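(* Define $v:[0,T]\times\mathbb{R}\times\mathbb{R}\to\mathbb{R}$ by $v(t,r,x)=x\,M(T-t,r)+\tilde G(t,r)$, where $$\tilde G(t,r)=\mu (T-t) M(T-t,r)+ \xi\int_0^{T-t} \int_{\alpha(u+t)}^\infty M(u,r)\,\bigl(1-M(T-u-t,z)\bigr)\,\varphi(z,u,r)\,dz\,du .$$ Then: (i) $v$ is the value function, i.e. $v(t,r,x)=V(t,r,x)$ for all $(t,r,x)\in[0,T]\times\mathbb{R}\times\mathbb{R}$. (ii) $v$ solves the Hamilton--Jacobi--Bellman equation $$v_t+\mu v_x+\frac{\sigma^2}{2}v_{xx}+a(b-r) v_r+\frac{\delta^2}{2} v_{rr}-rv+\sup_{0\le c\le\xi}c\,\{1-v_x\}=0$$ on $[0,T)\times\mathbb{R}\times\mathbb{R}$. (iii) The strategy $c^*=\{c^*_s\}$ with $c^*_s=\xi\,\mathbf{1}_{\{r_s>\alpha(s)\}}$ is optimal, i.e. it is admissible and $V^{c^*}(t,r,x)=V(t,r,x)$ for all $(t,r,x)$.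
   Context: Let $W=\{W_t\}$ and $B=\{B_t\}$ be independent standard Brownian motions on a probability space $(\Omega,\mathcal{F},\mathbb{P})$, and let $\{\mathcal{F}_t\}$ be the filtration generated by $(W,B)$, augmented with the $\mathbb{P}$-null sets. Fix constants $a,\delta,\sigma,\xi>0$, $b,\mu\in\mathbb{R}$, and a deterministic time horizon $T\in(0,\infty)$. Put $\tilde b:=b-\frac{\delta^2}{2a^2}$ and assume throughout $\tilde b>0$. Interest rate: $r$ is the Ornstein--Uhlenbeck process $dr_t=a(b-r_t)\,dt+\delta\,dB_t$. For $t\le s$ set $U_t^s:=\int_t^s r_u\,du$. A strategy is a process $c=\{c_s\}$ with values in $[0,\xi]$; it is admissible if it is adapted to $\{\mathcal{F}_t\}$. The set of admissible strategies is $\mathfrak{A}$. The post-dividend surplus $X^c$ satisfies $dX^c_s=(\mu-c_s)\,ds+\sigma\,dW_s$. It is not stopped at ruin and may become negative. Write $\mathbb{E}_{t,r,x}$ for expectation given $r_t=r$, $X^c_t=x$. Return function and value function: $$V^c(t,r,x)=\mathbb{E}_{t,r,x}\Bigl[\int_t^{T} e^{-U_{t}^s} c_s\,ds+e^{-U_{t}^T}X_{T}^c\Bigr],\qquad V(t,r,x)=\sup_{c\in\mathfrak A} V^c(t,r,x),$$ with $V(T,r,x)=x$. For $u\ge0$, $r\in\mathbb{R}$, let $M(u,r):=\mathbb{E}[e^{-U_0^u}\mid r_0=r]$, which is given explicitly by $$M(u,r)=e^{-\tilde b u}\exp\Bigl\{\frac{\tilde b-r}{a} (1-e^{-au})-\frac{\delta^2}{4a^3}(1-e^{-au})^2\Bigr\}.$$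 For $t\in[0,T)$ let $$\alpha(t):=\tilde b\Bigl(1-a\frac{T-t}{1-e^{-a(T-t)}}\Bigr)-\frac{\delta^2}{4a^2}\bigl(1-e^{-a(T-t)}\bigr),$$ and $\alpha(T):=0$ (the limit as $t\to T$). For $t<T$, $\alpha(t)$ is the unique $r$ with $M(T-t,r)=1$. For $u>0$ and $z,r\in\mathbb{R}$ let $$\varphi(z,u,r):=\frac1{\sqrt{2\pi \frac{\delta^2}{2a}(1-e^{-2au})}}\exp\left\{-\frac{\bigl(z-re^{-au}-b(1-e^{-au})+\frac{\delta^2}{2a^2}(1-e^{-au})^2\bigr)^2}{2\cdot\frac{\delta^2}{2a}(1-e^{-2au})}\right\}.$$ *)

(* Defs.v *)
From HB Require Import structures.
From mathcomp Require Import all_boot all_order all_algebra.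
From mathcomp Require Import all_classical all_reals all_analysis.

Set Implicit Arguments.
Unset Strict Implicit.
Unset Printing Implicit Defensive.

Import Order.TTheory GRing.Theory Num.Theory.
Import numFieldNormedType.Exports.

Local Open Scope classical_set_scope.
Local Open Scope ring_scope.

(* A process is a function [R -> Omega -> R] of which only the values at times
   [0 <= s] (or [t <= s] for a process started at [t]) are meaningful. *)

Section processes.
Context d (Omega : measurableType d) (R : realType) (P : probability Omega R).

Definition mutually_independent n (X : 'I_n -> Omega -> R) : Prop :=
  forall A : 'I_n -> set R, (forall i, measurable (A i)) ->
    P (\bigcap_(i in [set: 'I_n]) (X i @^-1` A i)) =
    (\prod_(i < n) P (X i @^-1` A i))%E.

(* [normal_prob m s] has standard deviation [s]. *)
Definition brownian_motion (W : R -> Omega -> R) : Prop :=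
  [/\ forall s, 0 <= s -> measurable_fun [set: Omega] (W s),
      {ae P, forall w, W 0 w = 0},
      forall w, {within `[0, +oo[, continuous (fun s => W s w)},
      forall s t, 0 <= s -> s < t -> forall A : set R, measurable A ->
        P ((fun w => W t w - W s w) @^-1` A) =
        normal_prob 0 (Num.sqrt (t - s)) A
    & forall n (tau : nat -> R),
        0 <= tau 0%N -> (forall i, tau i <= tau i.+1) ->
        mutually_independent
          (fun (i : 'I_n) w => W (tau i.+1) w - W (tau i) w)].

Definition path_events (W : R -> Omega -> R) (I : set R) : set (set Omega) :=
  [set E | exists u (A : set R),
             [/\ I u, measurable A & E = W u @^-1` A]].

Definition independent_processes (W B : R -> Omega -> R) : Prop :=
  forall E F : set Omega,
    <<s path_events W `[0, +oo[ >> E -> <<s path_events B `[0, +oo[ >> F ->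
    P (E `&` F) = (P E * P F)%E.

Definition augmented_filtration (W B : R -> Omega -> R) (s : R) :
    set (set Omega) :=
  <<s path_events W `[0, s] `|` path_events B `[0, s]
      `|` [set N | measurable N /\ P N = 0%E] >>.

(* Strong solution, started from [r0] at time [t], of
   dr_s = a (b - r_s) ds + delta dB_s.  As the noise is additive, the integral
   form of the equation involves no stochastic integral. *)
Definition OU_process (a b delta : R) (B : R -> Omega -> R) (t r0 : R)
    (r : R -> Omega -> R) : Prop :=
  [/\ forall s, t <= s -> measurable_fun [set: Omega] (r s),
      forall w, {within `[t, +oo[, continuous (fun s => r s w)}
    & {ae P, forall w, forall s, t <= s ->
        r s w = r0
                + \int[lebesgue_measure]_(u in `[t, s]) (a * (b - r u w))
                + delta * (B s w - B t w)}].

(* The class of admissible strategies for the problem started at time [t]; a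
   strategy is a (jointly) measurable process, so that the integrals of its
   paths are random variables. *)
Definition admissible (W B : R -> Omega -> R) (xi T t : R)
    (c : R -> Omega -> R) : Prop :=
  [/\ forall s w, t <= s <= T -> 0 <= c s w <= xi,
      measurable_fun (`[t, T] `*` [set: Omega])
        (fun p : R * Omega => c p.1 p.2)
    & forall s, t <= s <= T -> forall A : set R, measurable A ->
        augmented_filtration W B s (c s @^-1` A)].

Definition surplus (mu sigma : R) (W : R -> Omega -> R) (t x : R)
    (c : R -> Omega -> R) (s : R) (w : Omega) : R :=
  x + \int[lebesgue_measure]_(u in `[t, s]) (mu - c u w)
    + sigma * (W s w - W t w).

Definition integrated_rate (r : R -> Omega -> R) (t s : R) (w : Omega) : R :=
  \int[lebesgue_measure]_(u in `[t, s]) r u w.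

(* In the definitions below [rho t r] is the interest rate process started
   from [r] at time [t]: expectations given r_t = r, X_t = x are plain
   expectations for the processes [rho t r] and [surplus mu sigma W t x c]. *)

Definition return_function (rho : R -> R -> R -> Omega -> R)
    (W : R -> Omega -> R) (mu sigma T : R) (c : R -> Omega -> R)
    (t r x : R) : \bar R :=
  'E_P[(fun w =>
    (\int[lebesgue_measure]_(s in `[t, T])
       (expR (- integrated_rate (rho t r) t s w) * c s w)
     + expR (- integrated_rate (rho t r) t T w)
       * surplus mu sigma W t x c T w)%R)]%E.

Definition value_function (rho : R -> R -> R -> Omega -> R)
    (W B : R -> Omega -> R) (mu sigma xi T t r x : R) : \bar R :=
  ereal_sup [set return_function rho W mu sigma T c t r x
            | c in [set c | admissible W B xi T t c]].

Definition discount (rho : R -> R -> R -> Omega -> R) (u r : R) : R :=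
  fine 'E_P[(fun w => expR (- integrated_rate (rho 0 r) 0 u w)%R)]%E.

End processes.

Section candidate.
Context (R : realType).
Implicit Types (a b delta sigma xi mu T : R).

Definition btilde a b delta : R := b - delta ^+ 2 / (2 * a ^+ 2).

Definition alpha a b delta T (t : R) : R :=
  if t == T then 0 else
  btilde a b delta * (1 - a * ((T - t) / (1 - expR (- a * (T - t)))))
  - delta ^+ 2 / (4 * a ^+ 2) * (1 - expR (- a * (T - t))).

Definition phi_var a delta (u : R) : R :=
  delta ^+ 2 / (2 * a) * (1 - expR (- (2 * a * u))).

Definition phi a b delta (z u r : R) : R :=
  (Num.sqrt (2 * pi * phi_var a delta u))^-1 *
  expR (- ((z - r * expR (- a * u) - b * (1 - expR (- a * u))
            + delta ^+ 2 / (2 * a ^+ 2) * (1 - expR (- a * u)) ^+ 2) ^+ 2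
           / (2 * phi_var a delta u))).

Definition Gtilde (M : R -> R -> R) a b delta xi mu T (t r : R) : R :=
  mu * (T - t) * M (T - t) r
  + xi * \int[lebesgue_measure]_(u in `[0, T - t])
           \int[lebesgue_measure]_(z in `]alpha a b delta T (u + t), +oo[)
             (M u r * (1 - M (T - u - t) z) * phi a b delta z u r).

Definition candidate (M : R -> R -> R) a b delta xi mu T (t r x : R) : R :=
  x * M (T - t) r + Gtilde M a b delta xi mu T t r.

(* Derivative of [f] at [t] as a function on [D]: one-sided at an endpoint. *)
Definition has_derivative_on (D : set R) (f : R -> R) (t df : R) : Prop :=
  h^-1 * (f (t + h) - f t) @[h --> within [set h | D (t + h)] 0^'] --> df.

Definition solves_HJB a b delta sigma xi mu T (v : R -> R -> R -> R) : Prop :=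
  forall t r x : R, 0 <= t < T ->
  let vx := derive1 (fun y => v t r y) in
  let vr := derive1 (fun y => v t y x) in
  [/\ derivable (fun y => v t r y) x 1, derivable vx x 1,
      derivable (fun y => v t y x) r 1, derivable vr r 1
    & exists2 vt, has_derivative_on `[0, T] (fun s => v s r x) t vt &
      vt + mu * vx x + sigma ^+ 2 / 2 * derive1 vx x
      + a * (b - r) * vr r + delta ^+ 2 / 2 * derive1 vr r
      - r * v t r x
      + sup [set c * (1 - vx x) | c in `[0, xi]] = 0].

End candidate.

(* Main.v *)
(* The surplus is affine in x and its noise W is independent of the interest rate, so
   that V(t, r, x) is affine in x.  Since r solves a linear equation with additive noise,
   U_t^s and r_s are explicit functionals of B, and sums over partitions of [t, s] give the
   joint Laplace transform E[Y e^{-U_t^s} f(r_s)] for Y measurable at time t, without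
   stochastic integration.  This yields M and the Markov property, and with Fubini
     V^c(t, r, x) = (x + mu (T - t)) M(T - t, r)
                    + int_t^T E[c_s e^{-U_t^s} (1 - M(T - s, r_s))] ds,
   which is maximised pointwise by c_s = xi when M(T - s, r_s) < 1, that is r_s > alpha(s),
   and c_s = 0 otherwise.
   The HJB equation then is a computation on Gtilde.  Its inner integral has a
   Black-Scholes form k(L, u, r) = M(u, r) Phi(d1) - M(u + L, r) Phi(d2) with L = T - t - u
   and M(u, r) n(d1) = M(u + L, r) n(d2); as a function of (u, r) it solves the backward
   equation k_u = a (b - r) k_r + delta^2/2 k_rr - r k.  The boundary term at u = 0 in the
   derivative of the outer integral is (1 - M(T - t, r))^+, the maximum over c of
   c (1 - v_x) divided by xi. *)
Require Import Defs.
From HB Require Import structures.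
From mathcomp Require Import all_boot all_order all_algebra.
From mathcomp Require Import ring lra.
From mathcomp Require Import all_classical all_reals all_analysis.
From mathcomp Require Import measurable_realfun.
Import Order.TTheory GRing.Theory Num.Theory.
Import numFieldNormedType.Exports.
Local Open Scope classical_set_scope.
Local Open Scope ring_scope.

Set Implicit Arguments.
Unset Strict Implicit.
Unset Printing Implicit Defensive.

(** * Calculus *)

Section ode.
Variable R : realType.
Implicit Types (f g : R -> R).
Notation mu := lebesgue_measure.

(** Two limits shape the proof. On the probabilistic side, sums over partitions converge only path
    by path and their exponentials are unbounded; convergence of expectations comes from a bound on
    second moments, which is why the Laplace transform is proved first for bounded [Y] and [f].
    Double integrals over time and sample space are kept nonnegative, so that Tonelli applies
    without integrability; the sign of 1 - M is handled by comparing the integrals of c e^{-U} and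
    of c e^{-U} M. The noise of W contributes nothing because the discount factor agrees almost
    surely with a function of the path of B. On the analytic side, the closed form is singular at
    the ends of the range of u: the standard deviation of r_u behaves like the square root of u near
    0, so that its derivative is unbounded there, and the threshold is a quotient of two functions
    that vanish at L = 0. Hence the integrals over open intervals, the dominating functions that are
    integrable but not bounded, and the substitution u = tau y, under which differentiation in tau
    sets a factor y against the singularity. *)

Lemma is_derive_continuous f (x df : R) :
  is_derive x 1 f df -> {for x, continuous f}.
Proof.
move=> [d _]; apply: differentiable_continuous; exact/derivable1_diffP.
Qed.

(** Freezing [f] to the left of [t] makes a path that is continuous on [[t, +oo[] only into a
    function continuous everywhere, the form that the lemmas on integrals take. *)
Lemma continuous_within_maxl f t : {within `[t, +oo[, continuous f} ->
  continuous (fun u => f (Num.max t u)).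
Proof.
move=> /continuous_within_itvcyP[cf cft] u.
have cmax : {for u, continuous (fun u : R => Num.max t u)}.
  by apply: (@continuous_max _ _ (cst t) id u); [exact: cvg_cst|exact: cvg_id].
have [tu|ut|<-] := ltgtP t u.
- apply: continuous_comp cmax _.
  by rewrite (max_idPr (ltW tu)); apply: cf; rewrite in_itv/= tu.
- have : \forall z \near u, f t = f (Num.max t z).
    near=> z; rewrite (max_idPl _)// ltW//; near: z.
    exact: lt_nbhsl.
  move=> /near_eq_cvg H; rewrite /continuous_at (max_idPl (ltW ut)).
  by apply: cvg_trans H _; exact: cvg_cst.
- rewrite /continuous_at maxxx.
  apply/cvgrPdist_lt => e e0.
  have /cvgrPdist_lt/(_ e e0) := cft.
  rewrite near_withinE => H.
  near=> z.
  have [zt|tz] := leP z t.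
    by rewrite subrr normr0.

  move: tz; near: z; exact: H.
Unshelve. all: by end_near. Qed.

Lemma continuous_integrable f (s t : R) : continuous f ->
  mu.-integrable `[s, t] (EFin \o f).
Proof.
move=> cf; apply: continuous_compact_integrable; first exact: segment_compact.
exact: continuous_subspaceT.
Qed.

Lemma is_derive_integral f (t x : R) : continuous f -> t < x ->
  is_derive x 1 (fun z => \int[mu]_(u in `[t, z]) f u : R) (f x).
Proof.
move=> cf tx.
have x1 : x < x + 1 by rewrite ltrDl.
have [d e] := continuous_FTC1_closed x1 (continuous_integrable _ _ cf) tx (cf x).
apply: DeriveDef; first exact: d.
by rewrite -derive1E.
Qed.

Lemma continuous_integral f (t s : R) : continuous f -> t <= s ->
  {within `[t, s], continuous (fun z => \int[mu]_(u in `[t, z]) f u : R)}.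
Proof.
by move=> cf ts; apply: parameterized_integral_continuous => //; exact: continuous_integrable.
Qed.

Lemma FTC2_within f g (t s : R) : t < s -> continuous f ->
  {within `[t, s], continuous g} ->
  (forall x, t < x < s -> is_derive x 1 g (f x)) ->
  \int[mu]_(u in `[t, s]) f u = g s - g t.
Proof.
move=> ts cf cg dg.
rewrite /Rintegral (@continuous_FTC2 _ f g)//.
- exact: continuous_subspaceT.
- have /(continuous_within_itvP _ ts)[_ gl gr] := cg.
  split => // x; rewrite in_itv/= => /dg dgx; exact: ex_derive.
- by move=> x; rewrite in_itv/= => /dg dgx; rewrite derive1E derive_val.
Qed.

(** Integrating factor: with [Y] the primitive of [y], the derivative of [expR (a * z) * Y z] is
    [expR (a * z) * f z]. Since [f] need only be continuous, it may contain a Brownian path. *)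
Lemma linear_ode_integral (a t : R) (y f : R -> R) : continuous y -> continuous f ->
  (forall s, t <= s -> y s = f s - a * \int[mu]_(u in `[t, s]) y u) ->
  forall s, t <= s ->
  \int[mu]_(u in `[t, s]) y u = \int[mu]_(u in `[t, s]) (expR (- (a * (s - u))) * f u).
Proof.
move=> cy cf yE s; rewrite le_eqVlt => /predU1P[<-|ts].
  by rewrite set_itv1 !Rintegral_set1.
pose Y z := \int[mu]_(u in `[t, z]) y u : R.
have dE x : is_derive x (1 : R) (fun z : R => expR (a * z)) (a * expR (a * x)).
  by apply: is_derive_eq; rewrite /GRing.scale/= mulr1 mulrC.
have cexp : continuous (fun u : R => expR (a * u)).
  by move=> x; exact: is_derive_continuous (dE x).
have H : \int[mu]_(u in `[t, s]) (expR (a * u) * f u) = expR (a * s) * Y s - expR (a * t) * Y t.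
  apply: (@FTC2_within _ (fun z => expR (a * z) * Y z)) => //.
  - by move=> x; apply: cvgM; [exact: cexp|exact: cf].
  - move=> x; apply: cvgM.
      by apply: continuous_subspaceT.
    exact: (continuous_integral cy (ltW ts)).
  - move=> x /andP[tx xs].
    have := is_deriveM (dE x) (is_derive_integral cy tx).
    move/is_derive_eq; apply.
    rewrite (yE x (ltW tx)) -/(Y x) /GRing.scale/=; ring.
have Yt : Y t = 0 by rewrite /Y set_itv1 Rintegral_set1.
have -> : \int[mu]_(u in `[t, s]) (expR (- (a * (s - u))) * f u) =
    expR (- (a * s)) * \int[mu]_(u in `[t, s]) (expR (a * u) * f u).
  rewrite -RintegralZl//; last first.
    by apply: continuous_integrable => x; apply: cvgM; [exact: cexp|exact: cf].
  apply: eq_Rintegral => u _; rewrite mulrA -expRD; congr (expR _ * _); ring.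
by rewrite H Yt mulr0 subr0 mulrA -expRD addNr expR0 mul1r.
Qed.

(** Compactness in its near-covering form, with the radius as the parameter that tends to 0 from the
    right. Only [x] is confined to [[t, s]]. *)
Lemma heine_cantor f (t s eps : R) : continuous f -> 0 < eps ->
  exists2 d : R, 0 < d &
    forall x y : R, x \in `[t, s] -> `|x - y| < d -> `|f x - f y| < eps.
Proof.
move=> cf e0.
have := segment_compact (a := t) (b := s) => /compact_near_coveringP.
move=> /(_ R (0:R)^'+ (fun (d : R) (x : R) => forall y : R, `|x - y| < d -> `|f x - f y| < eps) _).
case.
  move=> x _.
  have /cvgrPdist_lt/(_ (eps / 2)) := cf x.
  move=> /(_ (divr_gt0 e0 (ltr0Sn _ 1))) [r /= r0 xr].
  exists (ball x (r / 2), [set d | d < r / 2]) => /=.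
    split; first by apply: nbhsx_ballx; rewrite divr_gt0.
    by apply: nbhs_right_lt; rewrite divr_gt0.
  move=> [z d] [/= xz dr] y zy.
  rewrite (splitr eps).
  have -> : f z - f y = (f x - f y) - (f x - f z) by ring.
  rewrite (le_lt_trans (ler_normB _ _))// ltrD//; apply: xr => /=.
    rewrite (splitr r) (_ : x - y = (x - z) + (z - y)); last by ring.
    rewrite (le_lt_trans (ler_normD _ _))// ltrD//.
    exact: lt_trans zy dr.
  by rewrite (lt_le_trans xz)//; move: r0; clear; lra.
move=> r /= r0 H.
exists (r / 2); first by rewrite divr_gt0.
move=> x y xts; apply: (H (r / 2)) => //=.
  by rewrite sub0r normrN gtr0_norm ?divr_gt0// ltr_pdivrMr// ltr_pMr// ltr1n.
by rewrite divr_gt0.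
Qed.

(** On each cell the integral of [f * g] is [f c] times the increment of [G] for some [c] in the
    cell; uniform continuity of [f] bounds what is lost by moving [c] to an endpoint. The number [e]
    selects the left (0) or the right (1) endpoint. *)
Lemma riemann_stieltjes_cvg (t s : R) f g (G : R -> R) (e : nat) : t < s ->
  continuous f -> continuous g -> (forall x, 0 < g x) ->
  (forall x : R, is_derive x 1 G (g x)) -> (e <= 1)%N ->
  let u n j := t + j%:R * ((s - t) / n.+1%:R) in
  (\sum_(j < n.+1) f (u n (j + e)%N) * (G (u n j.+1) - G (u n j))) @[n --> \oo] -->
  (\int[mu]_(x in `[t, s]) (f x * g x) : R).
Proof.
move=> ts cf cg g0 dG e1 u.
have cfg : continuous (fun x => f x * g x).
  by move=> x; apply: cvgM; [exact: cf|exact: cg].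
have cG : continuous G.
  by move=> x; exact: is_derive_continuous (dG x).
have GE x y : x <= y -> exists2 c, c \in `[x, y] & G y - G x = g c * (y - x).
  move=> xy; apply: (MVT_segment xy).
  exact: continuous_subspaceT.
have Ginc x y : x <= y -> G x <= G y.
  by move=> xy; have [c _ cE] := GE _ _ xy; rewrite -subr_ge0 cE mulr_ge0 ?subr_ge0// ltW.
pose H z := \int[mu]_(x in `[t, z]) (f x * g x) : R.
have Ht : H t = 0 by rewrite /H set_itv1 Rintegral_set1.
have ult n j : u n j < u n j.+1.
  rewrite /u ltrD2l ltr_pM2r ?ltr_nat//.
  by rewrite divr_gt0 ?subr_gt0// ltr0n.
have ule n : {homo u n : j k / (j <= k)%N >-> j <= k}.
  by apply: homo_leq => [x|y x z|j]; [exact: lexx|exact: le_trans|exact: ltW].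
have u0 n : u n 0%N = t by rewrite /u mul0r addr0.
have un n : u n n.+1 = s.
  by rewrite /u mulrCA divff ?mulr1 ?pnatr_eq0// addrC subrK.
have Gts : 0 < G s - G t + 1 by rewrite ltr_wpDl// subr_ge0 Ginc// ltW.
apply/cvgrPdist_le => eps eps0.
have eps' : 0 < eps / (G s - G t + 1) by rewrite divr_gt0.
have [d d0 Hd] := heine_cantor t s cf eps'.
have [N _ HN] : \forall n \near \oo, (s - t) / n.+1%:R < d.
  near=> n; rewrite ltr_pdivrMr// mulrC -ltr_pdivrMr//.
  by rewrite (lt_trans _ (_ : n%:R < n.+1%:R)) ?ltr_nat//; near: n; exact: nbhs_infty_gtr.
exists N => // n /= Nn.
have sum1 : H s = \sum_(j < n.+1) (H (u n j.+1) - H (u n j)).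
  rewrite -(big_mkord xpredT (fun j => H (u n j.+1) - H (u n j))) telescope_sumr//.
  by rewrite un u0 Ht subr0.
rewrite -/(H s) sum1 -sumrB.
rewrite (le_trans (ler_norm_sum _ _ _))//.
apply: (@le_trans _ _ (\sum_(j < n.+1) eps / (G s - G t + 1) * (G (u n j.+1) - G (u n j)))).
  apply: ler_sum => j _.
  have tu : t <= u n j by rewrite -(u0 n) ule.
  have us : u n j.+1 <= s by rewrite -(un n) ule.
  have itvS : `[u n j, u n j.+1]%classic `<=` `[t, s]%classic.
    by apply: subset_itv; rewrite bnd_simp.
  (* Cauchy's mean value theorem for the primitive [H] and for [G] yields a value of [f] alone, with
     the increment of [G] as its exact weight. *)
  have [c] : exists2 c, c \in `]u n j, u n j.+1[ & f c * g c / g c =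
      (H (u n j.+1) - H (u n j)) / (G (u n j.+1) - G (u n j)).
    apply: (cauchy_MVT (f := H) (df := fun x => f x * g x) (ult n j)).
    - apply: continuous_subspaceW itvS _.
      exact: (continuous_integral cfg (ltW ts)).
    - exact: continuous_subspaceT.
    - move=> x; rewrite in_itv/= => /andP[ux _].
      apply: is_derive_integral => //; exact: le_lt_trans ux.
    - by move=> x _; rewrite gt_eqF.
  move=> cu; rewrite mulfK ?gt_eqF// => fc.
  have G1 : 0 < G (u n j.+1) - G (u n j).
    have [c' _ ->] := GE _ _ (ltW (ult n j)).
    by rewrite mulr_gt0// subr_gt0.
  have -> : H (u n j.+1) - H (u n j) = f c * (G (u n j.+1) - G (u n j)).
    by rewrite fc divfK ?gt_eqF.
  rewrite -mulrBl normrM (gtr0_norm G1) ler_pM2r//.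
  move: cu; rewrite in_itv/= => /andP[c1 c2].
  apply: ltW; apply: Hd.
    by rewrite in_itv/= (le_trans tu (ltW c1)) (le_trans (ltW c2) us).
  apply: le_lt_trans (HN n Nn).
  have -> : (s - t) / n.+1%:R = u n j.+1 - u n j.
    by rewrite /u -(natr1 j); ring.
  case: e e1 => [_|[|//] _].
    by rewrite addn0 ger0_norm ?subr_ge0 ?(ltW c1)// lerD2r ltW.
  by rewrite addn1 distrC ger0_norm ?subr_ge0 ?(ltW c2)// lerD2l lerN2 ltW.
rewrite -mulr_sumr.
rewrite -(big_mkord xpredT (fun j => G (u n j.+1) - G (u n j))) telescope_sumr//.
rewrite un u0 mulrAC ler_pdivrMr// ler_pM2l//.
by rewrite lerDl.
Unshelve. all: by end_near. Qed.

End ode.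

(** * Independence and measurability of paths *)

Section measurability.
Context d (Omega : measurableType d) (R : realType).
Notation mu := lebesgue_measure.

(** The process is the pointwise limit of its values at the times [q n s], rounded down to multiples
    of 1/(n+1); each approximation has countably many time slices, so its preimages are countable
    unions of rectangles. *)
Lemma measurable_fun_path (X : R -> Omega -> R) :
  (forall w, continuous (X ^~ w)) -> (forall s, measurable_fun [set: Omega] (X s)) ->
  measurable_fun [set: R * Omega] (fun p => X p.1 p.2).
Proof.
move=> cX mX.
pose q (n : nat) (s : R) : R := (Num.floor (s * n.+1%:R))%:~R / n.+1%:R.
apply: (@measurable_fun_cvg _ _ R _ (fun n p => X (q n p.1) p.2)).
  move=> n _ A mA; rewrite setTI.
  pose F (k : int) : set (R * Omega) :=
    [set s : R | Num.floor (s * n.+1%:R) = k] `*` (X (k%:~R / n.+1%:R) @^-1` A).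
  have -> : (fun p : R * Omega => X (q n p.1) p.2) @^-1` A = \bigcup_k F k.
    apply/seteqP; split=> [[s w] /= As|[s w] [k _] [/= sk]].
      by exists (Num.floor (s * n.+1%:R)).
    by rewrite /q sk.
  apply: countable_bigcupT_measurable; first exact: countableP.
  move=> k; apply: measurableX; last first.
    by rewrite -[_ @^-1` _]setTI; exact: mX.
  have -> : [set s : R | Num.floor (s * n.+1%:R) = k] =
      `[k%:~R / n.+1%:R, (k + 1)%:~R / n.+1%:R[%classic.
    have n0 : 0 < n.+1%:R :> R by rewrite ltr0n.
    apply/seteqP; split => s /=; rewrite in_itv/= ler_pdivrMr// ltr_pdivlMr//.
      by move=> <-; exact: floor_itv.
    by move=> ks; apply/eqP; rewrite floor_eq.
  exact: measurable_itv.
move=> [s w] _ /=.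
have qs : q n s @[n --> \oo] --> s.
  apply/cvgrPdist_le => e e0; near=> n.
  have n0 : 0 < n.+1%:R :> R by rewrite ltr0n.
  have /andP[f1 f2] := floor_itv (s * n.+1%:R).
  rewrite /q; set k := _%:~R in f1 *.
  have -> : s - k / n.+1%:R = (s * n.+1%:R - k) / n.+1%:R.
    by rewrite mulrBl mulfK// gt_eqF.
  rewrite ger0_norm ?divr_ge0 ?subr_ge0 ?(ltW n0)//.
  rewrite ler_pdivrMr// (@le_trans _ _ 1)//.
    by rewrite lerBlDl; move: f2; rewrite intrD -/k addrC => /ltW.
  rewrite mulrC -ler_pdivrMr// mul1r.
  rewrite (@le_trans _ _ n%:R) ?ler_nat//.
  near: n; exact: nbhs_infty_ger.
exact: (cvg_comp _ _ qs (cX w s)).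
Unshelve. all: by end_near. Qed.

(** No integrability is assumed: the integral is [fine] of the difference of two Tonelli integrals,
    those of the positive and the negative part, and each is measurable in the parameter. *)
Lemma measurable_Rintegral_param (D : set R) (f : R * Omega -> R) :
  measurable D -> measurable_fun [set: R * Omega] f ->
  measurable_fun [set: Omega] (fun w => \int[mu]_(s in D) f (s, w) : R).
Proof.
move=> mD mf.
pose g (p : R * Omega) : \bar R := ((f p)%:E * (\1_D p.1)%:E)%E.
have mg : measurable_fun setT g.
  apply: emeasurable_funM; first exact/measurable_EFinP.
  apply/measurable_EFinP; apply: (measurableT_comp (measurable_indic mD)) => //.
have -> : (fun w => \int[mu]_(s in D) f (s, w)) =
    (fun w => fine (fubini_G mu g^\+ w - fubini_G mu g^\- w)).
  apply/funext => w; rewrite /Rintegral integral_mkcond.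
  rewrite (_ : (_ \_ D) = fun s => g (s, w)); last first.
    by apply/funext => s; rewrite patchE /g/= indicE; case: ifPn => _; rewrite ?mule1 ?mule0.
  by rewrite integralE /fubini_G; congr (fine (_ - _));
    apply: eq_integral => s _; rewrite ?funeposE ?funenegE.
apply: (measurableT_comp (fine_measurable measurableT)).
apply: emeasurable_funB.
  by apply: measurable_fun_fubini_tonelli_G => //; exact: measurable_funepos.
by apply: measurable_fun_fubini_tonelli_G => //; exact: measurable_funeneg.
Qed.

End measurability.

(** * Independence and passage to the limit in expectations *)

Section independence.
Context d d1 d2 (Omega : measurableType d) (T1 : measurableType d1)
  (T2 : measurableType d2) (R : realType) (P : probability Omega R).

(** Independence says that the law of the pair agrees with the product of the laws on rectangles,
    hence everywhere; Tonelli then integrates [Y] first. *)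
Lemma indep_integral (X : Omega -> T1) (Y : {mfun Omega >-> T2}) (h : T1 * T2 -> \bar R) :
  measurable_fun setT X ->
  (forall A B, measurable A -> measurable B ->
    P (X @^-1` A `&` Y @^-1` B) = P (X @^-1` A) * P (Y @^-1` B))%E ->
  measurable_fun setT h -> (forall z, 0 <= h z)%E ->
  (\int[P]_w h (X w, Y w) = \int[P]_w \int[distribution P Y]_y h (X w, y))%E.
Proof.
move=> mX indep mh h0.
pose X' : {mfun Omega >-> T1} := mfun_Sub (mem_set mX).
have mXY : measurable_fun setT (fun w => (X w, Y w)) by exact: measurable_fun_pair.
pose XY : {mfun Omega >-> (T1 * T2)%type} := mfun_Sub (mem_set mXY).
have <- : (\int[distribution P XY]_z h z = \int[P]_w h (X w, Y w))%E.
  by rewrite ge0_integral_distribution.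
transitivity (\int[(distribution P X' \x distribution P Y)%E]_z h z)%E.
  apply: eq_measure_integral => A mA _.
  apply/esym/(product_measure_unique (m' := distribution P XY)) => //.
rewrite fubini_tonelli1// ge0_integral_distribution//.
  exact: measurable_fun_fubini_tonelli_F.
by move=> x; apply: integral_ge0.
Qed.

(** As functions of [E] both sides are finite measures, the restriction of [P] to [F] and a multiple
    of [P]; they agree on a generating class that is stable under intersections and contains the
    whole space. *)
Lemma indep_sigma (G : set (set Omega)) (F : set Omega) :
  G `<=` measurable -> G setT -> setI_closed G -> measurable F ->
  (forall E, G E -> P (E `&` F) = P E * P F)%E ->
  forall E, <<s G >> E -> (P (E `&` F) = P E * P F)%E.
Proof.
move=> Gm GT GI mF GF E GE.
have PF0 : 0 <= fine (P F) by apply: fine_ge0.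
pose c := NngNum PF0.
have PFE : P F = (fine (P F))%:E by rewrite fineK// fin_num_measure.
have mc A : mscale c P A = (P A * P F)%E.
  by rewrite /mscale muleC; congr (_ * _)%E; exact/esym/PFE.
rewrite -mc.
rewrite -[LHS]/(mrestr P mF E).
apply: (g_sigma_algebra_measure_unique G Gm (fun=> setT)) => //.
- by rewrite bigcup_const.
- by move=> A GA; rewrite [RHS]mc; exact: GF.
- by move=> _; apply: le_lt_trans (ltry 1); apply: probability_le1; exact: measurableI.
Qed.

(** The bound on second moments gives uniform integrability. Fatou yields one inequality. For the
    other, Z_n is at most min(Z_n, K) + Z_n^2 / K; the truncated part converges by dominated
    convergence and the remainder has mean at most C / K. *)
Lemma cvg_expectation_L2 (Z_ : nat -> Omega -> R) (Z : Omega -> R) (C L : R) :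
  (forall n, measurable_fun setT (Z_ n)) -> (forall n w, 0 <= Z_ n w) ->
  (forall w, Z_ n w @[n --> \oo] --> Z w) ->
  (forall n, \int[P]_w (Z_ n w ^+ 2)%:E <= C%:E)%E ->
  (\int[P]_w (Z_ n w)%:E)%E @[n --> \oo] --> L%:E ->
  (\int[P]_w (Z w)%:E = L%:E)%E.
Proof.
move=> mZ_ Z_0 Z_Z Z2 ZL.
have mZ : measurable_fun setT Z by apply: measurable_fun_cvg mZ_ _ => w _; exact: Z_Z.
have Z0 w : 0 <= Z w.
  have -> : Z w = limn (Z_^~ w) by apply/esym/cvg_lim => //; exact: Z_Z.
  apply: limr_ge; first by apply/cvg_ex; exists (Z w); exact: Z_Z.
  by apply: nearW => n.
have C0 : 0 <= C.
  rewrite -lee_fin; apply: le_trans (Z2 0%N); apply: integral_ge0 => w _.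
  by rewrite lee_fin sqr_ge0.
pose m (K : R) (x : R) := Num.min x K.
have mm K (f : Omega -> R) : measurable_fun setT f -> measurable_fun setT (fun w => m K (f w)).
  by move=> mf; apply: measurable_minr => //.
have m0 K x : 0 <= K -> 0 <= x -> 0 <= m K x by move=> ? ?; rewrite /m le_min; apply/andP.
have trunc (K : R) : 0 < K ->
    (\int[P]_w (m K (Z_ n w))%:E)%E @[n --> \oo] --> (\int[P]_w (m K (Z w))%:E)%E.
  move=> K0.
  have [|||||_ _] // := @dominated_convergence _ _ _ P _ measurableT
    (fun n w => (m K (Z_ n w))%:E) (fun w => (m K (Z w))%:E) (fun=> K%:E).
  - by move=> n; apply/measurable_EFinP; exact: mm.
  - by apply/measurable_EFinP; exact: mm.
  - apply: aeW => w _; apply: cvg_EFin; first exact: nearW.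
    have := @continuous_min _ _ id (cst K) (Z w).
    have c1 : {for Z w, continuous (id : R -> R)} by exact: cvg_id.
    have c2 : {for Z w, continuous (cst K : R -> R)} by exact: cvg_cst.
    move=> /(_ c1 c2) c3.
    exact: (cvg_comp _ _ (Z_Z w) c3).
  - exact: finite_measure_integrable_cst.
  - apply: aeW => w n _; rewrite gee0_abs ?lee_fin ?m0 ?(ltW K0)//.
    by rewrite /m ge_min lexx orbT.
have mE (f : Omega -> R) : measurable_fun setT f -> measurable_fun setT (EFin \o f).
  by move=> mf; exact/measurable_EFinP.
apply/eqP; rewrite eq_le; apply/andP; split.
  have := @fatou _ _ _ P _ measurableT (fun n w => (Z_ n w)%:E) (fun n => mE _ (mZ_ n))
     (fun n w _ => Z_0 n w).
  rewrite (_ : limn_einf (fun n => \int[P]_w (Z_ n w)%:E)%E = L%:E); last first.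
    rewrite is_cvg_limn_einfE; last by apply/cvg_ex; exists L%:E.
    exact/cvg_lim.
  apply: le_trans; rewrite le_eqVlt; apply/orP; left; apply/eqP.
  apply: eq_integral => w _; apply/esym.
  have zw : (Z_ n w)%:E @[n --> \oo] --> (Z w)%:E.
    by apply: cvg_EFin; [exact: nearW|exact: Z_Z].
  rewrite is_cvg_limn_einfE; last by apply/cvg_ex; exists (Z w)%:E.
  exact/cvg_lim.
apply/lee_addgt0Pr => e e0.
(* Chosen so that C / K is at most [e]; the added 1 keeps [K] positive when [C] is 0. *)
pose K := (C + 1) / e.
have K0 : 0 < K by rewrite divr_gt0// ltr_wpDl.
apply: (@le_trans _ _ (\int[P]_w (m K (Z w))%:E + e%:E)%E); last first.
  apply: leeD2r; apply: ge0_le_integral => //.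
  - by move=> w _; rewrite lee_fin m0// ltW.
  - by apply: mE; exact: mm.
  - by apply: mE.
  - by move=> w _; rewrite lee_fin /m ge_min lexx.
have LE : (L%:E = limn (fun n => \int[P]_w (Z_ n w)%:E))%E by apply/esym/cvg_lim.
have TE : (\int[P]_w (m K (Z_ n w))%:E + e%:E)%E @[n --> \oo] -->
   (\int[P]_w (m K (Z w))%:E + e%:E)%E.
  apply: cvgeD; [exact: fin_num_adde_defl|exact: trunc|exact: cvg_cst].
rewrite LE -(cvg_lim _ TE)//; apply: lee_lim.
- by apply/cvg_ex; exists L%:E.
- exact: cvgP TE.
apply: nearW => n.
apply: (@le_trans _ _ (\int[P]_w ((m K (Z_ n w))%:E + (K^-1 * Z_ n w ^+ 2)%:E))%E).
  apply: ge0_le_integral => //.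
  - by move=> w _; rewrite lee_fin.
  - exact: mE.
  - apply: emeasurable_funD; apply: mE; first exact: mm.
    by apply: measurable_funM => //; exact: measurable_funX.
  - move=> w _; rewrite -EFinD lee_fin /m.
    have [ZK|KZ] := leP (Z_ n w) K.
      by rewrite lerDl mulr_ge0 ?invr_ge0 ?sqr_ge0// ltW.
    rewrite -[leLHS]add0r lerD ?(ltW K0)//.
    by rewrite mulrC ler_pdivlMr// expr2 ler_wpM2l// ltW.
rewrite ge0_integralD//; last 4 first.
- by move=> w _; rewrite lee_fin m0// ltW.
- by apply: mE; exact: mm.
- by move=> w _; rewrite lee_fin mulr_ge0 ?invr_ge0 ?sqr_ge0// ltW.
- by apply: mE; apply: measurable_funM => //; exact: measurable_funX.
apply: leeD2l.
under eq_integral do rewrite EFinM.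
rewrite ge0_integralZl//; last 3 first.
- by apply: mE; exact: measurable_funX.
- by move=> w _; rewrite lee_fin sqr_ge0.
- by rewrite lee_fin invr_ge0 ltW.
apply: (@le_trans _ _ (K^-1%:E * C%:E)%E).
  by apply: lee_wpmul2l => //; rewrite lee_fin invr_ge0 ltW.
rewrite -EFinM lee_fin /K invf_div mulrAC ler_pdivrMr ?ltr_wpDl//.
by rewrite mulrDr mulr1 lerDl ltW.
Qed.

End independence.

(** * Brownian increments and the augmented filtration *)

Section filtration.
Context d (Omega : measurableType d) (R : realType) (P : probability Omega R).
Implicit Types (W B : R -> Omega -> R).

Lemma sub_sigma_measurable (G : set (set Omega)) :
  G `<=` measurable -> <<s G >> `<=` measurable.
Proof.
by move=> Gm; apply: smallest_sub => //; exact: sigma_algebra_measurable.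
Qed.

Lemma path_events_measurable W (I : set R) :
  (forall s, I s -> measurable_fun setT (W s)) ->
  <<s path_events W I >> `<=` measurable.
Proof.
move=> mW; apply: sub_sigma_measurable => E [u [A [Iu mA ->]]].
by rewrite -[_ @^-1` _]setTI; exact: mW.
Qed.

Lemma ae_eq_measure (E E' : set Omega) : measurable E -> measurable E' ->
  {ae P, forall w, E w <-> E' w} -> P E = P E'.
Proof.
move=> mE mE' EE'.
have <- := setIT E; have <- := setIT E'.
rewrite -!integral_indic//.
apply: ae_eq_integral => //.
- exact/measurable_EFinP/measurable_indic.
- exact/measurable_EFinP/measurable_indic.
apply: filterS EE' => w EE' _; rewrite !indicE.
by congr ((nat_of_bool _)%:R%:E); apply/idP/idP; rewrite !inE => /EE'.
Qed.

(** The intersection-stable class behind the sigma-algebra of a path. The sets [A] are indexed by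
    times and not by positions in [s], so that concatenating two lists describes an intersection
    even when they share times. *)
Definition finite_cylinders W (I : set R) : set (set Omega) :=
  [set E | exists (s : seq R) (A : R -> set R),
    [/\ {in s, forall x, I x}, forall x, measurable (A x)
      & E = \bigcap_(x in [set` s]) (W x @^-1` A x)]].

Lemma finite_cylinders_setI W I : setI_closed (finite_cylinders W I).
Proof.
move=> _ _ [s [A [sI mA ->]]] [s' [A' [sI' mA' ->]]].
exists (s ++ s'), (fun x => (if x \in s then A x else setT) `&`
                            (if x \in s' then A' x else setT)); split.
- by move=> x; rewrite mem_cat => /orP[/sI|/sI'].
- by move=> x; apply: measurableI; case: ifP.
apply/seteqP; split=> w /=.
  move=> [H H'] x /=; rewrite mem_cat => _; split.
    by case: ifPn => // xs; exact: H.
  by case: ifPn => // xs; exact: H'.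
move=> H; split=> x /= xs; have /= := H x; rewrite mem_cat xs ?orbT.
  by move=> /(_ isT)[].
by move=> /(_ isT)[].
Qed.

Lemma path_events_sub_cylinders W I : path_events W I `<=` finite_cylinders W I.
Proof.
move=> E [u [A [Iu mA ->]]]; exists [:: u], (fun=> A); split => //.
  by move=> x; rewrite inE => /eqP ->.
apply/seteqP; split=> w /=; first by move=> Aw x /=; rewrite inE => /eqP ->.
by move=> /(_ u); apply; rewrite /= inE.
Qed.

Section brownian.
Variable B : R -> Omega -> R.
Hypothesis B_brownian : brownian_motion P B.

Let mB s : 0 <= s -> measurable_fun setT (B s).
Proof. by case: B_brownian => + _ _ _ _; exact. Qed.

Let incr (tau : nat -> R) i w := B (tau i.+1) w - B (tau i) w.

(** Mutual independence of [n] and of [n.+1] increments, compared: the last factor splits off on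
    intersections of preimages, which generate the sigma-algebra of the earlier increments. *)
Lemma increment_indep_past (tau : nat -> R) n (E : set Omega) A :
  0 <= tau 0%N -> (forall i, tau i <= tau i.+1) -> measurable A ->
  <<s [set F | exists i C, [/\ (i < n)%N, measurable C & F = incr tau i @^-1` C]] >> E ->
  (P (E `&` incr tau n @^-1` A) = P E * P (incr tau n @^-1` A))%E.
Proof.
move=> tau0 tauS mA GE.
have tau_ge0 i : 0 <= tau i by elim: i => // i IH; exact: le_trans (tauS i).
have mincr i : measurable_fun setT (incr tau i).
  by apply: measurable_funB; exact: mB.
have [_ _ _ _ indep] := B_brownian.
pose G := [set F | exists C : nat -> set R, (forall i, measurable (C i)) /\
  F = \bigcap_(i in [set: 'I_n]) (incr tau i @^-1` C i)].
apply: (@indep_sigma _ _ _ _ G).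
- move=> F [C [mC ->]]; apply: fin_bigcap_measurable; first exact: finite_finset.
  by move=> i _; rewrite -[_ @^-1` _]setTI; exact: mincr.
- exists (fun=> setT); split => //.
  by apply/seteqP; split => // w _ i.
- move=> _ _ [C [mC ->]] [C' [mC' ->]]; exists (fun i => C i `&` C' i); split.
    by move=> i; exact: measurableI.
  apply/seteqP; split=> w /=; first by move=> [H H'] i _; split; [exact: H|exact: H'].
  by move=> H; split => i _; have [] := H i I.
- by rewrite -[_ @^-1` _]setTI; exact: mincr.
- move=> F [C [mC ->]].
  pose C' i := if (i < n)%N then C i else A.
  have mC' i : measurable (C' i) by rewrite /C'; case: ifP.
  have := indep n.+1 tau tau0 tauS (fun i => C' i) (fun i => mC' i).
  have := indep n tau tau0 tauS (fun i => C i) (fun i => mC i).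
  rewrite -/(incr tau) => -> .
  rewrite big_ord_recr /= {3}/C' ltnn.
  under [X in _ = (X * _)%E -> _]eq_bigr => i _ do rewrite /C' ltn_ord.
  move=> <-; congr (P _); apply/seteqP; split=> w /=.
    move=> [H HA] i _; rewrite /C'; case: ifPn => [ilt|]; first exact: (H (Ordinal ilt)).
    rewrite -leqNgt => ni; have -> : i = n :> nat by apply/eqP; rewrite eqn_leq ni -ltnS ltn_ord.
    exact: HA.
  move=> H; split.
    by move=> i _; have := H (widen_ord (leqnSn n) i) I; rewrite /C' /= ltn_ord.
  by have := H ord_max I; rewrite /C' /= ltnn.
- apply: (@sub_sigma_algebra2 _ _ _ _ _ E GE).
  move=> F [i [C [i_n mC ->]]]; exists (fun j => if j == i then C else setT); split.
    by move=> j; case: ifP.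
  apply/seteqP; split=> w /=.
    by move=> Cw j _ /=; case: eqP => // ->.
  by move=> /(_ (Ordinal i_n) I) /=; rewrite eqxx.
Qed.

(** Brownian motion is defined through increments, whereas the past is generated by values. Along a
    time grid that starts at 0 and contains the times of a cylinder, each value is a sum of
    increments, up to the null set where B_0 is not 0. *)
Lemma increment_indep_paths (u v : R) (E : set Omega) A :
  0 <= u -> u <= v -> measurable A -> <<s path_events B `[0, u] >> E ->
  (P (E `&` (fun w => (B v w - B u w)%R) @^-1` A) =
   P E * P ((fun w => (B v w - B u w)%R) @^-1` A))%E.
Proof.
move=> u0 uv mA GE.
have v0 := le_trans u0 uv.
have mF : measurable ((fun w => (B v w - B u w)%R) @^-1` A).
  by rewrite -[_ @^-1` _]setTI; apply: measurable_funB => //; exact: mB.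
apply: (@indep_sigma _ _ _ _ (finite_cylinders B `[0, u])) => //; last first.
  exact: (sub_sigma_algebra2 (@path_events_sub_cylinders B _) GE).
- move=> {GE}E [s [C [sI mC ->]]].
  have sge0 x : x \in s -> 0 <= x by move=> /sI /=; rewrite in_itv => /andP[].
  have sleu x : x \in s -> x <= u by move=> /sI /=; rewrite in_itv => /andP[].
  (* B_0 = 0 holds almost surely only, so the cylinder is replaced by the version built from B_x -
     B_0, which differs from it by a null set. *)
  pose E' := \bigcap_(x in [set` s]) ((fun w => B x w - B 0 w) @^-1` C x).
  set F := (X in P X = _).
  have ms x (D : set R) : x \in s -> measurable D -> measurable (B x @^-1` D).
    by move=> xs mD; rewrite -[_ @^-1` _]setTI; apply: mB => //; exact: sge0.
  pose l := sort <=%R s.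
  (* The default [v] makes the sequence constant after the list ends, hence nondecreasing forever;
     the increment of index [(size l).+1] then runs from [u] to [v]. *)
  pose tau := nth v (0 :: rcons l u).
  have taun : tau (size l).+1 = u by rewrite /tau /= nth_rcons ltnn eqxx.
  have taun1 : tau (size l).+2 = v by rewrite /tau /= nth_default// size_rcons.
  have tau_le_v i : tau i <= v.
    have [iL|iL] := ltnP i (size (0 :: rcons l u)); last by rewrite /tau nth_default.
    have := mem_nth v iL; rewrite -/(tau i) inE mem_rcons inE mem_sort.
    by case/or3P => [/eqP->//|/eqP->//|/sleu ix]; exact: le_trans uv.
  have tau_sorted i : tau i <= tau i.+1.
    have [iL|iL] := ltnP i.+1 (size (0 :: rcons l u)); last first.
      by rewrite {2}/tau nth_default.
    have : sorted <=%R (0 :: rcons l u).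
      rewrite /= rcons_path; apply/andP; split.
        rewrite path_min_sorted; first exact: sort_le_sorted.
        by apply/allP => x; rewrite mem_sort => /sge0.
      have := mem_last 0 l; rewrite inE => /orP[/eqP->//|].
      by rewrite mem_sort; exact: sleu.
    by move/(sortedP v) => /(_ i iL).
  have E'G : <<s [set F | exists i C, [/\ (i < (size l).+1)%N, measurable C &
      F = incr tau i @^-1` C]] >> E'.
    set G := (X in <<s X >>).
    apply: (@fin_bigcap_measurable _ (g_sigma_algebraType G)); first exact: finite_seq.
    move=> x xs.
    have xl : x \in l by rewrite mem_sort.
    pose k := (index x l).+1.
    have taux : tau k = x.
      by rewrite /tau /= nth_rcons index_mem xl nth_index.
    rewrite (_ : (fun w => B x w - B 0 w) = (fun w => \sum_(i < k) incr tau i w)); last first.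
      apply/funext => w.
      rewrite -(big_mkord xpredT (fun i => incr tau i w)) telescope_sumr// taux.
      by congr (_ - B _ _).
    rewrite -[_ @^-1` _]setTI.
    apply: (measurable_sum (T := g_sigma_algebraType G)) => // i.
    move=> _ D mD; rewrite setTI; apply: sub_sigma_algebra; exists i, D; split => //.
    by rewrite (leq_trans (ltn_ord i))// ltnS index_size.
  have tau0 : 0 <= tau 0%N by [].
  have := increment_indep_past tau0 tau_sorted mA E'G.
  rewrite /incr taun taun1 => H.
  have mE : measurable (\bigcap_(x in [set` s]) (B x @^-1` C x)).
    by apply: fin_bigcap_measurable; [exact: finite_seq|move=> x xs; exact: ms].
  have mE' : measurable E'.
    apply: fin_bigcap_measurable; first exact: finite_seq.
    move=> x xs; rewrite -[_ @^-1` _]setTI.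
    by apply: measurable_funB => //; apply: mB => //; exact: sge0.
  have EE' : {ae P, forall w, (\bigcap_(x in [set` s]) (B x @^-1` C x)) w <-> E' w}.
    have [_ B0 _ _ _] := B_brownian.
    apply: filterS B0 => w B0; split=> H' x xs; have := H' x xs.
      by rewrite /= B0 subr0.
    by rewrite /= B0 subr0.
  rewrite (ae_eq_measure mE mE' EE') -H; apply: ae_eq_measure.
  - exact: measurableI.
  - exact: measurableI.
  by apply: filterS EE' => w EE'; split=> -[/EE'].
- exact: finite_cylinders_setI.
- exists [::], (fun=> setT); split => //.
  by apply/seteqP; split => // w _ i.
- move=> E' [s [C [sI mC ->]]].
  apply: fin_bigcap_measurable; first exact: finite_seq.
  move=> x xs; rewrite -[_ @^-1` _]setTI; apply: mB => //.
  by have /= := sI x xs; rewrite in_itv => /andP[].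
Qed.

End brownian.

Definition filtration_events W B (u : R) : set (set Omega) :=
  path_events W `[0, u] `|` path_events B `[0, u]
  `|` [set N | measurable N /\ P N = 0%E].

(** The filtration is generated by the intersections of an event of W with an event of B, together
    with the null sets. For such an intersection, the independence of W and B is used to split off
    the W event, and the independent increments of B do the rest. *)
Lemma increment_indep_filtration W B (u v : R) (E : set Omega) A :
  brownian_motion P W -> brownian_motion P B -> independent_processes P W B ->
  0 <= u -> u <= v -> measurable A -> augmented_filtration P W B u E ->
  (P (E `&` (fun w => (B v w - B u w)%R) @^-1` A) =
   P E * P ((fun w => (B v w - B u w)%R) @^-1` A))%E.
Proof.
move=> W_brownian B_brownian WB u0 uv mA GE.
have v0 := le_trans u0 uv.
have mW s : 0 <= s -> measurable_fun setT (W s).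
  by case: W_brownian => + _ _ _ _; exact.
have mB s : 0 <= s -> measurable_fun setT (B s).
  by case: B_brownian => + _ _ _ _; exact.
set F := (X in P (_ `&` X)).
have mF : measurable F.
  by rewrite /F -[_ @^-1` _]setTI; apply: measurable_funB => //; exact: mB.
pose Nulls := [set N : set Omega | measurable N /\ P N = 0%E].
pose G := [set E1 `&` E2 | E1 in <<s path_events W `[0, u] >> & E2 in <<s path_events B `[0, u] >>]
  `|` Nulls.
have mWu : <<s path_events W `[0, u] >> `<=` measurable.
  by apply: path_events_measurable => s /=; rewrite in_itv/= => /andP[s0 _]; exact: mW.
have mBu : <<s path_events B `[0, u] >> `<=` measurable.
  by apply: path_events_measurable => s /=; rewrite in_itv/= => /andP[s0 _]; exact: mB.
have sGT (G0 : set (set Omega)) : <<s G0 >> setT.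
  exact: (@measurableT _ (g_sigma_algebraType G0)).
have sGI (G0 : set (set Omega)) : setI_closed <<s G0 >>.
  exact: (@measurableI _ (g_sigma_algebraType G0)).
have Gm : G `<=` measurable.
  move=> _ [[E1 GE1 [E2 GE2 <-]]|[]//].
  by apply: measurableI; [exact: mWu|exact: mBu].
have null_setI N A' : P N = 0%E -> measurable N -> measurable A' -> P (N `&` A') = 0%E.
  move=> N0 mN mA'; apply/eqP; rewrite eq_le measure_ge0 andbT -N0.
  by apply: le_measure; rewrite ?inE//; exact: measurableI.
apply: (@indep_sigma _ _ _ _ G) => //.
- by left; exists setT => //; exists setT => //; rewrite setTI.
- move=> N N' [[E1 GE1 [E2 GE2 <-]]|[mN N0]] [[E1' GE1' [E2' GE2' <-]]|[mN' N0']].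
  + left; exists (E1 `&` E1'); first exact: sGI.
    by exists (E2 `&` E2'); [exact: sGI|rewrite setIACA].
  + right; rewrite setIC; split; last apply: null_setI => //.
      by apply: measurableI => //; apply: measurableI; [exact: mWu|exact: mBu].
    by apply: measurableI; [exact: mWu|exact: mBu].
  + right; split; last apply: null_setI => //.
      by apply: measurableI => //; apply: measurableI; [exact: mWu|exact: mBu].
    by apply: measurableI; [exact: mWu|exact: mBu].
  + by right; split; [exact: measurableI|exact: null_setI].
- move=> N [[E1 GE1 [E2 GE2 <-]]|[mN N0]]; last by rewrite N0 mul0e null_setI.
  have subI W' : <<s path_events W' `[0, u] >> `<=` <<s path_events W' `[0, +oo[ >>.
    apply: sub_sigma_algebra2 => _ [s [D [su mD ->]]]; exists s, D; split => //.
    by move: su; rewrite /= !in_itv/= => /andP[-> _].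
  have GF : <<s path_events B `[0, +oo[ >> F.
    rewrite /F -[_ @^-1` _]setTI.
    apply: (@measurable_funB _ (g_sigma_algebraType (path_events B `[0, +oo[))) => //.
      move=> _ D mD; rewrite setTI; apply: sub_sigma_algebra.
      by exists v, D; split => //=; rewrite in_itv/= v0.
    move=> _ D mD; rewrite setTI; apply: sub_sigma_algebra.
    by exists u, D; split => //=; rewrite in_itv/= u0.
  rewrite -setIA WB//; last 2 first.
  + exact: subI.
  + by apply: sGI => //; exact: subI.
  rewrite (increment_indep_paths B_brownian u0 uv mA GE2) WB//; last 2 first.
  + exact: subI.
  + exact: subI.
  by rewrite muleA.
- apply: sub_sigma_algebra2 GE => E0 [[GE0|GE0]|]; last by right.
  + left; exists E0; first exact: sub_sigma_algebra.
    by exists setT => //; rewrite setIT.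
  + left; exists setT => //; exists E0; first exact: sub_sigma_algebra.
    by rewrite setTI.
Qed.

End filtration.

(** * Gaussian expectations *)

Section gaussian.
Context (R : realType).
Notation mu := (@lebesgue_measure R).
Local Open Scope ereal_scope.

(** The scaled image of Lebesgue measure under the affine map gives each half-open interval its
    length, hence is Lebesgue measure. This asks only measurability and sign of [f]. *)
Lemma lebesgue_integral_affine (m s : R) (f : R -> \bar R) :
  (0 < s)%R -> measurable_fun setT f -> (forall x, 0 <= f x) ->
  \int[mu]_x f x = s%:E * \int[mu]_x f (m + s * x)%R.
Proof.
move=> s0 mf f0.
pose phi x : R := (m + s * x)%R.
have mphi : measurable_fun setT phi by apply: measurable_funD => //; exact: measurable_funM.
pose c := NngNum (ltW s0).
pose pmu : {measure set (measurableTypeR R) -> \bar R} :=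
  measure_function_pushforward__canonical__measure_function_Measure mu
    (mphi : @measurable_fun _ _ (measurableTypeR R) (measurableTypeR R) setT phi).
pose nu : {measure set (measurableTypeR R) -> \bar R} := mscale c pmu.
have nuE A : measurable A -> mu A = nu A.
  move=> mA; apply: (@lebesgue_measure_unique R nu _ A mA) => _ [[a b] _ <-].
  transitivity (s%:E * mu (phi @^-1` `]a, b]%classic)); last by [].
  have -> : phi @^-1` `]a, b]%classic = `]((a - m) / s)%R, ((b - m) / s)%R]%classic.
    apply/seteqP; split => x /=; rewrite !in_itv/= /phi ltr_pdivrMr// ler_pdivlMr//.
      by rewrite ltrBlDl lerBrDl mulrC.
    by rewrite ltrBlDl lerBrDl mulrC.
  rewrite !lebesgue_measure_itv/= !lte_fin ltr_pM2r ?invr_gt0// ltrD2r.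
  case: ifPn => _; last by rewrite mule0.
  by rewrite -!EFinB -EFinM; congr EFin; field; rewrite gt_eqF.
transitivity (\int[nu]_x f x).
  by apply: eq_measure_integral => A mA _; exact: nuE.
rewrite /nu ge0_integral_mscale//; congr (_ * _).
by rewrite ge0_integral_pushforward.
Qed.

(** The Radon-Nikodym derivative of the normal law has the same integrals over measurable sets as
    [normal_pdf], so the two agree almost everywhere. *)
Lemma ge0_integral_normal_prob (m s : R) (f : R -> \bar R) :
  measurable_fun setT f -> (forall x, 0 <= f x) ->
  \int[normal_prob m s]_x f x = \int[mu]_x (f x * (normal_pdf m s x)%:E).
Proof.
move=> mf f0.
have dom := normal_prob_dominates m s.
rewrite -(Radon_Nikodym_SigmaFinite.change_of_variables dom)//.
apply: ae_eq_integral => //.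
- apply: emeasurable_funM => //.
  exact: measurable_int (Radon_Nikodym_SigmaFinite.f_integrable dom).
- apply: emeasurable_funM => //; apply/measurable_EFinP.
  exact: measurable_normal_pdf.
have : ae_eq mu setT (Radon_Nikodym_SigmaFinite.f (normal_prob m s) mu)
    (fun x => (normal_pdf m s x)%:E).
  apply: integral_ae_eq => //.
  - exact: Radon_Nikodym_SigmaFinite.f_integrable.
  - by apply/measurable_EFinP; exact: measurable_normal_pdf.
  - by move=> E _ mE; rewrite -Radon_Nikodym_SigmaFinite.f_integral.
by apply: filterS => x + _; move=> ->.
Qed.

Lemma normal_pdf_affine (m s z : R) : (0 < s)%R ->
  (s * normal_pdf m s (m + s * z) = normal_pdf 0 1 z)%R.
Proof.
move=> s0; rewrite !normal_pdfE ?oner_neq0 ?gt_eqF// /normal_peak /normal_fun.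
rewrite mulrA; congr (_ * expR _)%R; last by field; rewrite gt_eqF.
rewrite -mulrnAr sqrtrM ?sqr_ge0// sqrtr_sqr gtr0_norm//.
by rewrite expr1n mul1r invfM mulrA mulfV ?gt_eqF// mul1r.
Qed.

Lemma gaussian_peakM (v w p : R) : (v + w != 0)%R ->
  ((v * p *+ 2) * (1 * p *+ 2) = ((v + w) * p *+ 2) * (v / (v + w) * p *+ 2))%R.
Proof. by move=> vw; field. Qed.

(** Completing the square in [x]: the density of [y] given [x] times that of [x] is the density of
    [y] times that of [x] given [y]. [gaussian_peakM] is the same factorisation for the normalising
    constants. *)
Lemma gaussian_exponentD (v k x y m : R) : (v != 0)%R -> (v + k ^+ 2 != 0)%R ->
  (- (y - (m + k * x)) ^+ 2 / (v *+ 2) + - (x - 0) ^+ 2 / (1 *+ 2) =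
   - (y - m) ^+ 2 / ((v + k ^+ 2) *+ 2)
   + - (x - k * (y - m) / (v + k ^+ 2)) ^+ 2 / (v / (v + k ^+ 2) *+ 2))%R.
Proof. by move=> v0 vk; field; rewrite vk v0. Qed.

(** The expectation of [f] under N(m, v), as an integral against the standard normal law: [v] = 0
    gives the point mass at [m], and limits in [m] and [v] are limits of integrands under a fixed
    measure. *)
Definition gaussE (f : R -> \bar R) (m v : R) : \bar R :=
  \int[normal_prob 0 1]_z f (m + Num.sqrt v * z)%R.

Lemma gaussE_ge0 f m v : (forall x, 0 <= f x) -> 0 <= gaussE f m v.
Proof. by move=> f0; apply: integral_ge0. Qed.

Lemma measurable_gaussE f v : (forall x, 0 <= f x) -> measurable_fun setT f ->
  measurable_fun setT (gaussE f ^~ v).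
Proof.
move=> f0 mf.
pose h (p : R * R) := f (p.1 + Num.sqrt v * p.2)%R.
have mh : measurable_fun setT h.
  apply: measurableT_comp => //; apply: measurable_funD => //.
  exact: measurable_funM.
by apply: (measurable_fun_fubini_tonelli_F (m2 := normal_prob 0 1) h mh) => p; exact: f0.
Qed.

Lemma gaussE_pdf f m s : (0 < s)%R -> (forall x, 0 <= f x) -> measurable_fun setT f ->
  gaussE f m (s ^+ 2) = \int[mu]_x (f x * (normal_pdf m s x)%:E).
Proof.
move=> s0 f0 mf.
rewrite (lebesgue_integral_affine m s0); last 2 first.
- by apply: emeasurable_funM => //; apply/measurable_EFinP; exact: measurable_normal_pdf.
- by move=> x; rewrite mule_ge0// lee_fin normal_pdf_ge0.
have maff : measurable_fun setT (fun x : R => m + s * x)%R.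
  by apply: measurable_funD => //; exact: measurable_funM.
rewrite /gaussE ge0_integral_normal_prob//; last first.
  apply: measurableT_comp => //.
  by apply: measurable_funD => //; exact: measurable_funM.
rewrite -ge0_integralZl//; last 3 first.
- apply: emeasurable_funM; first exact: measurableT_comp.
  apply/measurable_EFinP; apply: measurableT_comp maff => //; exact: measurable_normal_pdf.
- by move=> x _; rewrite mule_ge0// lee_fin normal_pdf_ge0.
- by rewrite lee_fin ltW.
apply: eq_integral => z _.
by rewrite sqrtr_sqr gtr0_norm// muleCA -EFinM normal_pdf_affine.
Qed.

Lemma normal_pdf_tilt (m s p x : R) : (s != 0)%R ->
  (expR (p * x) * normal_pdf m s x =
   expR (p * m + p ^+ 2 * s ^+ 2 / 2) * normal_pdf (m + p * s ^+ 2) s x)%R.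
Proof.
move=> s0; rewrite !normal_pdfE// /normal_fun mulrCA [RHS]mulrCA -!expRD.
by congr (_ * expR _)%R; field.
Qed.

(** The effect of one Brownian increment of variance [h]: the exponential weight contributes the
    factor e^{p^2 h / 2} and moves the mean of the increment from 0 to [p * h]. *)
Lemma normal_prob_tilt (f : R -> \bar R) (y p q h : R) :
  (0 < q)%R -> (0 < h)%R -> (forall x, 0 <= f x) -> measurable_fun setT f ->
  \int[normal_prob 0 (Num.sqrt h)]_x ((expR (p * x))%:E * f (y + q * x)%R) =
  (expR (p ^+ 2 * h / 2))%:E * gaussE f (y + q * (p * h)) (q ^+ 2 * h).
Proof.
move=> q0 h0 f0 mf.
have maff : measurable_fun setT (fun x : R => y + q * x)%R.
  by apply: measurable_funD => //; exact: measurable_funM.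
have mexp : measurable_fun setT (fun x : R => expR (p * x)).
  by apply: measurableT_comp => //; exact: measurable_funM.
have mfa : measurable_fun setT (fun x => f (y + q * x)%R) by exact: measurableT_comp.
have s0 : (0 < Num.sqrt h)%R by rewrite sqrtr_gt0.
rewrite ge0_integral_normal_prob//; last 2 first.
- by apply: emeasurable_funM => //; exact/measurable_EFinP.
- by move=> x; rewrite mule_ge0// lee_fin expR_ge0.
transitivity (\int[mu]_x ((expR (p ^+ 2 * h / 2))%:E *
   (f (y + q * x)%R * (normal_pdf (p * h) (Num.sqrt h) x)%:E))).
  apply: eq_integral => x _.
  rewrite muleAC -EFinM normal_pdf_tilt ?gt_eqF// mulr0 !add0r sqr_sqrtr ?ltW//.
  by rewrite EFinM -muleA; congr (_ * _); rewrite muleC.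
rewrite ge0_integralZl//; last 2 first.
- by apply: emeasurable_funM => //; apply/measurable_EFinP; exact: measurable_normal_pdf.
- by move=> x _; rewrite mule_ge0// lee_fin normal_pdf_ge0.
congr (_ * _).
rewrite -(gaussE_pdf (f := fun x => f (y + q * x)%R) (p * h) s0 (fun x => f0 _) mfa).
apply: eq_integral => z _; congr (f _).
rewrite sqr_sqrtr ?ltW// sqrtrM ?sqr_ge0// sqrtr_sqr gtr0_norm//; ring.
Qed.

(** The convolution of normal laws. Tonelli exchanges the two integrations, and [pdfE] factors the
    joint density so that the inner variable integrates to 1. The case [w] = 0, where there is no
    density, is separate. *)
Lemma gaussE_comp (f : R -> \bar R) (m v w : R) : (0 < v)%R -> (0 <= w)%R ->
  (forall x, 0 <= f x) -> measurable_fun setT f ->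
  gaussE (gaussE f ^~ v) m w = gaussE f m (v + w).
Proof.
move=> v0; rewrite le_eqVlt => /predU1P[<-|w0] f0 mf.
  rewrite addr0 {1}/gaussE sqrtr0.
  under eq_integral do rewrite mul0r addr0.
  by rewrite integral_cst// [X in _ * X](_ : _ = 1) ?mule1//; exact: (probability_setT (normal_prob 0 1)).
have vw0 : (0 < v + w)%R by rewrite addr_gt0.
have sv0 : (0 < Num.sqrt v)%R by rewrite sqrtr_gt0.
have sw0 : (0 < Num.sqrt w)%R by rewrite sqrtr_gt0.
have svw0 : (0 < Num.sqrt (v + w))%R by rewrite sqrtr_gt0.
pose t := Num.sqrt (v / (v + w)).
have t0 : (0 < t)%R by rewrite sqrtr_gt0 divr_gt0.
pose c y := (Num.sqrt w * (y - m) / (v + w))%R.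
have pdfE x y : (normal_pdf (m + Num.sqrt w * x) (Num.sqrt v) y * normal_pdf 0 1 x =
   normal_pdf m (Num.sqrt (v + w)) y * normal_pdf (c y) t x)%R.
  rewrite !normal_pdfE ?oner_neq0 ?gt_eqF// /normal_fun.
  rewrite mulrACA [RHS]mulrACA -!expRD; congr (_ * expR _)%R.
    rewrite /normal_peak -!invfM -!sqrtrM ?mulrn_wge0 ?mulr_ge0 ?pi_ge0 ?sqr_ge0//.
    congr ((Num.sqrt _)^-1)%R.
    rewrite !sqr_sqrtr ?ltW ?divr_gt0//.
    by rewrite expr1n; apply: gaussian_peakM; rewrite gt_eqF.
  rewrite !sqr_sqrtr ?ltW ?divr_gt0// /c expr1n.
  rewrite -[X in (v + X)%R](sqr_sqrtr (ltW w0)).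
  by apply: gaussian_exponentD; rewrite ?(sqr_sqrtr (ltW w0)) gt_eqF.
pose h (p : R * R) := f p.2 * (normal_pdf (m + Num.sqrt w * p.1) (Num.sqrt v) p.2 * normal_pdf 0 1 p.1)%:E.
have mpdf s : measurable_fun setT (fun z : R => normal_pdf 0 s z).
  exact: measurable_normal_pdf.
have h0 p : 0 <= h p by rewrite /h mule_ge0// lee_fin mulr_ge0// normal_pdf_ge0.
have mh : measurable_fun setT h.
  apply: emeasurable_funM; first exact: measurableT_comp.
  apply/measurable_EFinP; apply: measurable_funM; last exact: measurableT_comp.
  rewrite (_ : (fun p : R * R => _) = (fun p : R * R =>
     normal_pdf 0 (Num.sqrt v) (p.2 - (m + Num.sqrt w * p.1)))%R); last first.
    by apply/funext => p; rewrite !normal_pdfE ?gt_eqF// /normal_fun subr0.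
  apply: measurableT_comp => //; apply: measurable_funB => //.
  by apply: measurable_funD => //; exact: measurable_funM.
have -> : gaussE (gaussE f ^~ v) m w = \int[mu]_x \int[mu]_y h (x, y).
  rewrite {1}/gaussE ge0_integral_normal_prob//; last 2 first.
  - apply: (measurableT_comp (measurable_gaussE v f0 mf)).
    by apply: measurable_funD => //; exact: measurable_funM.
  - by move=> x; exact: gaussE_ge0.
  apply: eq_integral => x _.
  rewrite -[in LHS](sqr_sqrtr (ltW v0)) gaussE_pdf// muleC -ge0_integralZl//; last 3 first.
  - by apply: emeasurable_funM => //; apply/measurable_EFinP; exact: measurable_normal_pdf.
  - by move=> y _; rewrite mule_ge0// lee_fin normal_pdf_ge0.
  - by rewrite lee_fin normal_pdf_ge0.
  by apply: eq_integral => y _; rewrite /h/= muleC -muleA EFinM.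
rewrite fubini_tonelli//.
rewrite -{1}(sqr_sqrtr (ltW vw0)) gaussE_pdf//.
apply: eq_integral => y _.
under eq_integral do rewrite /h/= pdfE EFinM muleA.
rewrite ge0_integralZl//; last 3 first.
- by apply/measurable_EFinP; exact: measurable_normal_pdf.
- by move=> x _; rewrite lee_fin normal_pdf_ge0.
- by rewrite mule_ge0// lee_fin normal_pdf_ge0.
by rewrite integral_normal_pdf mule1.
Qed.

End gaussian.

(** * Exponential moments of weighted sums of Brownian increments *)

Section gaussian_sum.
Context d (Omega : measurableType d) (R : realType) (P : probability Omega R).
Variables (W B : R -> Omega -> R).
Hypotheses (W_brownian : brownian_motion P W) (B_brownian : brownian_motion P B)
  (WB_independent : independent_processes P W B).

(** Measurability for the space whose events are those of the filtration at time [s]; in this form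
    the closure properties of measurable functions apply as they stand. *)
Definition adapted_at d' (T : measurableType d') (s : R) (X : Omega -> T) :=
  measurable_fun [set: g_sigma_algebraType (filtration_events P W B s)] X.

Lemma measurable_W s : 0 <= s -> measurable_fun setT (W s).
Proof. by case: W_brownian => + _ _ _ _; exact. Qed.

Lemma measurable_B s : 0 <= s -> measurable_fun setT (B s).
Proof. by case: B_brownian => + _ _ _ _; exact. Qed.

Lemma augmented_filtration_measurable s E : 0 <= s ->
  augmented_filtration P W B s E -> measurable E.
Proof.
move=> s0; apply: sub_sigma_measurable => {}E [[]|[]//].
  move=> [u [A [/=]]]; rewrite in_itv/= => /andP[u0 _] mA ->.
  by rewrite -[_ @^-1` _]setTI; exact: measurable_W.
move=> [u [A [/=]]]; rewrite in_itv/= => /andP[u0 _] mA ->.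
by rewrite -[_ @^-1` _]setTI; exact: measurable_B.
Qed.

Lemma adaptedP d' (T : measurableType d') (s : R) (X : Omega -> T) :
  adapted_at s X <->
  forall A, measurable A -> augmented_filtration P W B s (X @^-1` A).
Proof.
split=> H; first by move=> A mA; have := H measurableT A mA; rewrite setTI.
by move=> _ A mA; rewrite setTI; exact: H.
Qed.

Lemma adapted_measurable d' (T : measurableType d') (s : R) (X : Omega -> T) :
  0 <= s -> adapted_at s X -> measurable_fun setT X.
Proof.
move=> s0 /adaptedP aX _ A mA; rewrite setTI.
exact: augmented_filtration_measurable s0 (aX A mA).
Qed.

Lemma augmented_filtration_le s t E : s <= t ->
  augmented_filtration P W B s E -> augmented_filtration P W B t E.
Proof.
move=> st; apply: sub_sigma_algebra2 => {}E [[]|]; last by right.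
  move=> [u [A [/= su mA ->]]]; left; left; exists u, A; split => //.
  by move: su; rewrite /= !in_itv/= => /andP[-> /le_trans]; exact.
move=> [u [A [/= su mA ->]]]; left; right; exists u, A; split => //.
by move: su; rewrite /= !in_itv/= => /andP[-> /le_trans]; exact.
Qed.

Lemma adapted_le d' (T : measurableType d') (s t : R) (X : Omega -> T) :
  s <= t -> adapted_at s X -> adapted_at t X.
Proof.
move=> st /adaptedP aX; apply/adaptedP => A mA.
exact: augmented_filtration_le st (aX A mA).
Qed.

Lemma adapted_B s t : 0 <= s -> s <= t -> adapted_at t (B s).
Proof.
move=> s0 st; apply/adaptedP => A mA; apply: sub_sigma_algebra.
by left; right; exists s, A; split => //=; rewrite in_itv/= s0.
Qed.

Lemma increment_normal s t (f : R -> \bar R) (X : {mfun Omega >-> measurableTypeR R}) :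
  0 <= s -> s < t -> (forall w, X w = B t w - B s w) ->
  (\int[distribution P X]_x f x = \int[normal_prob 0 (Num.sqrt (t - s))]_x f x)%E.
Proof.
move=> s0 st XE; apply: (eq_measure_integral (normal_prob 0 (Num.sqrt (t - s)))) => A mA _.
have [_ _ _ law _] := B_brownian.
transitivity (P ((fun w => B t w - B s w) @^-1` A)); last exact: law.
rewrite /distribution /pushforward; congr (P _).
by apply/seteqP; split => w /=; rewrite XE.
Qed.

(** Induction on [n] with [f] general: the last increment is independent of the filtration at [u n],
    to which [Y] and the earlier increments are adapted. Integrating it out replaces [f] by the
    Gaussian average [f'], to which the hypothesis applies, and [gaussE_comp] adds the variances.
    Positive [q] keeps each new variance positive. *)
Lemma gaussian_sum (u : nat -> R) (h : R) (p q : nat -> R) (Y : Omega -> R) n :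
  0 < h -> 0 <= u 0%N -> (forall k, u k.+1 = u k + h) -> (forall k, 0 < q k) ->
  (forall w, 0 <= Y w) -> adapted_at (u 0%N) Y ->
  forall f : R -> \bar R, (forall x, 0 <= f x)%E -> measurable_fun setT f ->
  let xi k w := B (u k.+1) w - B (u k) w in
  (\int[P]_w ((Y w * expR (\sum_(k < n) p k * xi k w))%:E
              * f (\sum_(k < n) q k * xi k w)%R) =
   \int[P]_w (Y w)%:E * (expR (h / 2 * \sum_(k < n) p k ^+ 2))%:E
   * gaussE f (h * \sum_(k < n) p k * q k)%R (h * \sum_(k < n) q k ^+ 2)%R)%E.
Proof.
move=> h0 u0 uS q0 Y0 aY f f0 mf xi.
have u_ge0 k : 0 <= u k by elim: k => // k IH; rewrite uS addr_ge0// ltW.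
have ult k : u k < u k.+1 by rewrite uS ltrDl.
have ule : {homo u : j k / (j <= k)%N >-> j <= k}.
  by apply: homo_leq => [x|y x z|j]; [exact: lexx|exact: le_trans|exact: ltW].
have mY : measurable_fun setT Y by exact: adapted_measurable aY.
elim: n f f0 mf => [|n IH] f f0 mf.
  under eq_integral do rewrite !big_ord0 expR0 mulr1.
  rewrite !big_ord0 !mulr0 expR0 mule1 /gaussE sqrtr0.
  under [X in (_ * X)%E]eq_integral do rewrite mul0r addr0.
  rewrite integral_cst// [X in (_ * (_ * X))%E](_ : _ = 1%E); last exact: (probability_setT (normal_prob 0 1)).
  rewrite mule1 ge0_integralZr//; first exact/measurable_EFinP.
  by move=> w _; rewrite lee_fin.
have mxi k : @measurable_fun _ _ Omega (measurableTypeR R) setT (xi k).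
  by apply: measurable_funB; exact: measurable_B.
have axi k j : (j < k)%N -> adapted_at (u k) (xi j).
  move=> jk; apply: (@measurable_funB _ (g_sigma_algebraType _)); apply: adapted_B => //; apply: ule => //.
  exact: ltnW.
have asum k (r : nat -> R) : adapted_at (u k) (fun w => \sum_(i < k) r i * xi i w).
  apply: (@measurable_sum _ (g_sigma_algebraType _)) => i.
  apply: (@measurable_funM _ (g_sigma_algebraType _)) => //.
  exact: axi.
pose X w := (Y w * expR (\sum_(k < n) p k * xi k w), \sum_(k < n) q k * xi k w).
have aX : adapted_at (u n) X.
  apply: (@measurable_fun_pair _ _ _ (g_sigma_algebraType _)); last exact: asum.
  apply: (@measurable_funM _ (g_sigma_algebraType _)).
    by apply: adapted_le aY; exact: ule.
  apply: (measurableT_comp (T1 := g_sigma_algebraType _)) => //.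
  exact: asum.
have mX : measurable_fun setT X by exact: adapted_measurable aX.
(* The absolute value makes [H] nonnegative on the whole space; it is inert on the values taken by
   [X]. *)
pose H (z : (R * R) * R) := ((`|z.1.1| * expR (p n * z.2))%:E * f (z.1.2 + q n * z.2)%R)%E.
have mH : measurable_fun setT H.
  apply: emeasurable_funM.
    apply/measurable_EFinP; apply: measurable_funM.
      by do 2 apply: measurableT_comp => //.
    by apply: measurableT_comp => //; exact: measurable_funM.
  apply: measurableT_comp => //; apply: measurable_funD => //.
    exact: measurableT_comp.
  exact: measurable_funM.
have H0 z : (0 <= H z)%E by rewrite /H mule_ge0// lee_fin mulr_ge0// expR_ge0.
pose f' y := gaussE f (y + q n * (p n * h)) (q n ^+ 2 * h).
have f'0 y : (0 <= f' y)%E by exact: gaussE_ge0.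
have mf' : measurable_fun setT f'.
  apply: (measurableT_comp (measurable_gaussE (q n ^+ 2 * h) f0 mf)).
  exact: measurable_funD.
transitivity (\int[P]_w H (X w, xi n w))%E.
  apply: eq_integral => w _.
  rewrite !big_ord_recr/= /H/= expRD mulrA ger0_norm//.
  by rewrite mulr_ge0// expR_ge0.
pose Z : {mfun Omega >-> measurableTypeR R} :=
  @mfun_Sub _ _ Omega (measurableTypeR R) (xi n) (mem_set (mxi n)).
rewrite (indep_integral (Y := Z) (h := H) mX)//; last first.
  move=> A A' mA mA'.
  apply: (increment_indep_filtration W_brownian B_brownian WB_independent (u_ge0 n) (ltW (ult n)) mA').
  by move/adaptedP : aX => /(_ A mA).
transitivity (\int[P]_w ((expR (p n ^+ 2 * h / 2))%:E *
   ((Y w * expR (\sum_(k < n) p k * xi k w))%:E * f' (\sum_(k < n) q k * xi k w)%R)))%E.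
  apply: eq_integral => w _.
  rewrite (@increment_normal (u n) (u n.+1))//.
  rewrite (_ : u n.+1 - u n = h); last by rewrite uS addrC addKr.
  rewrite /H/= ger0_norm; last by rewrite mulr_ge0// expR_ge0.
  under eq_integral do rewrite EFinM -muleA.
  rewrite ge0_integralZl//; last 3 first.
  - apply: emeasurable_funM.
      apply/measurable_EFinP; apply: measurableT_comp => //; exact: measurable_funM.
    apply: measurableT_comp => //; apply: measurable_funD => //; exact: measurable_funM.
  - by move=> x _; rewrite mule_ge0// lee_fin expR_ge0.
  - by rewrite lee_fin mulr_ge0// expR_ge0.
  by rewrite normal_prob_tilt// muleCA.
rewrite ge0_integralZl//; last 2 first.
- apply: emeasurable_funM.
    apply/measurable_EFinP; apply: measurable_funM => //.
    by apply: measurableT_comp => //; exact: adapted_measurable (asum n p).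
  by apply: measurableT_comp => //; exact: adapted_measurable (asum n q).
- by move=> w _; rewrite mule_ge0// lee_fin mulr_ge0// expR_ge0.
rewrite IH// !big_ord_recr/=.
have -> : gaussE f' (h * \sum_(k < n) p k * q k) (h * \sum_(k < n) q k ^+ 2) =
   gaussE f (h * (\sum_(k < n) p k * q k + p n * q n))
     (h * (\sum_(k < n) q k ^+ 2 + q n ^+ 2)).
  have -> : h * (\sum_(k < n) q k ^+ 2 + q n ^+ 2) =
    q n ^+ 2 * h + h * \sum_(k < n) q k ^+ 2 by ring.
  rewrite -(@gaussE_comp _ _ _ _ (h * \sum_(k < n) q k ^+ 2))//; last 2 first.
  - by rewrite mulr_gt0// exprn_gt0.
  - by rewrite mulr_ge0 ?(ltW h0)// sumr_ge0// => i _; rewrite sqr_ge0.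
  by apply: eq_integral => z _; rewrite /f'; congr (gaussE f _ _); ring.
rewrite muleCA !muleA; congr (_ * _)%E.
rewrite -!muleA; congr (_ * _)%E.
by rewrite -EFinM -expRD; congr ((expR _)%:E); field.
Qed.

End gaussian_sum.

(** * The Ornstein-Uhlenbeck process *)

Section ou_coefficients.
Variable R : realType.
Implicit Types (a x : R).
Notation mu := lebesgue_measure.

(** The integral of e^{-a u} over [[0, x]]: the weight of the initial rate in U. *)
Definition ou_beta a x : R := (1 - expR (- (a * x))) / a.

(** The primitive of [ou_beta a ^+ 2] that vanishes at 0; times delta^2 it is the variance of U. *)
Definition ou_int_beta2 a x : R := (x - ou_beta a x - a * ou_beta a x ^+ 2 / 2) / a ^+ 2.

Lemma ou_beta0 a : ou_beta a 0 = 0.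
Proof. by rewrite /ou_beta mulr0 oppr0 expR0 subrr mul0r. Qed.

Lemma ou_beta_ge0 a x : 0 < a -> 0 <= x -> 0 <= ou_beta a x.
Proof.
move=> a0 x0; rewrite divr_ge0 ?(ltW a0)// subr_ge0 -expR0 ler_expR oppr_le0.
by rewrite mulr_ge0// ltW.
Qed.

Lemma ou_beta_gt0 a x : 0 < a -> 0 < x -> 0 < ou_beta a x.
Proof.
move=> a0 x0; rewrite divr_gt0// subr_gt0 -expR0 ltr_expR oppr_lt0.
by rewrite mulr_gt0.
Qed.

Lemma ou_beta_le a x : 0 < a -> ou_beta a x <= x.
Proof.
move=> a0; rewrite ler_pdivrMr// mulrC lerBlDl -lerBlDr.
exact: expR_ge1Dx.
Qed.

Lemma ou_beta_leV a x : 0 < a -> ou_beta a x <= a^-1.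
Proof.
move=> a0; rewrite -[leRHS]mul1r ler_pM2r ?invr_gt0// gerBl expR_ge0.
Qed.

Lemma expR_ou_beta a x : a != 0 -> expR (- (a * x)) = 1 - a * ou_beta a x.
Proof. by move=> a0; rewrite /ou_beta; field. Qed.

Lemma is_derive_expRM (c x : R) :
  is_derive x 1 (fun z : R => expR (c * z)) (c * expR (c * x)).
Proof. by apply: is_derive_eq; rewrite /GRing.scale/= mulr1 mulrC. Qed.

Lemma continuous_expRNM (c : R) : continuous (fun z : R => expR (- (c * z))).
Proof.
move=> x; have -> : (fun z => expR (- (c * z))) = (fun z => expR (- c * z)).
  by apply/funext => z; rewrite mulNr.
exact: is_derive_continuous (is_derive_expRM (- c) x).
Qed.

Lemma is_derive_ou_beta a x : a != 0 ->
  is_derive x 1 (ou_beta a) (expR (- (a * x))).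
Proof.
move=> a0.
have -> : ou_beta a = fun z => a^-1 * (1 - expR (- a * z)).
  by apply/funext => z; rewrite /ou_beta mulNr mulrC.
have h := is_derive_expRM (- a) x.
apply: is_derive_eq.
by rewrite /GRing.scale/= !mulNr; field.
Qed.

Lemma continuous_ou_beta a : a != 0 -> continuous (ou_beta a).
Proof. by move=> a0 x; exact: is_derive_continuous (is_derive_ou_beta x a0). Qed.

Lemma is_derive_ou_int_beta2 a x : a != 0 ->
  is_derive x 1 (ou_int_beta2 a) (ou_beta a x ^+ 2).
Proof.
move=> a0; have db := is_derive_ou_beta x a0.
have -> : ou_int_beta2 a = fun z => (a ^+ 2)^-1 * (z - ou_beta a z - a / 2 * (ou_beta a z * ou_beta a z)).
  by apply/funext => z; rewrite /ou_int_beta2; field.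
apply: is_derive_eq.
by rewrite /GRing.scale/= expR_ou_beta//; field.
Qed.

End ou_coefficients.

Section ou_integrals.
Variables (R : realType) (a t s : R).
Hypotheses (a_gt0 : 0 < a) (ts : t < s).
Notation mu := lebesgue_measure.
Let a_neq0 : a != 0. Proof. by rewrite gt_eqF. Qed.

Let derive_rev (F f : R -> R) (x : R) : (forall y : R, is_derive y 1 F (f y)) ->
  is_derive x 1 (fun z : R => - F (s - z)) (f (s - x)).
Proof.
move=> dF.
have h : is_derive x 1 (fun z : R => s - z) (-1).
  by apply: is_derive_eq; ring.
have := @is_derive1_comp R F (fun z => s - z) x _ _ (dF _) h.
move=> /is_deriveN /is_derive_eq; apply.
by rewrite /GRing.scale/=; ring.
Qed.

Let FTC_rev (F f : R -> R) : (forall y : R, is_derive y 1 F (f y)) -> continuous f ->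
  \int[mu]_(u in `[t, s]) f (s - u) = F (s - t) - F 0.
Proof.
move=> dF cf.
have cs : continuous (fun u : R => s - u).
  by move=> x; apply: cvgB; [exact: cvg_cst|exact: cvg_id].
have -> : F (s - t) - F 0 = - F (s - s) - - F (s - t) by rewrite subrr; ring.
apply: (@FTC2_within R (fun u => f (s - u)) (fun z => - F (s - z))) => //.
- by move=> x; apply: continuous_comp; [exact: cs|exact: cf].
- apply: continuous_subspaceT => x.
  exact: is_derive_continuous (derive_rev x dF).
- by move=> x _; exact: derive_rev.
Qed.

Lemma integral_ou_beta2 :
  \int[mu]_(u in `[t, s]) (ou_beta a (s - u) ^+ 2) = ou_int_beta2 a (s - t).
Proof.
rewrite (FTC_rev (fun y => is_derive_ou_int_beta2 y a_neq0)); last first.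
  move=> x; have := @continuous_ou_beta _ _ a_neq0 x.
  by move=> c; rewrite /continuous_at !expr2; exact: cvgM.
by rewrite [ou_int_beta2 a 0]/ou_int_beta2 ou_beta0; field.
Qed.

Lemma integral_ou_beta_exp :
  \int[mu]_(u in `[t, s]) (ou_beta a (s - u) * expR (- (a * (s - u)))) =
  ou_beta a (s - t) ^+ 2 / 2.
Proof.
have dF y : is_derive y (1 : R) (fun z : R => ou_beta a z ^+ 2 / 2)
    (ou_beta a y * expR (- (a * y))).
  have db := is_derive_ou_beta y a_neq0.
  apply: is_derive_eq.
  by rewrite /GRing.scale/=; field.
rewrite (@FTC_rev _ _ dF).
  by rewrite ou_beta0; field.
by move=> x; apply: cvgM; [exact: continuous_ou_beta|exact: continuous_expRNM].
Qed.

Lemma integral_exp2 :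
  \int[mu]_(u in `[t, s]) (expR (- (a * (s - u))) ^+ 2) =
  (1 - expR (- (2 * a * (s - t)))) / (2 * a).
Proof.
have dF y : is_derive y (1 : R) (fun z : R => - (2 * a)^-1 * expR (- (2 * a) * z))
    (expR (- (a * y)) ^+ 2).
  have db := is_derive_expRM (- (2 * a)) y.
  apply: is_derive_eq.
  rewrite /GRing.scale/= expr2 -expRD.
  have -> : - (a * y) - a * y = - (2 * a) * y by ring.
  by field.
rewrite (@FTC_rev _ _ dF).
  by rewrite mulr0 expR0 !mulNr; field.
move=> x; under eq_fun do rewrite expr2.
by apply: cvgM; exact: continuous_expRNM.
Qed.

Let u n k : R := t + k%:R * ((s - t) / n.+1%:R).
Let h n : R := (s - t) / n.+1%:R.

Lemma riemann_right_cvg (f : R -> R) : continuous f ->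
  (h n * \sum_(k < n.+1) f (u n k.+1)) @[n --> \oo] --> (\int[mu]_(x in `[t, s]) f x : R).
Proof.
move=> cf.
have dI (x : R) : is_derive x (1 : R) (fun z : R => z) 1 by exact: is_derive_id.
have H := @riemann_stieltjes_cvg R t s f (cst 1) (fun z => z) 1 ts cf
   (fun x => cvg_cst _) (fun=> ltr01) dI isT.
have -> : \int[mu]_(x in `[t, s]) f x = \int[mu]_(x in `[t, s]) (f x * cst 1 x) :> R.
  by apply: eq_Rintegral => x _; rewrite mulr1.
rewrite [X in X @ _ --> _](_ : _ = fun n => \sum_(j < n.+1) f (u n (j + 1)%N) * (u n j.+1 - u n j)).
  exact: H.
apply/funext => n.
rewrite mulr_sumr; apply: eq_bigr => k _.
by rewrite addn1 mulrC /u /h -(natr1 k); ring.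
Qed.

(* Summation by parts turns the Riemann-Stieltjes sums of the path into sums over its
   increments. *)
Lemma increment_sum_cvg (b : R -> R) : {within `[t, +oo[, continuous b} ->
  (\sum_(k < n.+1) ou_beta a (s - u n k.+1) * (b (u n k.+1) - b (u n k))) @[n --> \oo] -->
  (\int[mu]_(x in `[t, s]) (expR (- (a * (s - x))) * (b x - b t)) : R).
Proof.
move=> cb.
pose f x := b (Num.max t x) - b t.
have cf : continuous f.
  by move=> x; apply: cvgB; [exact: continuous_within_maxl cb _|exact: cvg_cst].
pose g x := expR (- (a * (s - x))).
pose G x := a^-1 * g x.
have dg (x : R) : is_derive x (1 : R) (fun z : R => expR (- (a * (s - z)))) (a * expR (- (a * (s - x)))).
  by apply: is_derive_eq; rewrite /GRing.scale/=; ring.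
have dG (x : R) : is_derive x (1 : R) G (g x).
  by apply: is_derive_eq; rewrite /GRing.scale/= /g; field.
have cg : continuous g by move=> x; exact: is_derive_continuous (dg x).
have H := riemann_stieltjes_cvg ts cf cg (fun x => expR_gt0 _) dG (leq0n 1).
have -> : \int[mu]_(x in `[t, s]) (expR (- (a * (s - x))) * (b x - b t)) =
    \int[mu]_(x in `[t, s]) (f x * g x) :> R.
  apply: eq_Rintegral => x; rewrite inE/= in_itv/= => /andP[tx _].
  by rewrite /f (max_idPr tx) mulrC.
rewrite [X in X @ _ --> _](_ : _ = fun n => \sum_(j < n.+1) f (u n (j + 0)%N) * (G (u n j.+1) - G (u n j))).
  exact: H.
apply/funext => n.
have tu k : t <= u n k.
  by rewrite lerDl mulr_ge0// divr_ge0// subr_ge0 ltW.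
have un : u n n.+1 = s by rewrite /u mulrCA divff ?mulr1 ?pnatr_eq0// addrC subrK.
have u0 : u n 0%N = t by rewrite /u mul0r addr0.
have fu k : f (u n k) = b (u n k) - b t by rewrite /f (max_idPr _).
have GE k : ou_beta a (s - u n k) = G s - G (u n k).
  by rewrite /ou_beta /G /g subrr mulr0 oppr0 expR0; field.
apply/eqP; rewrite -subr_eq0 -sumrB; apply/eqP.
(* The difference of the two sums telescopes; the boundary terms vanish because [G s - G (u n n.+1)]
   and [f t] are both 0. *)
rewrite (eq_bigr (fun k : 'I_n.+1 => (G s - G (u n k.+1)) * f (u n k.+1) -
    (G s - G (u n k)) * f (u n k))).
  rewrite -(big_mkord xpredT (fun k => (G s - G (u n k.+1)) * f (u n k.+1) -
    (G s - G (u n k)) * f (u n k))) telescope_sumr//.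
  by rewrite un u0 (subrr (G s)) /f maxxx subrr mulr0 mul0r subrr.
move=> k _; rewrite addn0 GE !fu; ring.
Qed.

End ou_integrals.

Lemma gaussE_cst (R : realType) (c : \bar R) (m v : R) : gaussE (fun=> c) m v = c.
Proof.
rewrite /gaussE integral_cst// [X in (_ * X)%E](_ : _ = 1%E) ?mule1//.
exact: (probability_setT (normal_prob 0 1)).
Qed.

Section gaussE_bounded.
Variables (R : realType) (f : R -> R) (F : R).
Hypotheses (cf : continuous f) (f0 : forall x, 0 <= f x) (fF : forall x, f x <= F).

Lemma gaussE_fin_num m v : gaussE (EFin \o f) m v \is a fin_num.
Proof.
have mf : measurable_fun setT f by exact: continuous_measurable_fun.
rewrite ge0_fin_numE; last by apply: gaussE_ge0 => x; rewrite lee_fin.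
apply: le_lt_trans (ltry F); rewrite -(gaussE_cst F%:E m v).
apply: ge0_le_integral => //.
- by move=> x _; rewrite lee_fin.
- apply/measurable_EFinP; apply: measurableT_comp => //.
  by apply: measurable_funD => //; exact: measurable_funM.
- by move=> x _; rewrite lee_fin.
Qed.

Lemma gaussE_cvg (m_ v_ : nat -> R) (m v : R) :
  m_ n @[n --> \oo] --> m -> v_ n @[n --> \oo] --> v ->
  gaussE (EFin \o f) (m_ n) (v_ n) @[n --> \oo] --> gaussE (EFin \o f) m v.
Proof.
move=> mm vv.
have mf : measurable_fun setT f by exact: continuous_measurable_fun.
have ma m0 v0 : measurable_fun setT (fun z : R => f (m0 + Num.sqrt v0 * z)).
  apply: measurableT_comp => //.
  by apply: measurable_funD => //; exact: measurable_funM.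
have [|||||_ _] // := @dominated_convergence _ _ _ (normal_prob 0 1) _ measurableT
  (fun n z => (f (m_ n + Num.sqrt (v_ n) * z))%:E)
  (fun z => (f (m + Num.sqrt v * z))%:E) (fun=> F%:E).
- by move=> n; apply/measurable_EFinP; exact: ma.
- by apply/measurable_EFinP; exact: ma.
- apply: aeW => z _; apply: cvg_EFin; first exact: nearW.
  have c : m_ n + Num.sqrt (v_ n) * z @[n --> \oo] --> m + Num.sqrt v * z.
    apply: cvgD => //; apply: cvgM; last exact: cvg_cst.
    exact: (cvg_comp _ _ vv (@sqrt_continuous R v)).
  exact: (cvg_comp _ _ c (@cf _)).
- exact: (finite_measure_integrable_cst (normal_prob 0 1)).
- by apply: aeW => z n _; rewrite gee0_abs ?lee_fin.
Qed.

End gaussE_bounded.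

(** * Joint Laplace transform of the integrated noise and of the final value *)

Section ou_expectation.
Context d (Omega : measurableType d) (R : realType) (P : probability Omega R).
Variables (W B : R -> Omega -> R).
Hypotheses (W_brownian : brownian_motion P W) (B_brownian : brownian_motion P B)
  (WB_independent : independent_processes P W B).
Variables (a delta : R).
Hypotheses (a_gt0 : 0 < a) (delta_gt0 : 0 < delta).
Notation mu := lebesgue_measure.
Let a_neq0 : a != 0. Proof. by rewrite gt_eqF. Qed.

(** By parts, the Wiener integral of [ou_beta a (s - u)] against dB_u over [[t, s]], written as an
    ordinary integral of the path. *)
Definition ou_noise (t s : R) (w : Omega) : R :=
  \int[mu]_(u in `[t, s]) (expR (- (a * (s - u))) * (B u w - B t w)).

(** For the increment sums over a partition the expectation is given exactly by [gaussian_sum]. The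
    exponent, mean and variance there are Riemann sums of beta^2, of - beta e^{-a x} and of e^{-2 a
    x}, up to factors; the left side passes to the limit by [cvg_expectation_L2]. *)
Lemma ou_expectation_bounded (t s r0 C F : R) (Y : Omega -> R) (f : R -> R) :
  0 <= t -> t < s ->
  (forall w, 0 <= Y w) -> (forall w, Y w <= C) -> adapted_at P W B t Y ->
  continuous f -> (forall x, 0 <= f x) -> (forall x, f x <= F) ->
  (\int[P]_w (Y w * expR (- (delta * ou_noise t s w))
     * f (r0 + delta * (B s w - B t w - a * ou_noise t s w)))%:E =
   \int[P]_w (Y w)%:E * (expR (delta ^+ 2 * ou_int_beta2 a (s - t) / 2))%:E
   * gaussE (fun x => (f (r0 + x))%:E) (- (delta ^+ 2 * ou_beta a (s - t) ^+ 2 / 2))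
       (phi_var a delta (s - t)))%E.
Proof.
move=> t0 ts Y0 YC aY cf f0 fF.
pose u n k : R := t + k%:R * ((s - t) / n.+1%:R).
pose h n : R := (s - t) / n.+1%:R.
(* [S] approximates - delta times the noise and [Q] the centred rate at [s]. The weight of the
   latter is delta (1 - a beta) = delta e^{-a x}, hence positive. *)
pose p n k := - (delta * ou_beta a (s - u n k.+1)).
pose q n k := delta * expR (- (a * (s - u n k.+1))).
pose S n w := \sum_(k < n.+1) p n k * (B (u n k.+1) w - B (u n k) w).
pose Q n w := \sum_(k < n.+1) q n k * (B (u n k.+1) w - B (u n k) w).
have h0 n : 0 < h n by rewrite divr_gt0// subr_gt0.
have u0 n : u n 0%N = t by rewrite /u mul0r addr0.
have uS n k : u n k.+1 = u n k + h n by rewrite /u /h -(natr1 k); ring.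
have un n : u n n.+1 = s by rewrite /u mulrCA divff ?mulr1 ?pnatr_eq0// addrC subrK.
have u_ge0 n k : 0 <= u n k by rewrite addr_ge0// mulr_ge0//; exact: ltW (h0 n).
have q0 n k : 0 < q n k by rewrite mulr_gt0// expR_gt0.
have cB w : {within `[t, +oo[, continuous (fun x => B x w)}.
  have [_ _ cB _ _] := B_brownian.
  apply: continuous_subspaceW (cB w) => x /=; rewrite !in_itv/= !andbT; exact: le_trans.
have mB n k : measurable_fun setT (B (u n k)) by exact: (measurable_B B_brownian).
have mS n : measurable_fun setT (S n).
  by apply: measurable_sum => k; apply: measurable_funM => //; exact: measurable_funB.
have mQ n : measurable_fun setT (Q n).
  by apply: measurable_sum => k; apply: measurable_funM => //; exact: measurable_funB.
have mY : measurable_fun setT Y by exact: (adapted_measurable W_brownian B_brownian t0 aY).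
have mf : measurable_fun setT f by exact: continuous_measurable_fun.
have incr_cvg w := increment_sum_cvg a_gt0 ts (cB w).
have S_cvg w : S n w @[n --> \oo] --> - (delta * ou_noise t s w).
  rewrite -mulNr; rewrite [X in X @ _ --> _](_ : _ = fun n => (- delta) *
     \sum_(k < n.+1) ou_beta a (s - u n k.+1) * (B (u n k.+1) w - B (u n k) w)).
    by apply: cvgM; [exact: cvg_cst|exact: incr_cvg].
  by apply/funext => n; rewrite mulr_sumr; apply: eq_bigr => k _; rewrite /p; ring.
have Q_cvg w : Q n w @[n --> \oo] --> delta * (B s w - B t w - a * ou_noise t s w).
  rewrite [X in X @ _ --> _](_ : _ = fun n => delta * (B s w - B t w - a *
     \sum_(k < n.+1) ou_beta a (s - u n k.+1) * (B (u n k.+1) w - B (u n k) w))).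
    apply: cvgM; first exact: cvg_cst.
    apply: cvgB; first exact: cvg_cst.
    by apply: cvgM; [exact: cvg_cst|exact: incr_cvg].
  apply/funext => n.
  have -> : B s w - B t w = \sum_(k < n.+1) (B (u n k.+1) w - B (u n k) w).
    rewrite -(big_mkord xpredT (fun k => B (u n k.+1) w - B (u n k) w)) telescope_sumr//.
    by rewrite un u0.
  rewrite mulr_sumr -sumrB mulr_sumr; apply: eq_bigr => k _.
  by rewrite /q expR_ou_beta//; ring.
have y_fin : (\int[P]_w (Y w)%:E \is a fin_num)%E.
  rewrite ge0_fin_numE; last by apply: integral_ge0 => w _; rewrite lee_fin.
  apply: (@le_lt_trans _ _ (\int[P]_w (cst C%:E w))%E).
    apply: ge0_le_integral => //.
    - by move=> w _; rewrite lee_fin.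
    - exact/measurable_EFinP.
    - by move=> w _; rewrite lee_fin.
  by rewrite integral_cst//= probability_setT mule1 ltry.
have csub : continuous (fun x : R => s - x).
  by move=> x; apply: cvgB; [exact: cvg_cst|exact: cvg_id].
have cbs : continuous (fun x : R => ou_beta a (s - x)).
  move=> x; apply: (@continuous_comp _ _ _ (fun x => s - x) (ou_beta a)); first exact: csub.
  exact: continuous_ou_beta.
have ces : continuous (fun x : R => expR (- (a * (s - x)))).
  move=> x; apply: (@continuous_comp _ _ _ (fun x => s - x) (fun y => expR (- (a * y)))); first exact: csub.
  exact: continuous_expRNM.
pose fr x := f (r0 + x).
have cfr : continuous fr.
  move=> x; apply: (@continuous_comp _ _ _ (fun x => r0 + x) f); last exact: cf.
  by apply: cvgD; [exact: cvg_cst|exact: cvg_id].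
have fr0 x : 0 <= fr x by exact: f0.
have frF x : fr x <= F by exact: fF.
have g_fin := gaussE_fin_num cfr fr0 frF.
set m := - (delta ^+ 2 * _ / 2); set v := phi_var _ _ _; set c := delta ^+ 2 * _ / 2.
rewrite -(fineK y_fin) -(fineK (g_fin m v)) -!EFinM.
(* The square of e^{S_n} is the exponential of the sum with weights [2 * p], so its mean is e^{2 h
   sum p^2}; beta is at most 1/a, which bounds the exponent uniformly in [n]. *)
apply: (@cvg_expectation_L2 _ _ _ _ (fun n w => Y w * expR (S n w) * f (r0 + Q n w)) _
  ((C * F) ^+ 2 * expR (2 * ((s - t) * (delta / a) ^+ 2)))).
- move=> n; apply: measurable_funM; first apply: measurable_funM => //.
    exact: measurableT_comp.
  by apply: measurableT_comp => //; exact: measurable_funD.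
- by move=> n w; rewrite !mulr_ge0// expR_ge0.
- move=> w; apply: cvgM; first apply: cvgM; first exact: cvg_cst.
    exact: (cvg_comp _ _ (S_cvg w) (@continuous_expR _ _)).
  exact: (cvg_comp _ _ (Q_cvg w) (@cfr _)).
- move=> n.
  have hp : h n * \sum_(k < n.+1) p n k ^+ 2 <= (s - t) * (delta / a) ^+ 2.
    apply: (@le_trans _ _ (h n * \sum_(k < n.+1) (delta / a) ^+ 2)).
      apply: ler_wpM2l; first exact: ltW (h0 n).
      apply: ler_sum => k _.
      have b0 : 0 <= ou_beta a (s - u n k.+1).
        rewrite ou_beta_ge0// subr_ge0 -(un n).
        by rewrite lerD2l ler_wpM2r ?(ltW (h0 n))// ler_nat ltn_ord.
      have d0 := ltW delta_gt0; have ai0 : 0 <= a^-1 by rewrite invr_ge0 ltW.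
      have b1 : ou_beta a (s - u n k.+1) <= a^-1 by exact: ou_beta_leV.
      rewrite sqrrN ler_sqr ?nnegrE; [|exact: mulr_ge0|exact: mulr_ge0].
      exact: ler_wpM2l.
    rewrite sumr_const card_ord -mulr_natl mulrA /h divfK ?pnatr_eq0//.
  have FC0 : 0 <= (C * F) ^+ 2 by rewrite sqr_ge0.
  apply: (@le_trans _ _ (\int[P]_w (((C * F) ^+ 2)%:E * (expR (\sum_(k < n.+1) (2 * p n k) * (B (u n k.+1) w - B (u n k) w)))%:E))%E).
    apply: ge0_le_integral => //.
    - by move=> w _; rewrite lee_fin sqr_ge0.
    - apply/measurable_EFinP; apply: measurable_funX.
      apply: measurable_funM; first apply: measurable_funM => //.
        exact: measurableT_comp.
      by apply: measurableT_comp => //; exact: measurable_funD.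
    - apply: emeasurable_funM => //; apply/measurable_EFinP; apply: measurableT_comp => //.
      by apply: measurable_sum => k; apply: measurable_funM => //; exact: measurable_funB.
    - move=> w _; rewrite -EFinM lee_fin.
      have -> : \sum_(k < n.+1) 2 * p n k * (B (u n k.+1) w - B (u n k) w) = S n w + S n w.
        by rewrite /S -big_split /=; apply: eq_bigr => k _; ring.
      rewrite expRD mulrAC exprMn -expr2 ler_wpM2r ?sqr_ge0//.
      have YF0 : 0 <= Y w * f (r0 + Q n w) by exact: mulr_ge0.
      have YF : Y w * f (r0 + Q n w) <= C * F by exact: ler_pM.
      by rewrite ler_sqr ?nnegrE// (le_trans YF0).
  have a1 : adapted_at P W B (u n 0%N) (fun=> 1 : R).
    exact: measurable_cst.
  have := @gaussian_sum _ _ _ _ _ _ W_brownian B_brownian WB_independent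
      (u n) (h n) (fun k => 2 * p n k) (q n) (fun=> 1) n.+1 (h0 n) (u_ge0 n 0%N) (uS n) (q0 n)
      (fun=> ler01) a1 (fun=> 1%E) (fun=> lee01) (measurable_cst _).
  rewrite /= gaussE_cst integral_cst//= probability_setT !mul1e mule1.
  under [X in X = _ -> _]eq_integral do rewrite mule1 mul1r.
  move=> HE; rewrite ge0_integralZl//; last first.
  + apply/measurable_EFinP; apply: measurableT_comp => //.
    by apply: measurable_sum => k; apply: measurable_funM => //; exact: measurable_funB.
  rewrite HE -EFinM lee_fin ler_wpM2l// ler_expR.
  under eq_bigr do rewrite exprMn.
  rewrite -mulr_sumr.
  rewrite (_ : h n / 2 * _ = 2 * (h n * \sum_(k < n.+1) p n k ^+ 2)); last by field.
  by rewrite ler_wpM2l.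
- rewrite [X in X @ _ --> _](_ : _ = fun n => (fine (\int[P]_w (Y w)%:E)
     * expR (h n / 2 * \sum_(k < n.+1) p n k ^+ 2)
     * fine (gaussE (EFin \o fr) (h n * \sum_(k < n.+1) p n k * q n k)
         (h n * \sum_(k < n.+1) q n k ^+ 2)))%:E); last first.
    apply/funext => n.
    have mfr : measurable_fun setT (EFin \o fr).
      by apply/measurable_EFinP; exact: continuous_measurable_fun.
    rewrite !EFinM !fineK//.
    have := @gaussian_sum _ _ _ _ _ _ W_brownian B_brownian WB_independent
      (u n) (h n) (p n) (q n) Y n.+1 (h0 n) (u_ge0 n 0%N) (uS n) (q0 n) Y0 _ (EFin \o fr) _ mfr.
    by rewrite u0; apply => // x; rewrite lee_fin.
  apply: cvg_EFin; first exact: nearW.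
  apply: cvgM; first apply: cvgM; first exact: cvg_cst.
    have c_cvg : h n / 2 * \sum_(k < n.+1) p n k ^+ 2 @[n --> \oo] --> c.
      rewrite (_ : c = 2^-1 * \int[mu]_(x in `[t, s]) (delta * ou_beta a (s - x)) ^+ 2); last first.
        under eq_Rintegral do rewrite exprMn.
        rewrite RintegralZl//.
          by rewrite integral_ou_beta2// /c mulrC.
        apply: continuous_integrable => x; under eq_fun do rewrite expr2.
        by apply: cvgM; exact: cbs.
      rewrite [X in X @ _ --> _](_ : _ = fun n => 2^-1 * (h n * \sum_(k < n.+1) (delta * ou_beta a (s - u n k.+1)) ^+ 2)).
        apply: cvgM; first exact: cvg_cst.
        apply: (riemann_right_cvg ts (f := fun x => (delta * ou_beta a (s - x)) ^+ 2)) => x.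
        rewrite /continuous_at; under eq_fun do rewrite expr2.
        by rewrite expr2; apply: cvgM; apply: cvgM; first [exact: cvg_cst|exact: cbs].
      apply/funext => n; rewrite mulrA (mulrC (h n)); congr (_ * _).
      by apply: eq_bigr => k _; rewrite sqrrN.
    exact: (cvg_comp _ _ c_cvg (@continuous_expR _ _)).
  apply: fine_cvg; rewrite fineK//; apply: (gaussE_cvg cfr fr0 frF).
    rewrite (_ : m = (- delta ^+ 2) * \int[mu]_(x in `[t, s]) (ou_beta a (s - x) * expR (- (a * (s - x))))); last first.
      by rewrite integral_ou_beta_exp// /m; ring.
    rewrite [X in X @ _ --> _](_ : _ = fun n => (- delta ^+ 2) *
        (h n * \sum_(k < n.+1) (ou_beta a (s - u n k.+1) * expR (- (a * (s - u n k.+1)))))).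
      apply: cvgM; first exact: cvg_cst.
      apply: (riemann_right_cvg ts (f := fun x => ou_beta a (s - x) * expR (- (a * (s - x))))) => x.
      by apply: cvgM; [exact: cbs|exact: ces].
    apply/funext => n; rewrite mulrCA; congr (_ * _); rewrite mulr_sumr.
    by apply: eq_bigr => k _; rewrite /p /q; ring.
  rewrite (_ : v = delta ^+ 2 * \int[mu]_(x in `[t, s]) (expR (- (a * (s - x))) ^+ 2)); last first.
    by rewrite integral_exp2// /v /phi_var; field.
  rewrite [X in X @ _ --> _](_ : _ = fun n => delta ^+ 2 *
      (h n * \sum_(k < n.+1) expR (- (a * (s - u n k.+1))) ^+ 2)).
    apply: cvgM; first exact: cvg_cst.
    apply: (riemann_right_cvg ts (f := fun x => expR (- (a * (s - x))) ^+ 2)) => x.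
    by rewrite /continuous_at; under eq_fun do rewrite expr2; rewrite expr2; apply: cvgM; exact: ces.
  apply/funext => n; rewrite mulrCA; congr (_ * _); rewrite mulr_sumr.
  by apply: eq_bigr => k _; rewrite /q; ring.
Qed.

End ou_expectation.

(** * The Ornstein-Uhlenbeck path as an explicit functional of its noise *)

Section ou_path.
Variables (R : realType) (a b delta t r0 : R) (y B : R -> R).
Hypotheses (a_gt0 : 0 < a).
Hypotheses (cy : {within `[t, +oo[, continuous y}) (cB : {within `[t, +oo[, continuous B}).
Notation mu := lebesgue_measure.
Hypothesis yE : forall s, t <= s ->
  y s = r0 + \int[mu]_(u in `[t, s]) (a * (b - y u)) + delta * (B s - B t).
Let a_neq0 : a != 0. Proof. by rewrite gt_eqF. Qed.

Lemma within_integrable (f : R -> R) (x z : R) : t <= x ->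
  {within `[t, +oo[, continuous f} -> mu.-integrable `[x, z] (EFin \o f).
Proof.
move=> tx cf; apply: continuous_compact_integrable; first exact: segment_compact.
apply: continuous_subspaceW cf => u /=; rewrite !in_itv/= andbT => /andP[xu _].
exact: le_trans xu.
Qed.

Lemma ou_path_value s : t <= s ->
  y s = r0 + a * b * (s - t) - a * \int[mu]_(u in `[t, s]) y u + delta * (B s - B t).
Proof.
move=> ts; rewrite {1}yE//.
have iy : mu.-integrable `[t, s] (EFin \o y) by exact: within_integrable.
have ic : mu.-integrable `[t, s] (EFin \o cst b).
  by apply: continuous_integrable => x; exact: cvg_cst.
rewrite RintegralZl//; last first.
  rewrite (_ : EFin \o _ = (EFin \o cst b) \- (EFin \o y))%E//.
  exact: integrableB.
rewrite (RintegralB (f1 := cst b))// Rintegral_cst//= lebesgue_measure_itv/= lte_fin.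
have -> : fine (if t < s then (s%:E - t%:E)%E else 0%E) = s - t :> R.
  have [_|st] := ltP t s; first by rewrite -EFinB.
  by have -> : s = t; [apply/eqP; rewrite eq_le ts st|rewrite subrr].
by ring.
Qed.

(** [ou_path_value] is a linear equation for the integral of [y], solved by [linear_ode_integral];
    the forcing term splits into an affine part, integrated in closed form, and the Brownian
    part. *)
Lemma ou_path_integral s : t <= s ->
  \int[mu]_(u in `[t, s]) y u = r0 * ou_beta a (s - t) + b * (s - t - ou_beta a (s - t))
    + delta * \int[mu]_(u in `[t, s]) (expR (- (a * (s - u))) * (B u - B t)).
Proof.
move=> ts.
pose y' x := y (Num.max t x).
pose B' x := B (Num.max t x).
have cy' : continuous y' by exact: continuous_within_maxl.
have cB' : continuous B' by exact: continuous_within_maxl.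
pose f x := r0 + a * b * (x - t) + delta * (B' x - B t).
have cid (x : R) : (fun z : R => z) @ x --> x by exact: cvg_id.
have cf : continuous f.
  move=> x; apply: cvgD.
    apply: cvgD; first exact: cvg_cst.
    apply: cvgM; first exact: cvg_cst.
    by apply: cvgB; [exact: cid|exact: cvg_cst].
  apply: cvgM; first exact: cvg_cst.
  by apply: cvgB; [exact: cB'|exact: cvg_cst].
have int_y' x : \int[mu]_(u in `[t, x]) y' u = \int[mu]_(u in `[t, x]) y u.
  apply: eq_Rintegral => u; rewrite inE/= in_itv/= => /andP[tu _].
  by rewrite /y' (max_idPr tu).
rewrite -int_y' (@linear_ode_integral R a t y' f)//; last first.
  move=> x tx; rewrite int_y' {1}/y' (max_idPr tx) ou_path_value// /f /B' (max_idPr tx).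
  by ring.
have ce : continuous (fun u : R => expR (- (a * (s - u)))).
  move=> x; apply: (@continuous_comp _ _ _ (fun x => s - x) (fun y => expR (- (a * y)))).
    by apply: cvgB; [exact: cvg_cst|exact: cid].
  exact: continuous_expRNM.
pose f1 u := expR (- (a * (s - u))) * (r0 + a * b * (u - t)).
pose f2 u := expR (- (a * (s - u))) * (B' u - B t).
have cf1 : continuous f1.
  move=> x; apply: cvgM; first exact: ce.
  apply: cvgD; first exact: cvg_cst.
  apply: cvgM; first exact: cvg_cst.
  by apply: cvgB; [exact: cid|exact: cvg_cst].
have cf2 : continuous f2.
  move=> x; apply: cvgM; first exact: ce.
  by apply: cvgB; [exact: cB'|exact: cvg_cst].
pose f3 u := delta * f2 u.
transitivity (\int[mu]_(u in `[t, s]) (f1 u + f3 u)).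
  by apply: eq_Rintegral => u _; rewrite /f /f1 /f3 /f2; ring.
rewrite RintegralD//; last 2 first.
- exact: continuous_integrable.
- by apply: continuous_integrable => x; apply: cvgM; [exact: cvg_cst|exact: cf2].
rewrite RintegralZl//; last exact: continuous_integrable.
congr (_ + _ * _); last first.
  apply: eq_Rintegral => u; rewrite inE/= in_itv/= => /andP[tu _].
  by rewrite /f2 /B' (max_idPr tu).
move: ts; rewrite le_eqVlt => /predU1P[<-|ts].
  by rewrite set_itv1 Rintegral_set1 subrr ou_beta0; ring.
(* A primitive of the exponential times an affine function; the constant [- b / a] compensates the
   derivative of [b * (u - t)]. *)
pose H u := expR (- (a * (s - u))) * (r0 / a + b * (u - t) - b / a).
have dH (x : R) : is_derive x (1 : R) H (f1 x).
  by apply: is_derive_eq; rewrite /GRing.scale/= /f1; field.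
rewrite (@FTC2_within R f1 H)//; last first.
  by apply: continuous_subspaceT => x; exact: is_derive_continuous (dH x).
by rewrite /H subrr mulr0 oppr0 expR0 expR_ou_beta//; field.
Qed.

End ou_path.

Lemma Rintegral_itv_cat (R : realType) (f : R -> R) (t s v : R) : t <= s -> s <= v ->
  lebesgue_measure.-integrable `[t, v] (EFin \o f) ->
  \int[lebesgue_measure]_(u in `[t, v]) f u =
  \int[lebesgue_measure]_(u in `[t, s]) f u + \int[lebesgue_measure]_(u in `[s, v]) f u.
Proof.
move=> ts sv fi.
have fi' : lebesgue_measure.-integrable `]s, v] (EFin \o f).
  apply: integrableS fi => //; apply: subset_itvr; by rewrite bnd_simp.
have := @Rintegral_itvB R f (BLeft t) (BRight v) s fi.
rewrite !bnd_simp => /(_ ts sv); rewrite Rintegral_itv_obnd_cbnd// => <-.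
by rewrite addrC subrK.
Qed.

(** After time [s] the path solves the same equation from [y s] with the noise restarted, so the
    explicit formula applies on [[s, v]]. This separates past from future in the Markov property. *)
Lemma ou_path_flow (R : realType) (a b delta t s v r0 : R) (y B : R -> R) : 0 < a ->
  {within `[t, +oo[, continuous y} -> {within `[t, +oo[, continuous B} ->
  (forall s, t <= s ->
    y s = r0 + \int[lebesgue_measure]_(u in `[t, s]) (a * (b - y u)) + delta * (B s - B t)) ->
  t <= s -> s <= v ->
  \int[lebesgue_measure]_(u in `[t, v]) y u = \int[lebesgue_measure]_(u in `[t, s]) y u
    + (y s * ou_beta a (v - s) + b * (v - s - ou_beta a (v - s))
    + delta * \int[lebesgue_measure]_(u in `[s, v]) (expR (- (a * (v - u))) * (B u - B s))).
Proof.
move=> a0 cy cB yE ts sv.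
have sub : `[s, +oo[%classic `<=` `[t, +oo[%classic.
  by move=> x /=; rewrite !in_itv/= !andbT; exact: le_trans.
rewrite (Rintegral_itv_cat ts sv); last exact: within_integrable cy.
congr (_ + _).
apply: ou_path_integral => //.
- exact: continuous_subspaceW cy.
- exact: continuous_subspaceW cB.
move=> x sx; have tx := le_trans ts sx.
have cg : {within `[t, +oo[, continuous (fun u => a * (b - y u))}.
  by move=> z; apply: cvgM; [exact: cvg_cst|apply: cvgB; [exact: cvg_cst|exact: cy]].
rewrite (yE x tx) (yE s ts) (Rintegral_itv_cat ts sx); last exact: within_integrable cg.
by ring.
Qed.

Section ou_process.
Context d (Omega : measurableType d) (R : realType) (P : probability Omega R).
Variables (W B : R -> Omega -> R).
Hypotheses (W_brownian : brownian_motion P W) (B_brownian : brownian_motion P B)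
  (WB_independent : independent_processes P W B).
Variables (a b delta : R).
Hypotheses (a_gt0 : 0 < a) (delta_gt0 : 0 < delta).
Notation mu := lebesgue_measure.
Let a_neq0 : a != 0. Proof. by rewrite gt_eqF. Qed.
Local Notation noise := (ou_noise B a).
Local Notation adapted := (adapted_at P W B).

Lemma brownian_within_continuous t w : 0 <= t ->
  {within `[t, +oo[, continuous (fun x => B x w)}.
Proof.
move=> t0; have [_ _ cB _ _] := B_brownian.
apply: continuous_subspaceW (cB w) => x /=; rewrite !in_itv/= !andbT; exact: le_trans.
Qed.

Lemma noise_tt t w : noise t t w = 0.
Proof. by rewrite /ou_noise set_itv1 Rintegral_set1. Qed.

(** The noise is a limit of sums of increments of B. The sigma-algebra is left open because two are
    needed: the augmented filtration, and the one generated by B alone, against which W is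
    independent. *)
Lemma noise_measurable_wrt (G : set (set Omega)) t s : 0 <= t -> t <= s ->
  (forall u, t <= u <= s -> measurable_fun [set: g_sigma_algebraType G] (B u)) ->
  measurable_fun [set: g_sigma_algebraType G] (noise t s).
Proof.
move=> t0; rewrite le_eqVlt => /predU1P[<- _|ts mB].
  rewrite (_ : noise t t = fun=> 0); first exact: measurable_cst.
  by apply/funext => w; rewrite noise_tt.
pose u n k : R := t + k%:R * ((s - t) / n.+1%:R).
apply: (measurable_fun_cvg (T := g_sigma_algebraType _)
  (h := fun n w => \sum_(k < n.+1) ou_beta a (s - u n k.+1) * (B (u n k.+1) w - B (u n k) w))).
  move=> n.
  have mBu k : (k <= n.+1)%N -> measurable_fun [set: g_sigma_algebraType G] (B (u n k)).
    move=> kn; apply: mB; apply/andP; split.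
      by rewrite /u lerDl mulr_ge0// divr_ge0// subr_ge0 ltW.
    rewrite /u -lerBrDl mulrCA ler_piMr ?subr_ge0 ?(ltW ts)//.
    by rewrite ler_pdivrMr ?ltr0n// mul1r ler_nat.
  apply: (measurable_sum (T := g_sigma_algebraType _)) => k.
  apply: (measurable_funM (T := g_sigma_algebraType _)) => //.
  apply: (measurable_funB (T := g_sigma_algebraType _)).
    by apply: mBu; exact: ltn_ord.
  by apply: mBu; exact: ltnW.
move=> w _; apply: increment_sum_cvg => //.
exact: brownian_within_continuous.
Qed.

Lemma adapted_noise t s : 0 <= t -> t <= s -> adapted s (noise t s).
Proof.
move=> t0 ts; apply: noise_measurable_wrt => // u /andP[tu us].
by apply: adapted_B => //; exact: le_trans tu.
Qed.

(** The preimages under [X] and [X'] differ inside a null set, and the filtration contains all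
    measurable null sets; measurability of [X] makes the part inside that null set an event. *)
Lemma adapted_ae s (X X' : Omega -> R) : measurable_fun setT X -> 0 <= s ->
  adapted s X' -> {ae P, forall w, X w = X' w} -> adapted s X.
Proof.
move=> mX s0 aX' [N [mN N0 XX']]; apply/adaptedP => A mA.
have aX'A : augmented_filtration P W B s (X' @^-1` A) by move/adaptedP: aX' => /(_ A mA).
have mXA : measurable (X @^-1` A) by rewrite -[_ @^-1` _]setTI; exact: mX.
have nullE E : measurable E -> P E = 0%E -> augmented_filtration P W B s E.
  by move=> mE E0; apply: sub_sigma_algebra; right.
have -> : X @^-1` A = (X' @^-1` A `&` ~` N) `|` (X @^-1` A `&` N).
  apply/seteqP; split=> w /=.
    move=> XA; have [Nw|nNw] := pselect (N w); first by right.
    left; split => //; suff <- : X w = X' w by [].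
    by apply: contrapT => h; apply: nNw; apply: XX'.
  move=> [[X'A nNw]|[]//]; suff -> : X w = X' w by [].
  by apply: contrapT => h; apply: nNw; apply: XX'.
apply: (@measurableU _ (g_sigma_algebraType (filtration_events P W B s))).
  apply: (@measurableI _ (g_sigma_algebraType (filtration_events P W B s))) => //.
  by apply: (@measurableC _ (g_sigma_algebraType (filtration_events P W B s))); exact: nullE.
apply: nullE; first exact: measurableI.
apply/eqP; rewrite eq_le measure_ge0 andbT -N0.
by apply: le_measure; rewrite ?inE//; exact: measurableI.
Qed.

Variables (t r : R) (rt : R -> Omega -> R).
Hypotheses (t_ge0 : 0 <= t) (rt_OU : OU_process P a b delta B t r rt).

Local Notation U := (integrated_rate rt t).

Lemma ou_explicit_integral : {ae P, forall w, forall s, t <= s ->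
  U s w = r * ou_beta a (s - t) + b * (s - t - ou_beta a (s - t)) + delta * noise t s w}.
Proof.
have [_ cr rE] := rt_OU.
apply: filterS rE => w rE s ts.
apply: (@ou_path_integral R a b delta t r (rt ^~ w) (B ^~ w)) => //.
exact: brownian_within_continuous.
Qed.

Lemma ou_explicit_value : {ae P, forall w, forall s, t <= s ->
  rt s w = r * expR (- (a * (s - t))) + a * b * ou_beta a (s - t)
    + delta * (B s w - B t w - a * noise t s w)}.
Proof.
have [_ cr rE] := rt_OU; have UE := ou_explicit_integral.
apply: filterS2 UE rE => w UE rE s ts.
rewrite (@ou_path_value R a b delta t r (rt ^~ w) (B ^~ w))//.
rewrite -/(U s w) UE// expR_ou_beta//; ring.
Qed.

Lemma ou_flow : {ae P, forall w, forall s v, t <= s -> s <= v ->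
  U v w = U s w + (rt s w * ou_beta a (v - s) + b * (v - s - ou_beta a (v - s))
    + delta * noise s v w)}.
Proof.
have [_ cr rE] := rt_OU.
apply: filterS rE => w rE s v ts sv.
apply: (@ou_path_flow R a b delta t s v r (rt ^~ w) (B ^~ w)) => //.
exact: brownian_within_continuous.
Qed.

(** Frozen before [t], so that continuity and joint measurability hold on the whole time axis. *)
Definition ou_joint (p : R * Omega) : R := rt (Num.max t p.1) p.2.

Lemma measurable_ou_joint : measurable_fun [set: R * Omega] ou_joint.
Proof.
have [mr cr _] := rt_OU.
apply: (measurable_fun_path (X := fun s w => rt (Num.max t s) w)).
  by move=> w; exact: (continuous_within_maxl (cr w)).
by move=> s; apply: mr; rewrite le_max lexx.
Qed.

(** U_t^s with the moving bound [s] turned into a cut-off of the integrand over the fixed interval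
    [[t, v]]: a parametric integral, jointly measurable in time and sample point. *)
Definition integrated_joint (v : R) (p : R * Omega) : R :=
  \int[mu]_(u in `[t, v]) (if u <= p.1 then ou_joint (u, p.2) else 0).

Lemma measurable_integrated_joint v :
  measurable_fun [set: R * Omega] (integrated_joint v).
Proof.
apply: (measurable_Rintegral_param
  (f := fun q : R * (R * Omega) => if q.1 <= q.2.1 then ou_joint (q.1, q.2.2) else 0)) => //.
apply: measurable_fun_ifT => //.
  apply: measurable_fun_ler => //.
  exact: measurableT_comp.
apply: (measurableT_comp measurable_ou_joint).
apply: measurable_fun_pair => //.
exact: measurableT_comp.
Qed.

Lemma integrated_jointE s v w : t <= s -> s <= v -> integrated_joint v (s, w) = U s w.
Proof.
move=> ts sv.
rewrite /integrated_joint /integrated_rate /=.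
rewrite (_ : `[t, s]%classic = `[t, v]%classic `&` `[t, s]%classic); last first.
  by rewrite setIidr//; apply: subset_itvl; rewrite bnd_simp.
rewrite Rintegral_mkcondr; apply: eq_Rintegral => u; rewrite inE/= in_itv/= => /andP[tu uv].
rewrite patchE mem_setE in_itv/= tu /= /ou_joint /= (max_idPr tu).
by case: ifP.
Qed.

Lemma measurable_integrated s : t <= s -> measurable_fun setT (U s).
Proof.
move=> ts; rewrite (_ : U s = fun w => integrated_joint s (s, w)); last first.
  by apply/funext => w; rewrite integrated_jointE.
exact: (measurableT_comp (measurable_integrated_joint s)).
Qed.

Lemma adapted_integrated s : t <= s -> adapted s (U s).
Proof.
move=> ts; apply: (adapted_ae (measurable_integrated ts) (le_trans t_ge0 ts)
  (X' := fun w => r * ou_beta a (s - t) + b * (s - t - ou_beta a (s - t)) + delta * noise t s w)).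
  apply: (measurable_funD (T := g_sigma_algebraType _)) => //.
  apply: (measurable_funM (T := g_sigma_algebraType _)) => //.
  exact: adapted_noise.
by apply: filterS ou_explicit_integral => w; exact.
Qed.

Lemma adapted_ou s : t <= s -> adapted s (rt s).
Proof.
have [mr _ _] := rt_OU.
move=> ts; apply: (adapted_ae (mr s ts) (le_trans t_ge0 ts)
  (X' := fun w => r * expR (- (a * (s - t))) + a * b * ou_beta a (s - t)
    + delta * (B s w - B t w - a * noise t s w))).
  apply: (measurable_funD (T := g_sigma_algebraType _)) => //.
  apply: (measurable_funM (T := g_sigma_algebraType _)) => //.
  apply: (measurable_funB (T := g_sigma_algebraType _)).
    by apply: (measurable_funB (T := g_sigma_algebraType _)); apply: adapted_B => //; exact: le_trans ts.
  apply: (measurable_funM (T := g_sigma_algebraType _)) => //.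
  exact: adapted_noise.
by apply: filterS ou_explicit_value => w; exact.
Qed.

End ou_process.

Section discount_factor.
Variable R : realType.
Implicit Types (a b delta L r : R).

(* The explicit formula for M(L, r). *)
Definition ou_disc a b delta L r : R :=
  expR (- (r * ou_beta a L) - b * (L - ou_beta a L) + delta ^+ 2 * ou_int_beta2 a L / 2).

(* Mean of r_L under the measure with density proportional to exp(-U_0^L). *)
Definition ou_mean a b delta L r : R :=
  r * expR (- (a * L)) + a * b * ou_beta a L - delta ^+ 2 * ou_beta a L ^+ 2 / 2.

Lemma ou_disc0 a b delta r : ou_disc a b delta 0 r = 1.
Proof. by rewrite /ou_disc /ou_int_beta2 ou_beta0 -[RHS]expR0; congr expR; ring. Qed.

Lemma gaussE_shift (f : R -> \bar R) (c m v : R) :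
  gaussE (fun x => f (c + x)) m v = gaussE f (c + m) v.
Proof. by apply: eq_integral => z _; rewrite addrA. Qed.

End discount_factor.

(** * Discounted expectations and the Markov property *)

Section expectations.
Context d (Omega : measurableType d) (R : realType) (P : probability Omega R).
Variables (W B : R -> Omega -> R).
Hypotheses (W_brownian : brownian_motion P W) (B_brownian : brownian_motion P B)
  (WB_independent : independent_processes P W B).
Variables (a b delta : R).
Hypotheses (a_gt0 : 0 < a) (delta_gt0 : 0 < delta).
Local Notation noise := (ou_noise B a).
Local Notation adapted := (adapted_at P W B).

Lemma measurable_noise t s : 0 <= t -> t <= s -> measurable_fun setT (noise t s).
Proof.
move=> t0 ts; apply: (adapted_measurable W_brownian B_brownian (le_trans t0 ts)).
exact: (adapted_noise (W := W) B_brownian a_gt0 t0 ts).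
Qed.

(** Removes the bound on [Y] by truncation at [n] and monotone convergence; the Markov property
    needs it for a weight that contains the exponential of an unbounded rate. *)
Lemma expectation_noise t s (Y : Omega -> R) : 0 <= t -> t < s ->
  (forall w, 0 <= Y w) -> adapted t Y ->
  (\int[P]_w (Y w * expR (- (delta * noise t s w)))%:E =
   \int[P]_w (Y w)%:E * (expR (delta ^+ 2 * ou_int_beta2 a (s - t) / 2))%:E)%E.
Proof.
move=> t0 ts Y0 aY.
have mY : measurable_fun setT Y by exact: (adapted_measurable W_brownian B_brownian t0 aY).
have mnoise := measurable_noise t0 (ltW ts).
have mexp : measurable_fun setT (fun w => expR (- (delta * noise t s w))).
  apply: measurableT_comp => //; apply: measurableT_comp => //.
  exact: measurable_funM.
pose Yn n w : R := Num.min (Y w) n%:R.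
have Yn0 n w : 0 <= Yn n w by rewrite /Yn le_min Y0 ler0n.
have aYn n : adapted t (Yn n).
  exact: (measurable_minr (T := g_sigma_algebraType _)).
have mYn n : measurable_fun setT (Yn n) by exact: measurable_minr.
have Yn_nd w m n : (m <= n)%N -> Yn m w <= Yn n w.
  by move=> mn; rewrite /Yn le_min !ge_min lexx/= ler_nat mn orbT.
have Yn_cvg w : Yn n w @[n --> \oo] --> Y w.
  apply: cvg_near_cst; near=> n; rewrite /Yn min_l//.
  near: n; exact: nbhs_infty_ger.
have step n : (\int[P]_w (Yn n w * expR (- (delta * noise t s w)))%:E =
   \int[P]_w (Yn n w)%:E * (expR (delta ^+ 2 * ou_int_beta2 a (s - t) / 2))%:E)%E.
  have := @ou_expectation_bounded _ _ _ _ _ _ W_brownian B_brownian WB_independent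
    a delta a_gt0 delta_gt0 t s 0 n%:R 1 (Yn n) (fun=> 1) t0 ts (Yn0 n) _ (aYn n)
    (fun=> cvg_cst _) (fun=> ler01) (fun=> lexx _).
  rewrite gaussE_cst mule1; under eq_integral do rewrite mulr1.
  by apply => w; rewrite /Yn ge_min lexx orbT.
have lhs : (\int[P]_w (Yn n w * expR (- (delta * noise t s w)))%:E)%E @[n --> \oo] -->
    (\int[P]_w (Y w * expR (- (delta * noise t s w)))%:E)%E.
  rewrite (_ : (\int[P]_w (Y w * expR (- (delta * noise t s w)))%:E)%E =
     (\int[P]_w limn (fun n => (Yn n w * expR (- (delta * noise t s w)))%:E))%E).
    apply: cvg_monotone_convergence => //.
    - by move=> n; apply/measurable_EFinP; exact: measurable_funM.
    - by move=> n w _; rewrite lee_fin mulr_ge0// expR_ge0.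
    - by move=> w _ m n mn; rewrite lee_fin ler_wpM2r ?expR_ge0// Yn_nd.
  apply: eq_integral => w _; apply/esym/cvg_lim => //.
  apply: cvg_EFin; first exact: nearW.
  by apply: cvgM; [exact: Yn_cvg|exact: cvg_cst].
have rhs : (\int[P]_w (Yn n w)%:E)%E @[n --> \oo] --> (\int[P]_w (Y w)%:E)%E.
  rewrite (_ : (\int[P]_w (Y w)%:E)%E = (\int[P]_w limn (fun n => (Yn n w)%:E))%E).
    apply: cvg_monotone_convergence => //.
    - by move=> n; apply/measurable_EFinP.
    - by move=> n w _; rewrite lee_fin.
    - by move=> w _ m n mn; rewrite lee_fin Yn_nd.
  apply: eq_integral => w _; apply/esym/cvg_lim => //.
  by apply: cvg_EFin; [exact: nearW|exact: Yn_cvg].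
set c := (expR _)%:E in step *.
have lhs' : (\int[P]_w (Yn n w * expR (- (delta * noise t s w)))%:E)%E @[n --> \oo] -->
    (\int[P]_w (Y w)%:E * c)%E.
  rewrite [X in X @ _ --> _](_ : _ = fun n => (\int[P]_w (Yn n w)%:E * c)%E).
    exact: cvgeZr.
  by apply/funext => n; exact: step.
exact: (cvg_unique _ lhs lhs').
Unshelve. all: by end_near. Qed.

Variables (t r : R) (rt : R -> Omega -> R).
Hypotheses (t_ge0 : 0 <= t) (rt_OU : OU_process P a b delta B t r rt).
Local Notation U := (integrated_rate rt t).

Let mU s : t <= s -> measurable_fun setT (U s).
Proof. by move=> ts; exact: measurable_integrated rt_OU _ ts. Qed.

Let mrt s : t <= s -> measurable_fun setT (rt s).
Proof. by case: rt_OU => + _ _; exact. Qed.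

(** Almost surely U_t^s and r_s are constants plus multiples of the noise, so the bounded case with
    [Y] = 1 applies. It shows r_s to be normal under the discounted measure, with a mean lowered by
    the correlation with U. *)
Lemma expectation_discounted s (f : R -> R) (F : R) : t < s ->
  continuous f -> (forall x, 0 <= f x) -> (forall x, f x <= F) ->
  (\int[P]_w (expR (- U s w) * f (rt s w))%:E =
   (ou_disc a b delta (s - t) r)%:E
   * gaussE (EFin \o f) (ou_mean a b delta (s - t) r) (phi_var a delta (s - t)))%E.
Proof.
move=> ts cf f0 fF.
have ts' := ltW ts.
have mf : measurable_fun setT f by exact: continuous_measurable_fun.
pose c1 := r * ou_beta a (s - t) + b * (s - t - ou_beta a (s - t)).
pose c2 := r * expR (- (a * (s - t))) + a * b * ou_beta a (s - t).
have a1 : adapted t (fun=> 1 : R) by exact: measurable_cst.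
have H := @ou_expectation_bounded _ _ _ _ _ _ W_brownian B_brownian WB_independent
    a delta a_gt0 delta_gt0 t s c2 1 F (fun=> 1) f t_ge0 ts (fun=> ler01) (fun=> lexx _) a1 cf f0 fF.
have mnoise := measurable_noise t_ge0 ts'.
have mB v : t <= v -> measurable_fun setT (B v).
  by move=> tv; apply: (measurable_B B_brownian); exact: le_trans tv.
transitivity (\int[P]_w ((expR (- c1))%:E * (1 * expR (- (delta * noise t s w)) *
    f (c2 + delta * (B s w - B t w - a * noise t s w)))%:E))%E.
  apply: ae_eq_integral => //.
  - apply/measurable_EFinP; apply: measurable_funM; last exact: measurableT_comp (mrt ts').
    by apply: measurableT_comp => //; apply: measurableT_comp => //; exact: mU.
  - apply: emeasurable_funM => //; apply/measurable_EFinP; apply: measurable_funM.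
      apply: measurable_funM => //; apply: measurableT_comp => //.
      by apply: measurableT_comp => //; exact: measurable_funM.
    apply: measurableT_comp => //; apply: measurable_funD => //; apply: measurable_funM => //.
    apply: measurable_funB; last exact: measurable_funM.
    by apply: measurable_funB; apply: mB.
  have E1 := ou_explicit_integral B_brownian a_gt0 t_ge0 rt_OU.
  have E2 := ou_explicit_value B_brownian a_gt0 t_ge0 rt_OU.
  apply: filterS2 E1 E2 => w E1 E2 _.
  rewrite E1// E2// -EFinM mul1r; congr (_%:E).
  rewrite [RHS]mulrA -expRD; congr (expR _ * _).
  by rewrite /c1; ring.
rewrite ge0_integralZl//; last 2 first.
- apply/measurable_EFinP; apply: measurable_funM.
    apply: measurable_funM => //; apply: measurableT_comp => //.
    by apply: measurableT_comp => //; exact: measurable_funM.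
  apply: measurableT_comp => //; apply: measurable_funD => //; apply: measurable_funM => //.
  apply: measurable_funB; last exact: measurable_funM.
  by apply: measurable_funB; apply: mB.
- by move=> w _; rewrite lee_fin !mulr_ge0// expR_ge0.
rewrite H integral_cst//= probability_setT mule1 mul1e muleA -EFinM -expRD.
rewrite (gaussE_shift (EFin \o f)); congr (_ * _)%E.
by congr ((expR _)%:E); rewrite /c1; ring.
Qed.

Lemma expectation_disc s : t <= s ->
  (\int[P]_w (expR (- U s w))%:E = (ou_disc a b delta (s - t) r)%:E)%E.
Proof.
rewrite le_eqVlt => /predU1P[<-|ts].
  rewrite subrr ou_disc0.
  under eq_integral do rewrite /integrated_rate set_itv1 Rintegral_set1 oppr0 expR0.
  by rewrite integral_cst//= probability_setT mule1.
have := @expectation_discounted s (fun=> 1) 1 ts (fun=> cvg_cst _) (fun=> ler01) (fun=> lexx _).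
rewrite (gaussE_cst 1%E) mule1 => <-.
by under [RHS]eq_integral do rewrite mulr1.
Qed.

(** By the flow identity U_t^v is a part adapted at [s] plus delta times the noise after [s]. The
    adapted part goes into the weight [Z], and the mean of the remaining exponential completes it to
    [ou_disc]. *)
Lemma ou_markov s v (Y : Omega -> R) : t <= s -> s <= v ->
  (forall w, 0 <= Y w) -> adapted s Y ->
  (\int[P]_w (Y w * expR (- U v w))%:E =
   \int[P]_w (Y w * expR (- U s w) * ou_disc a b delta (v - s) (rt s w))%:E)%E.
Proof.
move=> ts; rewrite le_eqVlt => /predU1P[<- Y0 aY|sv Y0 aY].
  by apply: eq_integral => w _; rewrite subrr ou_disc0 mulr1.
have s0 := le_trans t_ge0 ts.
have tv := le_trans ts (ltW sv).
have mY : measurable_fun setT Y by exact: (adapted_measurable W_brownian B_brownian s0 aY).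
have aU := adapted_integrated (W := W) B_brownian a_gt0 t_ge0 rt_OU ts.
have ar := adapted_ou (W := W) B_brownian a_gt0 t_ge0 rt_OU ts.
pose Z w := Y w * expR (- U s w - rt s w * ou_beta a (v - s) - b * (v - s - ou_beta a (v - s))).
have Z0 w : 0 <= Z w by rewrite mulr_ge0// expR_ge0.
have aZ : adapted s Z.
  apply: (measurable_funM (T := g_sigma_algebraType _)) => //.
  apply: (measurableT_comp (T1 := g_sigma_algebraType _)) => //.
  apply: (measurable_funB (T := g_sigma_algebraType _)) => //.
  apply: (measurable_funB (T := g_sigma_algebraType _)).
    exact: (measurableT_comp (T1 := g_sigma_algebraType _)).
  exact: (measurable_funM (T := g_sigma_algebraType _)).
have mZ : measurable_fun setT Z by exact: (adapted_measurable W_brownian B_brownian s0 aZ).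
have mnoise := measurable_noise s0 (ltW sv).
transitivity (\int[P]_w (Z w * expR (- (delta * noise s v w)))%:E)%E.
  apply: ae_eq_integral => //.
  - apply/measurable_EFinP; apply: measurable_funM => //.
    by apply: measurableT_comp => //; apply: measurableT_comp => //; exact: mU.
  - apply/measurable_EFinP; apply: measurable_funM => //.
    apply: measurableT_comp => //; apply: measurableT_comp => //.
    exact: measurable_funM.
  have E := ou_flow B_brownian a_gt0 t_ge0 rt_OU.
  apply: filterS E => w E _.
  rewrite (E s v ts (ltW sv)) /Z -mulrA -expRD; congr ((_ * expR _)%:E); ring.
rewrite expectation_noise// -ge0_integralZr//; last first.
- by move=> w _; rewrite lee_fin.
- exact/measurable_EFinP.
apply: eq_integral => w _; rewrite -EFinM /Z /ou_disc; congr (_%:E).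
rewrite -[LHS]mulrA -[RHS]mulrA -!expRD; congr (_ * expR _).
by ring.
Qed.

End expectations.

(** * The candidate *)

Section candidate_gain.
Variables (R : realType) (a b delta : R).
Hypotheses (a_gt0 : 0 < a) (delta_gt0 : 0 < delta).
Notation mu := lebesgue_measure.
Let a_neq0 : a != 0. Proof. by rewrite gt_eqF. Qed.
Local Notation beta := (ou_beta a).
Local Notation disc := (ou_disc a b delta).
Local Notation mean := (ou_mean a b delta).

Definition ou_logdisc0 L : R := - b * (L - beta L) + delta ^+ 2 * ou_int_beta2 a L / 2.

Lemma ou_discE L z : disc L z = expR (ou_logdisc0 L - z * beta L).
Proof. by rewrite /ou_disc /ou_logdisc0; congr expR; ring. Qed.

(** log M(L, z) is affine in [z] with slope - beta(L), so M = 1 at the quotient of its constant term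
    by beta(L). *)
Lemma alphaE T t : t < T -> alpha a b delta T t = ou_logdisc0 (T - t) / beta (T - t).
Proof.
move=> tT; have L0 : 0 < T - t by rewrite subr_gt0.
have b0 := ou_beta_gt0 a_gt0 L0.
rewrite /alpha lt_eqF// mulNr expR_ou_beta// /ou_logdisc0 /btilde /ou_int_beta2.
have -> : 1 - (1 - a * beta (T - t)) = a * beta (T - t) by ring.
by field; rewrite a_neq0 gt_eqF.
Qed.

Lemma alpha_lt T t z : t < T -> (alpha a b delta T t < z) = (disc (T - t) z < 1).
Proof.
move=> tT; have L0 : 0 < T - t by rewrite subr_gt0.
have b0 := ou_beta_gt0 a_gt0 L0.
rewrite alphaE// ltr_pdivrMr//.
have -> : (disc (T - t) z < 1) = (disc (T - t) z < expR 0) by rewrite expR0.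
by rewrite ou_discE ltr_expR subr_lt0.
Qed.

(** The positive part stands for the factor 1 - M restricted to z > alpha; unlike a cut-off by an
    indicator it is visibly continuous, as [gaussE_cvg] and [expectation_discounted] require. *)
Definition excess L z : R := Num.max 0 (1 - disc L z).

Lemma excess_ge0 L z : 0 <= excess L z.
Proof. by rewrite /excess le_max lexx. Qed.

Lemma excess_le1 L z : excess L z <= 1.
Proof. by rewrite /excess ge_max ler01/= gerBl; exact: expR_ge0. Qed.

Lemma continuous_disc L : continuous (disc L).
Proof.
have -> : disc L = fun z => expR (ou_logdisc0 L) * expR (- (beta L * z)).
  by apply/funext => z; rewrite ou_discE -expRD; congr expR; ring.
by move=> z; apply: cvgM; [exact: cvg_cst|exact: continuous_expRNM].
Qed.

Lemma continuous_excess L : continuous (excess L).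
Proof.
move=> z; apply: (@continuous_max _ _ (cst 0) (fun z => 1 - disc L z)); first exact: cvg_cst.
by apply: cvgB; [exact: cvg_cst|exact: continuous_disc].
Qed.

Lemma phi_var_gt0 u : 0 < u -> 0 < phi_var a delta u.
Proof.
move=> u0; rewrite /phi_var mulr_gt0//.
  by rewrite divr_gt0 ?exprn_gt0// mulr_gt0.
by rewrite subr_gt0 -expR0 ltr_expR oppr_lt0 !mulr_gt0.
Qed.

Lemma phi_normal_pdf z u r : 0 < u ->
  phi a b delta z u r = normal_pdf (mean u r) (Num.sqrt (phi_var a delta u)) z.
Proof.
move=> u0; have v0 := phi_var_gt0 u0.
rewrite normal_pdfE ?gt_eqF ?sqrtr_gt0// /normal_peak /normal_fun /phi.
rewrite sqr_sqrtr ?(ltW v0)//; congr (_^-1 * expR _).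
  by congr Num.sqrt; rewrite -mulr_natl; ring.
rewrite /ou_mean !mulNr mulr_natl; congr (- (_ ^+ 2 / _)); last by rewrite mulr_natl.
by rewrite expR_ou_beta//; field.
Qed.

(* E[e^{-U_0^u} (1 - M(L, r_u))^+ | r_0 = r]; the domain z > alpha of the inner integral
   of [Gtilde] is exactly where the positive part does not vanish. *)
Definition gain L u r : R :=
  disc u r * fine (gaussE (EFin \o excess L) (mean u r) (phi_var a delta u)).

Lemma measurable_ou_beta : measurable_fun setT beta.
Proof. by apply: continuous_measurable_fun; exact: continuous_ou_beta. Qed.

Lemma measurable_ou_int_beta2 : measurable_fun setT (ou_int_beta2 a).
Proof.
apply: continuous_measurable_fun => x.
exact: is_derive_continuous (is_derive_ou_int_beta2 x a_neq0).
Qed.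

Lemma measurable_disc d (T : measurableType d) (f g : T -> R) :
  measurable_fun setT f -> measurable_fun setT g ->
  measurable_fun setT (fun x => disc (f x) (g x)).
Proof.
move=> mf mg; apply: measurableT_comp => //.
have mb : measurable_fun setT (fun x => beta (f x)).
  exact: measurableT_comp measurable_ou_beta mf.
apply: measurable_funD; last first.
  apply: measurable_funM => //; apply: measurable_funM => //.
  exact: measurableT_comp measurable_ou_int_beta2 mf.
apply: measurable_funB; first by apply: measurableT_comp => //; exact: measurable_funM.
by apply: measurable_funM => //; exact: measurable_funB.
Qed.

Lemma measurable_excess d (T : measurableType d) (f g : T -> R) :
  measurable_fun setT f -> measurable_fun setT g ->
  measurable_fun setT (fun x => excess (f x) (g x)).
Proof.
move=> mf mg; apply: measurable_maxr => //; apply: measurable_funB => //.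
exact: measurable_disc.
Qed.

Lemma measurable_gain (c r : R) : measurable_fun [set: R] (fun u : R => gain (c - u) u r).
Proof.
apply: measurable_funM; first exact: measurable_disc.
apply: (measurableT_comp (fine_measurable measurableT)).
pose h (p : R * R) := (excess (c - p.1)
  (mean p.1 r + Num.sqrt (phi_var a delta p.1) * p.2))%:E.
have msqrt : measurable_fun setT (@Num.sqrt R).
  by apply: continuous_measurable_fun; exact: sqrt_continuous.
have mexp k : measurable_fun setT (fun u : R => expR (- (k * u))).
  by apply: continuous_measurable_fun; exact: continuous_expRNM.
have mmean : measurable_fun setT (mean ^~ r).
  apply: measurable_funB; last first.
    apply: measurable_funM => //; apply: measurable_funM => //.
    by apply: measurable_funX; exact: measurable_ou_beta.
  apply: measurable_funD; first exact: measurable_funM.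
  by apply: measurable_funM => //; exact: measurable_ou_beta.
have mvar : measurable_fun setT (phi_var a delta).
  by apply: measurable_funM => //; exact: measurable_funB.
have mh : measurable_fun setT h.
  apply/measurable_EFinP; apply: measurable_excess; first exact: measurable_funB.
  apply: measurable_funD; first exact: measurableT_comp mmean _.
  apply: measurable_funM => //; apply: (measurableT_comp msqrt).
  exact: measurableT_comp mvar _.
by apply: (measurable_fun_fubini_tonelli_F (m2 := normal_prob 0 1) h mh) => p; rewrite lee_fin excess_ge0.
Qed.

Lemma gain_integral L u r T t : 0 < u -> t < T -> L = T - t ->
  \int[mu]_(z in `]alpha a b delta T t, +oo[)
    (disc u r * (1 - disc L z) * phi a b delta z u r) = gain L u r.
Proof.
move=> u0 tT ->; have v0 := phi_var_gt0 u0.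
have s0 : 0 < Num.sqrt (phi_var a delta u) by rewrite sqrtr_gt0.
have me : measurable_fun setT (EFin \o excess (T - t)).
  by apply/measurable_EFinP; apply: continuous_measurable_fun; exact: continuous_excess.
have gfin := gaussE_fin_num (@continuous_excess (T - t)) (@excess_ge0 _) (@excess_le1 _)
  (mean u r) (phi_var a delta u).
rewrite /gain; move: gfin; rewrite -{1 2}(sqr_sqrtr (ltW v0)) gaussE_pdf//; last first.
  by move=> x; rewrite lee_fin excess_ge0.
move=> gfin.
rewrite /Rintegral integral_mkcond.
rewrite (_ : (_ \_ _) = (fun z => (disc u r)%:E * ((EFin \o excess (T - t)) z
    * (normal_pdf (mean u r) (Num.sqrt (phi_var a delta u)) z)%:E))%E); last first.
  apply/funext => z; rewrite patchE -phi_normal_pdf// /= -!EFinM /excess.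
  case: ifPn; rewrite mem_setE in_itv/= andbT alpha_lt// => dz.
    by rewrite (max_idPr _) ?mulrA// subr_ge0 ltW.
  by rewrite (max_idPl _) ?mul0r ?mulr0// subr_le0 leNgt.
rewrite ge0_integralZl//.
- by rewrite fineM.
- by apply: emeasurable_funM => //; apply/measurable_EFinP; exact: measurable_normal_pdf.
- by move=> z _; rewrite mule_ge0// lee_fin ?excess_ge0 ?normal_pdf_ge0.
- by rewrite lee_fin expR_ge0.
Qed.

(** The inner integral is the gain for 0 < u < T - t only: at u = 0 the normal law degenerates, and
    at u = T - t the value of [alpha] is set by convention. These two points form a null set. *)
Lemma Gtilde_gain (M : R -> R -> R) xi m T t r : 0 <= t <= T ->
  (forall u r, 0 <= u <= T -> M u r = disc u r) ->
  Gtilde M a b delta xi m T t r =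
  m * (T - t) * disc (T - t) r + xi * \int[mu]_(u in `]0, T - t[) gain (T - t - u) u r.
Proof.
move=> /andP[t0 tT] ME; rewrite /Gtilde ME; last first.
  by rewrite subr_ge0 tT/= gerBl.
have inner u : u \in `]0, (T - t)[ -> \int[mu]_(z in `]alpha a b delta T (u + t), +oo[)
      (M u r * (1 - M (T - u - t) z) * phi a b delta z u r) = gain (T - t - u) u r.
  rewrite in_itv/= => /andP[u0 uT].
  have utT : u + t < T by rewrite -ltrBrDr.
  rewrite -(@gain_integral _ u r T (u + t))//; last by ring.
  apply: eq_Rintegral => z _; rewrite !ME.
  - by have -> : T - u - t = T - t - u by ring.
  - by apply/andP; split; [move: uT; lra|move: u0; lra].
  - by apply/andP; split; [exact: ltW|move: uT; lra].
congr (_ + _ * _).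
(* Dropping the endpoints requires measurability of the inner integral in [u], which is inherited
   from the gain on the open interval. *)
transitivity (\int[mu]_(u in `]0, T - t[) (\int[mu]_(z in `]alpha a b delta T (u + t), +oo[)
    (M u r * (1 - M (T - u - t) z) * phi a b delta z u r))).
  have mE : measurable_fun `]0, (T - t)[ (fun u => (\int[mu]_(z in `]alpha a b delta T (u + t), +oo[)
      (M u r * (1 - M (T - u - t) z) * phi a b delta z u r) : R)%:E).
    apply/measurable_EFinP.
    apply: (@eq_measurable_fun _ _ _ _ _ (fun u : R => gain (T - t - u) u r)).
      by move=> u; rewrite inE/= => uT; rewrite inner.
    by apply: measurable_funTS; exact: measurable_gain.
  by rewrite {1}/Rintegral (integral_itv_bndoo true false mE).
apply: eq_Rintegral => u; rewrite inE/=; exact: inner.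
Qed.

End candidate_gain.

(** * Verification *)

Section noise_independence.
Context d (Omega : measurableType d) (R : realType) (P : probability Omega R).
Variables (W B : R -> Omega -> R).
Hypotheses (W_brownian : brownian_motion P W) (B_brownian : brownian_motion P B)
  (WB_independent : independent_processes P W B).
Variables (a b delta : R).
Hypotheses (a_gt0 : 0 < a) (delta_gt0 : 0 < delta).
Notation mu := lebesgue_measure.

Lemma normal_prob_sym (s : R) (f : R -> \bar R) : s != 0 ->
  (forall x, 0 <= f x)%E -> measurable_fun setT f ->
  (\int[normal_prob 0 s]_x f (- x)%R = \int[normal_prob 0 s]_x f x)%E.
Proof.
move=> s0 f0 mf.
have mfN : measurable_fun setT (fun x : R => f (- x)) by exact: measurableT_comp.
rewrite !ge0_integral_normal_prob//.
pose g x := (f x * (normal_pdf 0 s x)%:E)%E.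
have mg : measurable_fun setT g.
  by apply: emeasurable_funM => //; apply/measurable_EFinP; exact: measurable_normal_pdf.
have g0 x : (0 <= g x)%E by rewrite mule_ge0// lee_fin normal_pdf_ge0.
transitivity (\int[mu]_x g (- x)%R)%E.
  by apply: eq_integral => x _; rewrite /g !normal_pdfE// /normal_fun !subr0 sqrrN.
have mN : @measurable_fun _ _ (measurableTypeR R) (measurableTypeR R) setT (fun x : R => - x).
  exact: measurableT_comp.
transitivity (\int[measure_function_pushforward__canonical__measure_function_Measure mu mN]_x g x)%E.
  by rewrite ge0_integral_pushforward.
apply: (eq_measure_integral mu) => A mA _; exact: lebesgue_measureN.
Qed.

(** The positive part of [x] is at most e^x, whose mean is known. *)
Lemma normal_prob_pos_fin (h : R) : 0 < h ->
  (\int[normal_prob 0 (Num.sqrt h)]_x (Num.max x 0)%:E < +oo)%E.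
Proof.
move=> h0.
have H := @normal_prob_tilt R (fun=> 1%E) 0 1 1 h ltr01 h0 (fun=> lee01) (measurable_cst _).
apply: (@le_lt_trans _ _ (\int[normal_prob 0 (Num.sqrt h)]_x ((expR (1 * x))%:E * 1))%E); last first.
  by rewrite H gaussE_cst mule1 ltry.
apply: ge0_le_integral => //.
- by move=> x _; rewrite lee_fin le_max lexx orbT.
- apply/measurable_EFinP; exact: measurable_maxr.
- apply: emeasurable_funM => //; apply/measurable_EFinP; apply: measurableT_comp => //.
- move=> x _; rewrite mule1 lee_fin mul1r ge_max expR_ge0 andbT.
  by apply: le_trans (expR_ge1Dx x); rewrite lerDr.
Qed.

(** The positive and the negative part of the increment of W have the same finite mean [kap],
    because the normal law is symmetric. By independence each, multiplied by [X], has mean E[X]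
    times [kap], and the two cancel. *)
Lemma sigma_B_indep_W (t T : R) (X : Omega -> R) : 0 <= t -> t < T ->
  measurable_fun [set: g_sigma_algebraType (path_events B `[0, +oo[)] X ->
  (forall w, 0 <= X w) -> P.-integrable setT (EFin \o X) ->
  P.-integrable setT (fun w => (X w * (W T w - W t w))%:E) /\
  \int[P]_w (X w * (W T w - W t w)) = 0.
Proof.
move=> t0 tT sX X0 iX.
have T0 := le_trans t0 (ltW tT).
have mW s : 0 <= s -> measurable_fun setT (W s) by exact: (measurable_B W_brownian).
have mB s : 0 <= s -> measurable_fun setT (B s) by exact: (measurable_B B_brownian).
have mX : measurable_fun setT X.
  move=> _ A mA; rewrite setTI.
  have : <<s path_events B `[0, +oo[ >> (X @^-1` A).
    by have := sX measurableT A mA; rewrite setTI.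
  by apply: path_events_measurable => s /=; rewrite in_itv/= => /andP[s0 _]; exact: mB.
pose Y w := W T w - W t w.
have mY : @measurable_fun _ _ Omega (measurableTypeR R) setT Y.
  by apply: measurable_funB; exact: mW.
pose Z : {mfun Omega >-> measurableTypeR R} := @mfun_Sub _ _ Omega (measurableTypeR R) Y (mem_set mY).
have sW A : measurable A -> <<s path_events W `[0, +oo[ >> (Y @^-1` A).
  move=> mA; rewrite -[_ @^-1` _]setTI.
  apply: (@measurable_funB _ (g_sigma_algebraType (path_events W `[0, +oo[))) => //.
    move=> _ C mC; rewrite setTI; apply: sub_sigma_algebra.
    by exists T, C; split => //=; rewrite in_itv/= T0.
  move=> _ C mC; rewrite setTI; apply: sub_sigma_algebra.
  by exists t, C; split => //=; rewrite in_itv/= t0.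
have indep A C : measurable A -> measurable C ->
    (P (X @^-1` A `&` Z @^-1` C) = P (X @^-1` A) * P (Z @^-1` C))%E.
  move=> mA mC; rewrite setIC WB_independent; first exact: muleC.
    exact: sW.
  by have := sX measurableT A mA; rewrite setTI.
have hT : 0 < T - t by rewrite subr_gt0.
set kap := (\int[normal_prob 0 (Num.sqrt (T - t))]_x (Num.max x 0)%:E)%E.
have EX : (\int[P]_w (X w)%:E \is a fin_num)%E by exact: integrable_fin_num iX.
have kap_fin : kap \is a fin_num.
  rewrite ge0_fin_numE; first exact: normal_prob_pos_fin.
  by apply: integral_ge0 => x _; rewrite lee_fin le_max lexx orbT.
have part (g : R -> R) : measurable_fun setT g -> (forall x, 0 <= g x) ->
    (\int[normal_prob 0 (Num.sqrt (T - t))]_x (g x)%:E = kap)%E ->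
    (\int[P]_w (X w * g (Y w))%:E = \int[P]_w (X w)%:E * kap)%E.
  move=> mg g0 gk.
  pose h (z : R * R) := (`|z.1| * g z.2)%:E.
  have mh : measurable_fun setT h.
    apply/measurable_EFinP; apply: measurable_funM; first exact: measurableT_comp.
    exact: measurableT_comp.
  transitivity (\int[P]_w h (X w, Z w))%E.
    by apply: eq_integral => w _; rewrite /h /= ger0_norm.
  rewrite (indep_integral (Y := Z) (h := h) mX)//; last first.
    by move=> z; rewrite lee_fin mulr_ge0.
  transitivity (\int[P]_w ((X w)%:E * kap))%E.
    apply: eq_integral => w _.
    rewrite (@increment_normal _ _ _ _ _ W_brownian t T)// /h/= ger0_norm//.
    under eq_integral do rewrite EFinM.
    rewrite ge0_integralZl// ?gk//.
    - exact/measurable_EFinP.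
    - by move=> x _; rewrite lee_fin.
    - by rewrite lee_fin.
  rewrite ge0_integralZr//.
  - exact/measurable_EFinP.
  - by move=> w _; rewrite lee_fin.
  - by apply: integral_ge0 => x _; rewrite lee_fin le_max lexx orbT.
pose gp x : R := Num.max x 0.
pose gn x : R := Num.max (- x) 0.
have mgp : measurable_fun setT gp by exact: measurable_maxr.
have mgn : measurable_fun setT gn.
  by apply: measurable_maxr => //; exact: measurableT_comp.
have gp0 x : 0 <= gp x by rewrite /gp le_max lexx orbT.
have gn0 x : 0 <= gn x by rewrite /gn le_max lexx orbT.
have Ep := part gp mgp gp0 erefl.
have En : (\int[P]_w (X w * gn (Y w))%:E = \int[P]_w (X w)%:E * kap)%E.
  apply: part => //.
  apply: (@normal_prob_sym _ (fun x => (Num.max x 0)%:E)) => //.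
  - by rewrite gt_eqF// sqrtr_gt0.
  - by apply/measurable_EFinP; exact: mgp.
have int_part (g : R -> R) : measurable_fun setT g -> (forall x, 0 <= g x) ->
    (\int[P]_w (X w * g (Y w))%:E = \int[P]_w (X w)%:E * kap)%E ->
    P.-integrable setT (EFin \o (fun w => X w * g (Y w))).
  move=> mg g0 gE; apply/integrableP; split.
    by apply/measurable_EFinP; apply: measurable_funM => //; exact: measurableT_comp.
  under eq_integral do rewrite gee0_abs ?lee_fin ?mulr_ge0//.
  by rewrite gE -ge0_fin_numE ?fin_numM// -gE; apply: integral_ge0 => w _; rewrite lee_fin mulr_ge0.
have ip := int_part gp mgp gp0 Ep.
have i_n := int_part gn mgn gn0 En.
have maxE (x : R) : x = Num.max x 0 - Num.max (- x) 0.
  have [x0|x0] := leP x 0.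
    by rewrite (max_idPl _) ?sub0r ?opprK// oppr_ge0.
  by rewrite (max_idPr _) ?subr0// oppr_le0 ltW.
have XYE w : X w * (W T w - W t w) = X w * gp (Y w) - X w * gn (Y w).
  by rewrite -mulrBr -maxE.
split.
  rewrite (_ : (fun w => _) = (EFin \o (fun w => (X w * gp (Y w))%R)) \- (EFin \o (fun w => (X w * gn (Y w))%R)))%E.
    exact: integrableB.
  by apply/funext => w /=; rewrite XYE EFinB.
transitivity (\int[P]_w (X w * gp (Y w) - X w * gn (Y w))).
  by apply: eq_Rintegral => w _; rewrite XYE.
rewrite RintegralB//.
by rewrite /Rintegral Ep En subrr.
Qed.

End noise_independence.

(** * The return of a strategy and its maximisation *)

Section verification.
Context d (Omega : measurableType d) (R : realType) (P : probability Omega R).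
Variables (W B : R -> Omega -> R).
Hypotheses (W_brownian : brownian_motion P W) (B_brownian : brownian_motion P B)
  (WB_independent : independent_processes P W B).
Variables (a b delta sigma xi m T t r x : R).
Hypotheses (a_gt0 : 0 < a) (delta_gt0 : 0 < delta) (xi_gt0 : 0 < xi).
Hypotheses (t_ge0 : 0 <= t) (tT : t <= T).
Variable rho : R -> R -> R -> Omega -> R.
Hypothesis rho_OU : OU_process P a b delta B t r (rho t r).
Notation mu := lebesgue_measure.
Local Notation disc := (ou_disc a b delta).
Local Notation adapted := (adapted_at P W B).
Local Notation rt := (rho t r).
Local Notation U := (integrated_rate rt t).
Let a_neq0 : a != 0. Proof. by rewrite gt_eqF. Qed.

Let D : set R := `[t, T]%classic.
Let mD : measurable D. Proof. exact: measurable_itv. Qed.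

(** Discount factor, future discount M(T - s, r_s) and its excess as functions on all of time times
    sample space, measurable everywhere; they have their meaning for times in [D]. *)
Let H (p : R * Omega) : R := expR (- integrated_joint t rt T p).
Let Q (p : R * Omega) : R := disc (T - p.1) (ou_joint t rt p).
Let E (p : R * Omega) : R := excess a b delta (T - p.1) (ou_joint t rt p).

Let mH : measurable_fun setT H.
Proof.
apply: measurableT_comp => //; apply: measurableT_comp => //.
exact: measurable_integrated_joint rho_OU _.
Qed.

Let mQ : measurable_fun setT Q.
Proof.
apply: measurable_disc => //; last exact: measurable_ou_joint rho_OU.
exact: measurable_funB.
Qed.

Let mE : measurable_fun setT E.
Proof.
apply: measurable_excess => //; last exact: measurable_ou_joint rho_OU.
exact: measurable_funB.
Qed.

Let H0 p : 0 <= H p. Proof. exact: expR_ge0. Qed.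
Let Q0 p : 0 <= Q p. Proof. exact: expR_ge0. Qed.
Let E0 p : 0 <= E p. Proof. exact: excess_ge0. Qed.

Let HE s w : D s -> H (s, w) = expR (- U s w).
Proof. by rewrite /D /= in_itv/= => /andP[ts sT]; rewrite /H integrated_jointE. Qed.

Let QE s w : D s -> Q (s, w) = disc (T - s) (rt s w).
Proof. by rewrite /D /= in_itv/= => /andP[ts sT]; rewrite /Q /ou_joint/= (max_idPr ts). Qed.

Let dbl (F : R * Omega -> R) : \bar R := (\int[mu]_(s in D) \int[P]_w (F (s, w))%:E)%E.

Let dbl_swap (F : R * Omega -> R) : measurable_fun setT F -> (forall p, 0 <= F p) ->
  (dbl F = \int[P]_w \int[mu]_(s in D) (F (s, w))%:E)%E.
Proof.
move=> mF F0.
pose G (p : R * Omega) := ((\1_D p.1)%:E * (F p)%:E)%E.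
have mG : measurable_fun setT G.
  apply: emeasurable_funM; last exact/measurable_EFinP.
  by apply/measurable_EFinP; exact: measurableT_comp (measurable_indic mD) _.
have G0 p : (0 <= G p)%E by rewrite mule_ge0// lee_fin.
transitivity (\int[mu]_s \int[P]_w G (s, w))%E.
  rewrite /dbl integral_mkcond; apply: eq_integral => s _.
  rewrite patchE /G/= indicE; case: ifPn => _.
    by under [RHS]eq_integral do rewrite mul1e.
  by under eq_integral do rewrite mul0e; rewrite integral0.
transitivity (\int[P]_w \int[mu]_s G (s, w))%E.
  exact: (fubini_tonelli (m1 := mu) (m2 := P) G mG G0).
apply: eq_integral => w _.
rewrite [RHS]integral_mkcond; apply: eq_integral => s _.
by rewrite patchE /G/= indicE; case: ifPn => _; rewrite ?mul1e ?mul0e.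
Qed.

Let mslice (F : R * Omega -> R) s : measurable_fun setT F ->
  measurable_fun setT (fun w => (F (s, w))%:E).
Proof. by move=> mF; apply/measurable_EFinP; exact: measurable_fun_pair2. Qed.

Let mdbl (F : R * Omega -> R) : measurable_fun setT F -> (forall p, 0 <= F p) ->
  measurable_fun D (fun s => \int[P]_w (F (s, w))%:E)%E.
Proof.
move=> mF F0; apply: measurable_funTS.
apply: (measurable_fun_fubini_tonelli_F (m2 := P) (EFin \o F)).
  exact/measurable_EFinP.
by move=> p; rewrite lee_fin.
Qed.

Let dbl_le (F G : R * Omega -> R) : measurable_fun setT F -> measurable_fun setT G ->
  (forall p, 0 <= F p) -> (forall p, 0 <= G p) ->
  (forall s w, D s -> F (s, w) <= G (s, w)) -> (dbl F <= dbl G)%E.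
Proof.
move=> mF mG F0 G0 FG; apply: ge0_le_integral => //.
- by move=> s _; apply: integral_ge0 => w _; rewrite lee_fin.
- exact: mdbl.
- exact: mdbl.
move=> s Ds; apply: ge0_le_integral => //.
- by move=> w _; rewrite lee_fin.
- exact: mslice.
- exact: mslice.
- by move=> w _; rewrite lee_fin FG.
Qed.

Let dbl_add (F G : R * Omega -> R) : measurable_fun setT F -> measurable_fun setT G ->
  (forall p, 0 <= F p) -> (forall p, 0 <= G p) ->
  (dbl (fun p => (F p + G p)%R) = dbl F + dbl G)%E.
Proof.
move=> mF mG F0 G0; rewrite /dbl -ge0_integralD//.
- apply: eq_integral => s _; under eq_integral do rewrite EFinD.
  rewrite ge0_integralD//.
  + by move=> w _; rewrite lee_fin.
  + exact: mslice.
  + by move=> w _; rewrite lee_fin.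
  + exact: mslice.
- by move=> s _; apply: integral_ge0 => w _; rewrite lee_fin.
- exact: mdbl.
- by move=> s _; apply: integral_ge0 => w _; rewrite lee_fin.
- exact: mdbl.
Qed.

Let dbl_H : (dbl (fun p => (xi * H p)%R) < +oo)%E.
Proof.
have -> : dbl (fun p => xi * H p) = (\int[mu]_(s in D) (xi * disc (s - t)%R r)%:E)%E.
  apply: eq_integral => s; rewrite inE => Ds.
  under eq_integral do rewrite HE// EFinM.
  move: Ds; rewrite /D /= in_itv/= => /andP[ts _].
  rewrite ge0_integralZl//.
  - by rewrite (expectation_disc W_brownian B_brownian WB_independent a_gt0 delta_gt0 t_ge0 rho_OU ts).
  - apply/measurable_EFinP; apply: measurableT_comp => //; apply: measurableT_comp => //.
    exact: (measurable_integrated rho_OU).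
  - by rewrite lee_fin ltW.
have : mu.-integrable D (EFin \o (fun s => xi * disc (s - t) r)).
  apply: continuous_integrable => s.
  apply: cvgM; first exact: cvg_cst.
  apply: (@continuous_comp _ _ _ (fun s => s - t) (disc ^~ r)).
    by apply: cvgB; [exact: cvg_id|exact: cvg_cst].
  apply: (@continuous_comp _ _ _ _ expR); last exact: continuous_expR.
  have cb := @continuous_ou_beta _ _ a_neq0 (s - t).
  have ck := is_derive_continuous (is_derive_ou_int_beta2 (s - t) a_neq0).
  apply: cvgD; last by apply: cvgM; [apply: cvgM; [exact: cvg_cst|exact: ck]|exact: cvg_cst].
  apply: cvgB; first by apply: cvgN; apply: cvgM; [exact: cvg_cst|exact: cb].
  by apply: cvgM; [exact: cvg_cst|apply: cvgB; [exact: cvg_id|exact: cb]].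
move=> /integrableP[_]; apply: le_lt_trans.
rewrite le_eqVlt; apply/orP; left; apply/eqP; apply: eq_integral => s _.
by rewrite gee0_abs// lee_fin mulr_ge0 ?expR_ge0// ltW.
Qed.

Let V0 := dbl (fun p => xi * H p * E p).

Let mV0 : measurable_fun setT (fun p => xi * H p * E p).
Proof. by apply: measurable_funM => //; exact: measurable_funM. Qed.

Let V0_ge0 p : 0 <= xi * H p * E p. Proof. by rewrite !mulr_ge0// ltW. Qed.

Let k : R := x + m * (T - t).

Let val : R := k * disc (T - t) r + xi * \int[mu]_(u in `]0, T - t[) gain a b delta (T - t - u) u r.

(** At a fixed time [s] strictly between [t] and [T], [expectation_discounted] turns the slice into
    the gain with maturity T - s after time s - t; the shift u = s - t then gives the outer
    integral. The double integral is finite, as [dbl_H] dominates it, and so the gain is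
    integrable. *)
Let V0E : (V0 + (k * disc (T - t) r)%:E = val%:E)%E.
Proof.
pose h s := (xi * gain a b delta (T - s) (s - t) r)%:E.
have slice s : t < s < T -> (\int[P]_w (xi * H (s, w) * E (s, w))%:E = h s)%E.
  move=> /andP[ts sT].
  have Ds : D s by rewrite /D/= in_itv/= !ltW.
  transitivity (\int[P]_w (xi%:E * (expR (- U s w) * excess a b delta (T - s) (rt s w))%:E))%E.
    apply: eq_integral => w _; rewrite -EFinM HE// mulrA; congr (_ * _)%:E.
    by rewrite /E /ou_joint /= (max_idPr (ltW ts)).
  have [mr _ _] := rho_OU.
  rewrite ge0_integralZl//; last 3 first.
  - apply/measurable_EFinP; apply: measurable_funM.
      apply: measurableT_comp => //; apply: measurableT_comp => //.
      by apply: (measurable_integrated rho_OU); exact: ltW.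
    by apply: measurable_excess => //; apply: mr; exact: ltW.
  - by move=> w _; rewrite lee_fin mulr_ge0 ?expR_ge0 ?excess_ge0.
  - by rewrite lee_fin ltW.
  have ce := @continuous_excess R a b delta (T - s).
  have e0 := @excess_ge0 R a b delta (T - s).
  have e1 := @excess_le1 R a b delta (T - s).
  rewrite (expectation_discounted W_brownian B_brownian WB_independent a_gt0 delta_gt0 t_ge0 rho_OU ts ce e0 e1).
  rewrite /h /gain !EFinM fineK//.
  exact: gaussE_fin_num.
have mh : measurable_fun setT h.
  apply/measurable_EFinP; apply: measurable_funM => //.
  rewrite (_ : (fun s => _) = (fun u => gain a b delta (T - t - u) u r) \o (fun s => s - t)).
    apply: measurableT_comp; first exact: measurable_gain.
    exact: measurable_funB.
  by apply/funext => s /=; have -> : T - t - (s - t) = T - s by ring.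
have h0 s : (0 <= h s)%E.
  rewrite lee_fin mulr_ge0 ?(ltW xi_gt0)// mulr_ge0 ?expR_ge0// fine_ge0//.
  by apply: gaussE_ge0 => z; rewrite lee_fin excess_ge0.
have hE u : h (t + u) = (xi%:E * (gain a b delta (T - t - u) u r)%:E)%E.
  rewrite /h EFinM; have -> : T - (t + u) = T - t - u by ring.
  by have -> : t + u - t = u by ring.
clearbody h.
have V0h : (V0 = \int[mu]_(s in `]t, T[) h s)%E.
  have mslices : measurable_fun `]t, T[ (fun s => \int[P]_w (xi * H (s, w) * E (s, w))%:E)%E.
    by apply: measurable_funS (mdbl mV0 V0_ge0) => //; exact: subset_itv_oo_cc.
  rewrite /V0 /dbl /D (integral_itv_bndoo true false mslices).
  by apply: eq_integral => s; rewrite inE/= in_itv/= => /slice.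
have shift : (\int[mu]_(s in `]t, T[) h s = \int[mu]_(u in `]0%R, (T - t)%R[) h (t + u)%R)%E.
  pose g := h \_ `]t, T[.
  have mg : measurable_fun setT g.
    by apply/(measurable_restrictT h (measurable_itv _)); exact: measurable_funTS.
  have g0 s : (0 <= g s)%E by rewrite /g patchE; case: ifPn.
  transitivity (\int[mu]_s g s)%E; first by rewrite integral_mkcond.
  rewrite (@lebesgue_integral_affine R t 1 g ltr01 mg g0) mul1e.
  rewrite [RHS]integral_mkcond; apply: eq_integral => u _.
  rewrite /g !patchE mul1r !mem_setE !in_itv/= ltrDl.
  by rewrite -ltrBrDl.
have xiH0 p : 0 <= xi * H p := mulr_ge0 (ltW xi_gt0) (H0 p).
have mxiH : measurable_fun setT (fun p => xi * H p) by exact: measurable_funM.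
have V0_lty : (V0 < +oo)%E.
  apply: le_lt_trans dbl_H; apply: (dbl_le mV0 mxiH V0_ge0 xiH0) => s w _.
  by apply: ler_piMr; [exact: xiH0|exact: excess_le1].
have V0_fin : V0 \is a fin_num.
  have V0p : (0 <= V0)%E by rewrite V0h; apply: integral_ge0 => s _; exact: h0.
  by rewrite (ge0_fin_numE V0p).
have ig : mu.-integrable `]0, T - t[ (EFin \o (fun u => gain a b delta (T - t - u) u r)).
  have mg := @measurable_gain R a b delta a_gt0 (T - t) r.
  have ih : mu.-integrable `]0, T - t[ (fun u => h (t + u)).
    apply/integrableP; split.
      apply: measurable_funTS; apply: (measurableT_comp mh); exact: measurable_funD.
    have -> : (\int[mu]_(u in `]0%R, (T - t)%R[) `|h (t + u)%R| = V0)%E.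
      by rewrite V0h shift; apply: eq_integral => u _; exact: (gee0_abs (h0 _)).
    exact: V0_lty.
  have mI : @measurable _ (measurableTypeR R) `]0, T - t[%classic by exact: measurable_itv.
  have i2 := integrableZl mI xi^-1 ih.
  have <- : (fun u => (xi^-1)%:E * h (t + u)%R)%E =
      EFin \o (fun u => gain a b delta (T - t - u) u r).
    have xi_neq0 : xi != 0 by rewrite gt_eqF.
    by apply/funext => u; rewrite hE -!EFinM mulrA (mulVf xi_neq0) mul1r.
  exact: i2.
rewrite /val EFinD addeC; congr (_ + _)%E.
rewrite V0h shift EFinM /Rintegral fineK; last first.
  have mI : @measurable _ (measurableTypeR R) `]0, T - t[%classic by exact: measurable_itv.
  exact: (integrable_fin_num mI ig).
transitivity (\int[mu]_(u in `]0%R, (T - t)%R[) (xi%:E * (gain a b delta (T - t - u)%R u r)%:E))%E.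
  by apply: eq_integral => u _; exact: hE.
have mI : @measurable _ (measurableTypeR R) `]0, T - t[%classic by exact: measurable_itv.
by rewrite (integralZl mI ig).
Qed.

Section strategy.
Variable c : R -> Omega -> R.
Hypothesis c_adm : admissible P W B xi T t c.

(** A strategy is constrained only on [[t, T]]; extension by 0 makes its bounds and its
    measurability global. *)
Let c0 (p : R * Omega) : R := if (t <= p.1) && (p.1 <= T) then c p.1 p.2 else 0.

Let c0E s w : D s -> c0 (s, w) = c s w.
Proof. by rewrite /D/= in_itv/= /c0/= => ->. Qed.

Let c0_ge0 p : 0 <= c0 p.
Proof.
rewrite /c0; case: ifPn => // h; have [cb _ _] := c_adm.
by have /andP[] := cb p.1 p.2 h.
Qed.

Let c0_le p : c0 p <= xi.
Proof.
rewrite /c0; case: ifPn => h; last exact: ltW.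
by have [cb _ _] := c_adm; have /andP[] := cb p.1 p.2 h.
Qed.

Let mc0 : measurable_fun setT c0.
Proof.
have [_ mc _] := c_adm.
have mDO : measurable (D `*` [set: Omega]) by exact: measurableX.
have -> : c0 = (fun p : R * Omega => c p.1 p.2) \_ (D `*` [set: Omega]).
  apply/funext => -[s w]; rewrite /c0 patchE/=.
  case: ifPn => h; case: ifPn => //.
    by rewrite notin_setE => /=; rewrite /D/= in_itv/= h => -[].
  by rewrite inE => /= -[]; rewrite /D/= in_itv/= (negbTE h).
by apply/(measurable_restrictT _ mDO).
Qed.

Let I1 w : R := \int[mu]_(s in D) (H (s, w) * c0 (s, w)).
Let C w : R := \int[mu]_(s in D) c0 (s, w).
Let DT w : R := expR (- U T w).

Let mHc : measurable_fun setT (fun p => H p * c0 p).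
Proof. exact: measurable_funM. Qed.

Let muD_fin : (mu D < +oo)%E.
Proof. by rewrite /D lebesgue_measure_itv/= lte_fin; case: ifPn => _; rewrite -?EFinB ltry. Qed.

Let bounded_slice_integrable (F : R * Omega -> R) (K : Omega -> R) w :
  measurable_fun setT F -> (forall s, D s -> `|F (s, w)| <= K w) ->
  mu.-integrable D (EFin \o (fun s => F (s, w))).
Proof.
move=> mF FK; apply: measurable_bounded_integrable => //.
- by apply: measurable_funTS; exact: measurable_fun_pair1.
- exists (K w); split; first exact: num_real.
  by move=> z Kz s Ds; apply: le_trans (FK s Ds) _; exact: ltW.
Qed.

Let int_c0 w : mu.-integrable D (EFin \o (fun s => c0 (s, w))).
Proof.
apply: (bounded_slice_integrable (K := fun=> xi)) => // s Ds.
by rewrite ger0_norm.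
Qed.

Let int_rt w : mu.-integrable D (EFin \o (rt ^~ w)).
Proof. by have [_ cr _] := rho_OU; apply: within_integrable (cr w). Qed.

Let int_Hc w : mu.-integrable D (EFin \o (fun s => H (s, w) * c0 (s, w))).
Proof.
pose K := expR (\int[mu]_(u in D) `|rt u w|) * xi.
apply: (bounded_slice_integrable (F := fun p => H p * c0 p) (K := fun=> K)) => // s Ds.
rewrite ger0_norm ?mulr_ge0// /K ler_pM// HE// ler_expR.
have ts : t <= s by move: Ds; rewrite /D/= in_itv/= => /andP[].
have sT : s <= T by move: Ds; rewrite /D/= in_itv/= => /andP[].
have sub : `[t, s]%classic `<=` D by apply: subset_itvl; rewrite bnd_simp.
have irs : mu.-integrable `[t, s] (EFin \o (rt ^~ w)) by exact: integrableS (int_rt w).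
have iars : mu.-integrable D (EFin \o (fun u => `|rt u w|)).
  exact: (integrable_norm (int_rt w)).
apply: (@le_trans _ _ `|U s w|); first by rewrite -normrN ler_norm.
apply: le_trans (le_normr_Rintegral _ irs) _ => //.
rewrite /Rintegral fine_le//.
- apply: integrable_fin_num => //; exact: integrableS iars.
- exact: integrable_fin_num.
- apply: ge0_subset_integral => //.
  + by apply/measurable_EFinP; case/integrableP : iars => /measurable_EFinP.
Qed.

Let I1_EFin w : ((I1 w)%:E = \int[mu]_(s in D) (H (s, w) * c0 (s, w))%:E)%E.
Proof. by rewrite /I1 /Rintegral fineK//; apply: integrable_fin_num => //; exact: int_Hc. Qed.

Let C_EFin w : ((C w)%:E = \int[mu]_(s in D) (c0 (s, w))%:E)%E.
Proof. by rewrite /C /Rintegral fineK//; apply: integrable_fin_num => //; exact: int_c0. Qed.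

Let I1_ge0 w : 0 <= I1 w.
Proof. by apply: Rintegral_ge0 => s _; rewrite mulr_ge0. Qed.

Let C_ge0 w : 0 <= C w.
Proof. by apply: Rintegral_ge0 => s _. Qed.

Let mI1 : measurable_fun setT I1.
Proof. exact: (measurable_Rintegral_param (f := fun p => H p * c0 p)). Qed.

Let mC : measurable_fun setT C.
Proof. exact: (measurable_Rintegral_param (f := c0)). Qed.

Let mDT : measurable_fun setT DT.
Proof.
apply: measurableT_comp => //; apply: measurableT_comp => //.
exact: (measurable_integrated rho_OU).
Qed.

Let A := dbl (fun p => H p * c0 p).
Let Bq := dbl (fun p => H p * c0 p * Q p).

Let EI1 : (\int[P]_w (I1 w)%:E = A)%E.
Proof.
rewrite /A dbl_swap//; last by move=> p; rewrite mulr_ge0.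
by apply: eq_integral => w _; rewrite I1_EFin.
Qed.

Let A_fin : (A < +oo)%E.
Proof.
apply: le_lt_trans dbl_H; apply: dbl_le => //.
- exact: measurable_funM.
- by move=> p; rewrite mulr_ge0.
- by move=> p; rewrite mulr_ge0// ltW.
- by move=> s w _; rewrite mulrC ler_wpM2r.
Qed.

(** Tonelli brings the time integral outside, and at each time the Markov property is applied with
    the adapted weight c_s: dividends reduce the final surplus, and the discount factor at T is
    averaged to e^{-U_t^s} M(T - s, r_s). *)
Let EDC : (\int[P]_w (DT w * C w)%:E = Bq)%E.
Proof.
transitivity (\int[P]_w \int[mu]_(s in D) (DT w * c0 (s, w))%:E)%E.
  apply: eq_integral => w _; rewrite EFinM C_EFin -ge0_integralZl//.
  - by have /integrableP[] := int_c0 w.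
  - by move=> s _; rewrite lee_fin.
  - by rewrite lee_fin expR_ge0.
rewrite -(dbl_swap (F := fun p => DT p.2 * c0 p)); last 2 first.
- by apply: measurable_funM => //; exact: measurableT_comp.
- by move=> p; rewrite mulr_ge0// expR_ge0.
apply: eq_integral => s; rewrite inE => Ds.
have /andP[ts sT] : t <= s <= T by move: Ds; rewrite /D/= in_itv.
have [cb _ ca] := c_adm.
have ac : adapted s (c s) by apply/adaptedP; apply: ca; rewrite ts.
have c_ge0 w : 0 <= c s w by rewrite -c0E.
transitivity (\int[P]_w (c s w * expR (- U T w))%:E)%E.
  by apply: eq_integral => w _; rewrite /= c0E// mulrC.
rewrite (ou_markov W_brownian B_brownian WB_independent a_gt0 delta_gt0 t_ge0 rho_OU ts sT c_ge0 ac).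
by apply: eq_integral => w _; rewrite HE// QE// c0E// (mulrC (c s w)).
Qed.

Let iDT : P.-integrable setT (EFin \o DT).
Proof.
apply/integrableP; split; first exact/measurable_EFinP.
under eq_integral do rewrite gee0_abs ?lee_fin ?expR_ge0//.
by rewrite (expectation_disc W_brownian B_brownian WB_independent a_gt0 delta_gt0 t_ge0 rho_OU tT) ltry.
Qed.

Let iI1 : P.-integrable setT (EFin \o I1).
Proof.
apply/integrableP; split; first exact/measurable_EFinP.
by under eq_integral do rewrite gee0_abs ?lee_fin//; rewrite EI1.
Qed.

Let iDC : P.-integrable setT (EFin \o (fun w => DT w * C w)).
Proof.
have iK : P.-integrable setT (EFin \o (fun w => (xi * fine (mu D)) * DT w)).
  by have := integrableZl measurableT (xi * fine (mu D)) iDT.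
apply: le_integrable iK => //.
  by apply/measurable_EFinP; exact: measurable_funM.
move=> w _ /=; rewrite lee_fin !normrM (ger0_norm (expR_ge0 _)) mulrC.
rewrite ler_wpM2r ?expR_ge0// -normrM !ger0_norm//.
  rewrite -(Rintegral_cst mu mD); apply: le_Rintegral => //.
  by apply: continuous_integrable => z; exact: cvg_cst.
by rewrite mulr_ge0 ?fine_ge0// ltW.
Qed.

Let ae_integrable (f g : Omega -> R) : measurable_fun setT f ->
  {ae P, forall w, f w = g w} -> P.-integrable setT (EFin \o g) ->
  P.-integrable setT (EFin \o f) /\ (\int[P]_w (f w)%:E = \int[P]_w (g w)%:E)%E.
Proof.
move=> mf fg ig.
have mg : measurable_fun setT g by case/integrableP : ig => /measurable_EFinP.
split; last first.
  apply: ae_eq_integral => //; [exact/measurable_EFinP|exact/measurable_EFinP|].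
  by apply: filterS fg => w ->.
apply/integrableP; split; first exact/measurable_EFinP.
case/integrableP : ig => _; apply: le_lt_trans; rewrite le_eqVlt; apply/orP; left; apply/eqP.
apply: ae_eq_integral => //.
- by apply: measurableT_comp => //; exact/measurable_EFinP.
- by apply: measurableT_comp => //; exact/measurable_EFinP.
by apply: filterS fg => w /= ->.
Qed.

Let DW w : R := DT w * (W T w - W t w).

(** The discount factor agrees almost surely with [X], a function of the noise of B, hence
    measurable for B alone and independent of the increment of W. For t = T the increment is 0,
    without a normal law of positive variance. *)
Let iDW : P.-integrable setT (EFin \o DW) /\ (\int[P]_w (DW w)%:E = 0)%E.
Proof.
move: tT; rewrite le_eqVlt => /predU1P[tTe|tTlt].
  have -> : DW = fun=> 0.
    by apply/funext => w; rewrite /DW {1}tTe subrr mulr0.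
  by split; [exact: integrable0|rewrite integral0].
pose X w := expR (- (r * ou_beta a (T - t) + b * (T - t - ou_beta a (T - t)) + delta * ou_noise B a t T w)).
have sX : measurable_fun [set: g_sigma_algebraType (path_events B `[0, +oo[)] X.
  apply: (measurableT_comp (T1 := g_sigma_algebraType _)) => //.
  apply: (measurableT_comp (T1 := g_sigma_algebraType _)) => //.
  apply: (measurable_funD (T := g_sigma_algebraType _)) => //.
  apply: (measurable_funM (T := g_sigma_algebraType _)) => //.
  apply: (noise_measurable_wrt B_brownian a_gt0) => // u /andP[tu uT] _ S mS.
  rewrite setTI; apply: sub_sigma_algebra; exists u, S; split => //=.
  by rewrite in_itv/= (le_trans t_ge0 tu).
have X0 w : 0 <= X w by exact: expR_ge0.
have XD : {ae P, forall w, DT w = X w}.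
  have := ou_explicit_integral B_brownian a_gt0 t_ge0 rho_OU.
  by apply: filterS => w h; rewrite /DT h.
have mX : measurable_fun setT X.
  apply: measurableT_comp => //; apply: measurableT_comp => //.
  apply: measurable_funD => //; apply: measurable_funM => //.
  exact: (measurable_noise W_brownian B_brownian).
have iX : P.-integrable setT (EFin \o X).
  by have [] := ae_integrable mX (filterS (fun w => @esym _ _ _) XD) iDT.
have mWs s : 0 <= s -> measurable_fun setT (W s) by exact: (measurable_B W_brownian).
have [i0 e0] := sigma_B_indep_W W_brownian B_brownian WB_independent t_ge0 tTlt sX X0 iX.
have mDW : measurable_fun setT DW.
  apply: measurable_funM => //; apply: measurable_funB; apply: mWs => //.
  exact: le_trans t_ge0 tT.
have DWX : {ae P, forall w, DW w = X w * (W T w - W t w)}.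
  by apply: filterS XD => w h; rewrite /DW h.
have [i1 e1] := ae_integrable mDW DWX i0.
split => //; rewrite e1.
have := e0; rewrite /Rintegral => e2.
by rewrite -[LHS]fineK ?e2//; apply: integrable_fin_num.
Qed.

(* By the Markov property a unit paid out at s, instead of being kept until T, changes
   the return by E[e^{-U_t^s} (1 - M(T - s, r_s))]. *)
Lemma return_decomposition :
  (return_function P rho W m sigma T c t r x = A - Bq + (k * disc (T - t) r)%:E)%E.
Proof.
have [iW eW] := iDW.
have DTE : (\int[P]_w (DT w)%:E = (disc (T - t) r)%:E)%E.
  exact: (expectation_disc W_brownian B_brownian WB_independent a_gt0 delta_gt0 t_ge0 rho_OU tT).
rewrite /return_function unlock.
transitivity (\int[P]_w (((I1 w)%:E - (DT w * C w)%:E) + (k%:E * (DT w)%:E + sigma%:E * (DW w)%:E)))%E.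
  apply: eq_integral => w _; rewrite -!EFinM -EFinB -!EFinD; congr (_%:E).
  have -> : \int[mu]_(s in `[t, T]) (expR (- integrated_rate rt t s w) * c s w) = I1 w.
    by apply: eq_Rintegral => s; rewrite inE => Ds; rewrite HE// c0E.
  rewrite /surplus.
  have -> : \int[mu]_(u in `[t, T]) (m - c u w) = m * (T - t) - C w.
    transitivity (\int[mu]_(u in D) (cst m u - c0 (u, w))).
      by apply: eq_Rintegral => s; rewrite inE => Ds; rewrite c0E.
    rewrite RintegralB//; last by apply: continuous_integrable => z; exact: cvg_cst.
    rewrite Rintegral_cst//= /D lebesgue_measure_itv/= lte_fin -/D; congr (_ * _ - _).
    have [_|Tt] := ltP t T; first by rewrite -EFinB.
    by have -> : t = T; [apply/eqP; rewrite eq_le tT Tt|rewrite subrr].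
  by rewrite /DW /k -/(DT w); ring.
rewrite integralD//; last 2 first.
- exact: integrableB.
- by apply: integrableD => //; exact: integrableZl.
rewrite integralB// integralD//; last 2 first.
- exact: integrableZl.
- exact: integrableZl.
by rewrite !integralZl// DTE eW mule0 adde0 EI1 EDC -EFinM.
Qed.

Let Bq_fin : (Bq \is a fin_num)%E.
Proof. by rewrite -EDC; apply: integrable_fin_num. Qed.

Let mBq : measurable_fun setT (fun p => H p * c0 p * Q p).
Proof. exact: measurable_funM. Qed.

Let Bq_ge0 p : 0 <= H p * c0 p * Q p. Proof. by rewrite !mulr_ge0. Qed.

Let reorder (u v w : \bar R) : (v \is a fin_num -> u = v + w -> u - v = w)%E.
Proof. by move=> fv ->; rewrite addeAC subee// add0e. Qed.

(** The finite integral [Bq] is moved to the other side, so that nonnegative integrands are compared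
    pointwise: H c is at most H c Q + xi H (1 - Q)^+. *)
Lemma return_le : (return_function P rho W m sigma T c t r x <= V0 + (k * disc (T - t) r)%:E)%E.
Proof.
rewrite return_decomposition leeD2r// leeBlDl//.
rewrite /Bq /V0 -dbl_add//; apply: dbl_le => //.
- exact: measurable_funD.
- by move=> p; rewrite mulr_ge0.
- by move=> p; rewrite addr_ge0.
move=> s w _; rewrite /E /excess -/(Q (s, w)).
have hc : 0 <= H (s, w) * c0 (s, w) by rewrite mulr_ge0.
have [Q1|Q1] := leP 0 (1 - Q (s, w)).
  rewrite -lerBlDl -{1}[H (s, w) * c0 (s, w)]mulr1 -mulrBr.
  by rewrite ler_wpM2r// mulrC ler_wpM2r.
rewrite mulr0 addr0 ler_peMr//.
by rewrite -subr_le0 ltW.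
Qed.

(** Equality in the pointwise comparison. At s = T one has Q = 1, so the value of the strategy there
    does not matter. *)
Lemma return_eq : (forall s w, t <= s < T -> c s w = if Q (s, w) < 1 then xi else 0) ->
  return_function P rho W m sigma T c t r x = val%:E.
Proof.
move=> cE; rewrite return_decomposition -V0E; congr (_ + _)%E; apply: reorder => //.
rewrite /Bq /V0 -dbl_add//; apply: eq_integral => s; rewrite inE => Ds.
apply: eq_integral => w _; congr (_%:E).
rewrite c0E// /E /excess -/(Q (s, w)).
move: (Ds); rewrite /D /= in_itv/= => /andP[ts].
rewrite le_eqVlt => /predU1P[sT|sT].
  have -> : Q (s, w) = 1 by rewrite /Q /= sT subrr ou_disc0.
  by rewrite subrr maxxx; ring.
rewrite cE ?ts//; case: ltP => Q1.
  by rewrite (max_idPr _) ?subr_ge0 ?ltW//; ring.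
by rewrite (max_idPl _) ?subr_le0//; ring.
Qed.

End strategy.

Lemma return_le_value c : admissible P W B xi T t c ->
  (return_function P rho W m sigma T c t r x <= val%:E)%E.
Proof. by move=> /return_le; rewrite V0E. Qed.

Let cstar s w : R := if alpha a b delta T s < rt s w then xi else 0.

Lemma cstar_admissible : admissible P W B xi T t cstar.
Proof.
have xi0 := ltW xi_gt0.
have mcut s (S : set R) : measurable S ->
    measurable ((fun z : R => if alpha a b delta T s < z then xi else 0) @^-1` S).
  move=> mS; rewrite -[_ @^-1` _]setTI.
  apply: (measurable_fun_ifT (T1 := R)) => //.
  exact: measurable_fun_ltr.
split.
- by move=> s w _; rewrite /cstar; case: ifP => _; rewrite ?xi0 ?lexx.
(* At s = T the threshold is 0 by convention and no longer the place where M(T - s, .) crosses 1,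
   hence a separate branch. *)
- pose G (p : R * Omega) : R :=
    if p.1 == T then (if 0 < ou_joint t rt p then xi else 0)
    else (if ou_disc a b delta (T - p.1) (ou_joint t rt p) < 1 then xi else 0).
  apply: (eq_measurable_fun G).
    move=> [s w]; rewrite inE /= => -[]; rewrite in_itv/= => /andP[ts sT] _.
    rewrite /G /cstar /= /ou_joint /= (max_idPr ts).
    have [->|sT'] := eqVneq s T; first by rewrite /alpha eqxx.
    by rewrite alpha_lt// lt_neqAle sT' sT.
  apply: measurable_funTS; apply: measurable_fun_ifT.
  - by apply: measurable_fun_eqr.
  - apply: measurable_fun_ifT => //; apply: measurable_fun_ltr => //.
    exact: measurable_ou_joint rho_OU.
  - apply: measurable_fun_ifT => //; apply: measurable_fun_ltr => //.
- move=> s /andP[ts sT] S mS.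
  have ar := adapted_ou (W := W) B_brownian a_gt0 t_ge0 rho_OU ts.
  by move/adaptedP : ar => /(_ _ (mcut s S mS)).
Qed.

Lemma return_cstar : return_function P rho W m sigma T cstar t r x = val%:E.
Proof.
apply: return_eq; first exact: cstar_admissible.
move=> s w /andP[ts sT]; rewrite /cstar alpha_lt// /Q /ou_joint /=.
by rewrite (max_idPr ts).
Qed.

End verification.

(** * Closed form of the gain and its derivatives *)

Section normal_cdf.
Variable R : realType.
Notation mu := lebesgue_measure.
Local Notation n01 := (@normal_pdf R 0 1).

(* By symmetry this is the cumulative distribution function of N(0,1). *)
Definition Phi (x : R) : R := \int[mu]_(z in `]- x, +oo[) n01 z.

Lemma n01E z : n01 z = normal_peak 1 * expR (- z ^+ 2 / 2).
Proof.
rewrite normal_pdfE ?oner_neq0// /normal_fun subr0 expr1n.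
by congr (_ * expR (_ / _)); rewrite mulr2n.
Qed.

Lemma n01N z : n01 (- z) = n01 z. Proof. by rewrite !n01E sqrrN. Qed.

Lemma n01_ge0 z : 0 <= n01 z. Proof. exact: normal_pdf_ge0. Qed.

Lemma n01_le z : n01 z <= normal_peak 1.
Proof. by apply: normal_pdf_ub; rewrite oner_neq0. Qed.

Lemma continuous_n01 : continuous n01.
Proof. by apply: continuous_normal_pdf; rewrite oner_neq0. Qed.

Lemma integrable_n01 (A : set R) : measurable A -> mu.-integrable A (EFin \o n01).
Proof. by move=> mA; apply: integrableS (@integrable_normal_pdf R 0 1). Qed.

Lemma Phi_ge0 x : 0 <= Phi x.
Proof. by apply: Rintegral_ge0 => z _; exact: n01_ge0. Qed.

Lemma Phi_NyE x : Phi x = 1 - \int[mu]_(z in `]-oo, - x]) n01 z.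
Proof.
apply/eqP; rewrite eq_sym subr_eq eq_sym; apply/eqP.
rewrite addrC /Phi -Rintegral_setU//.
- rewrite (_ : _ `|` _ = setT); first by rewrite /Rintegral integral_normal_pdf.
  apply/seteqP; split => z //= _; rewrite !in_itv/= andbT.
  by have [?|?] := leP z (- x); [left|right].
- by apply: integrable_n01; apply: measurableU; exact: measurable_itv.
apply/disj_setPS => z [] /=; rewrite !in_itv/= andbT => zx xz.
by move: (le_lt_trans zx xz); rewrite ltxx.
Qed.

Lemma Phi_le1 x : Phi x <= 1.
Proof.
by rewrite Phi_NyE gerBl; apply: Rintegral_ge0 => z _; exact: n01_ge0.
Qed.

Lemma is_derive_Phi (x : R) : is_derive x 1 Phi (n01 x).
Proof.
pose F y : R := \int[mu]_(z in `]-oo, y]) n01 z.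
have dF y : is_derive y (1 : R) F (n01 y).
  have y1 : y < y + 1 by rewrite ltrDl.
  have [||d e] := @continuous_FTC1 R n01 -oo%O y (y + 1) y1 _ _ (@continuous_n01 y).
  - by apply: integrable_n01; exact: measurable_itv.
  - by rewrite ltNyr.
  by apply: DeriveDef => //; rewrite -derive1E.
have -> : Phi = fun z => 1 - F (- z) by apply/funext => z; rewrite Phi_NyE.
have hN : is_derive x (1 : R) (fun z : R => - z) (-1) by exact: is_deriveNid.
have := @is_derive1_comp R F (fun z => - z) x _ _ (dF _) hN.
move=> h; apply: is_derive_eq; rewrite n01N; ring.
Qed.

Lemma continuous_Phi : continuous Phi.
Proof. by move=> x; exact: is_derive_continuous (is_derive_Phi x). Qed.

(* When [p1 n(d) = p2 n(d - e)] the derivative of [d] cancels out. *)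
Lemma is_derive_black_scholes (p1 p2 D e : R -> R) (z dp1 dp2 dD de : R) :
  is_derive z 1 p1 dp1 -> is_derive z 1 p2 dp2 -> is_derive z 1 D dD ->
  is_derive z 1 e de -> p1 z * n01 (D z) = p2 z * n01 (D z - e z) ->
  is_derive z 1 (fun z => p1 z * Phi (D z) - p2 z * Phi (D z - e z))
    (dp1 * Phi (D z) - dp2 * Phi (D z - e z) + p1 z * n01 (D z) * de).
Proof.
move=> h1 h2 h3 h4 H.
have h5 := @is_derive1_comp R Phi D z _ _ (is_derive_Phi _) h3.
have h6 : is_derive z 1 (fun z => D z - e z) (dD - de) by exact: is_deriveB.
have h7 := @is_derive1_comp R Phi (fun z => D z - e z) z _ _ (is_derive_Phi _) h6.
have h8 := is_deriveM h1 h5.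
have h9 := is_deriveM h2 h7.
have h10 := is_deriveB h8 h9.
move/is_derive_eq : h10; apply.
rewrite /GRing.scale /=.
transitivity (dp1 * Phi (D z) - dp2 * Phi (D z - e z) + p1 z * n01 (D z) * dD
  - (p2 z * n01 (D z - e z)) * (dD - de)); first by ring.
by rewrite -H; ring.
Qed.

End normal_cdf.

Section closed_form.
Variables (R : realType) (a b delta : R).
Hypotheses (a_gt0 : 0 < a) (delta_gt0 : 0 < delta).
Notation mu := lebesgue_measure.
Let a_neq0 : a != 0. Proof. by rewrite gt_eqF. Qed.
Local Notation beta := (ou_beta a).
Local Notation disc := (ou_disc a b delta).
Local Notation mean := (ou_mean a b delta).
Local Notation n01 := (@normal_pdf R 0 1).

Definition ou_sd u : R := Num.sqrt (phi_var a delta u).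

Definition ou_alpha L : R := ou_logdisc0 a b delta L / beta L.

Definition bs_d L u r : R := (mean u r - ou_alpha L) / ou_sd u.

Definition bs_gain L u r : R :=
  disc u r * Phi (bs_d L u r) - disc (u + L) r * Phi (bs_d L u r - ou_sd u * beta L).

Lemma ou_sd_gt0 u : 0 < u -> 0 < ou_sd u.
Proof. by move=> u0; rewrite sqrtr_gt0 phi_var_gt0. Qed.

Lemma phi_varE u : phi_var a delta u = delta ^+ 2 * (beta u - a * beta u ^+ 2 / 2).
Proof.
rewrite /phi_var (_ : expR (- (2 * a * u)) = (1 - a * beta u) ^+ 2); last first.
  by rewrite -expR_ou_beta// expr2 -expRD; congr expR; ring.
by field.
Qed.

Lemma sqr_ou_sd u : 0 < u -> ou_sd u ^+ 2 = delta ^+ 2 * (beta u - a * beta u ^+ 2 / 2).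
Proof. by move=> u0; rewrite sqr_sqrtr ?ltW ?phi_var_gt0// phi_varE. Qed.

Lemma ou_betaD u L : beta (u + L) = beta u + beta L - a * beta u * beta L.
Proof.
have h : expR (- (a * (u + L))) = (1 - a * beta u) * (1 - a * beta L).
  by rewrite -!expR_ou_beta// -expRD; congr expR; ring.
by rewrite {1}/ou_beta h; field.
Qed.

(* The semigroup property of the discount factor: averaging [disc L] against the
   tilted law of r_u gives [disc (u + L)]. *)
Lemma ou_disc_semigroup u L r : 0 < u ->
  disc (u + L) r = disc u r *
    expR (ou_logdisc0 a b delta L - beta L * mean u r + (beta L * ou_sd u) ^+ 2 / 2).
Proof.
move=> u0; rewrite !ou_discE -expRD; congr expR.
rewrite exprMn sqr_ou_sd// /ou_logdisc0 /ou_int_beta2 /ou_mean expR_ou_beta// ou_betaD.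
by field.
Qed.

(** The exponents cancel because the product of [bs_d], [ou_sd u] and beta(L) is mean * beta(L) -
    [ou_logdisc0] at L; this reflects that 1 - M(L, z) vanishes at the threshold. *)
Lemma bs_identity L u r : 0 < u -> 0 < L ->
  disc u r * n01 (bs_d L u r) = disc (u + L) r * n01 (bs_d L u r - ou_sd u * beta L).
Proof.
move=> u0 L0; have s0 := ou_sd_gt0 u0; have b0 := ou_beta_gt0 a_gt0 L0.
rewrite ou_disc_semigroup// !n01E -mulrA; congr (_ * _).
rewrite mulrCA -expRD; congr (_ * expR _).
rewrite /bs_d /ou_alpha; field.
by rewrite !gt_eqF.
Qed.

(** Write r_u as its mean plus [s] times a standard normal z: the rate exceeds the threshold for z >
    - D. In the second term M(L, r_u) is an exponential of z, which tilts the standard normal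
    density to one centred at [c]. *)
Lemma gain_bs_gain L u r : 0 < u -> 0 < L -> gain a b delta L u r = bs_gain L u r.
Proof.
move=> u0 L0; have s0 := ou_sd_gt0 u0; have b0 := ou_beta_gt0 a_gt0 L0.
pose s := ou_sd u; pose c := - (beta L * s); pose D := bs_d L u r.
(* [K] is the mean of M(L, r_u) under the discounted law, the factor by which [disc u r] becomes
   [disc (u + L) r]. *)
pose K := expR (ou_logdisc0 a b delta L - beta L * mean u r + (beta L * s) ^+ 2 / 2).
have iK : mu.-integrable `]- D, +oo[ (EFin \o normal_pdf c 1).
  apply: integrableS (@integrable_normal_pdf R c 1) => //; exact: measurable_itv.
have iKK : mu.-integrable `]- D, +oo[ (EFin \o (fun z => K * normal_pdf c 1 z)).
  have mI : @measurable _ (measurableTypeR R) `]- D, +oo[%classic by exact: measurable_itv.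
  exact: (integrableZl mI K iK).
have shift : \int[mu]_(z in `]- D, +oo[) normal_pdf c 1 z = Phi (D - s * beta L).
  rewrite /Phi /Rintegral; congr fine.
  rewrite integral_mkcond.
  pose g : R -> \bar R := (EFin \o normal_pdf c 1) \_ `]- D, +oo[.
  have mg : measurable_fun setT g.
    apply/(measurable_restrictT _ (measurable_itv _)); apply: measurable_funTS.
    by apply/measurable_EFinP; exact: measurable_normal_pdf.
  have g0 z : (0 <= g z)%E.
    by rewrite /g patchE; case: ifPn => // _; rewrite lee_fin normal_pdf_ge0.
  transitivity (\int[mu]_z g z)%E; first by [].
  rewrite (@lebesgue_integral_affine R c 1 g ltr01 mg g0) mul1e.
  rewrite [RHS]integral_mkcond; apply: eq_integral => z _.
  rewrite /g !patchE mul1r !mem_setE !in_itv/= !andbT.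
  have -> : (- D < c + z) = (- (D - s * beta L) < z).
    by rewrite -ltrBlDl; congr (_ < _); rewrite /c; ring.
  case: ifP => // _; rewrite /= !normal_pdfE ?oner_neq0// /normal_fun.
  by rewrite subr0 addrAC subrr add0r.
rewrite /gain /bs_gain (ou_disc_semigroup L r u0) -/s -/K -/D -mulrA -mulrBr; congr (_ * _).
rewrite /gaussE ge0_integral_normal_prob//; last 2 first.
- apply/measurable_EFinP; apply: measurableT_comp.
    by apply: continuous_measurable_fun; exact: continuous_excess.
  by apply: measurable_funD => //; exact: measurable_funM.
- by move=> z; rewrite lee_fin excess_ge0.
transitivity (\int[mu]_(z in `]- D, +oo[) (n01 z - K * normal_pdf c 1 z)); last first.
  rewrite RintegralB//; last exact: integrable_n01.
  by rewrite RintegralZl// shift.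
rewrite /Rintegral [in RHS]integral_mkcond; congr fine; apply: eq_integral => z _.
rewrite patchE mem_setE in_itv/= andbT -EFinM /excess -/(ou_sd u) -/s.
have dE : disc L (mean u r + s * z) * n01 z = K * normal_pdf c 1 z.
  rewrite ou_discE /K.
  have := @normal_pdf_tilt R 0 1 c z (oner_neq0 _).
  rewrite mulr0 !add0r expr1n !mulr1 => h.
  have -> : expR (ou_logdisc0 a b delta L - (mean u r + s * z) * beta L) =
    expR (ou_logdisc0 a b delta L - beta L * mean u r) * expR (c * z).
    by rewrite -expRD; congr expR; rewrite /c; ring.
  rewrite -mulrA h mulrA -expRD; congr (expR _ * _).
  by rewrite /c sqrrN.
have cut : (- D < z) = (disc L (mean u r + s * z) < 1).
  have -> : (disc L (mean u r + s * z) < 1) = (disc L (mean u r + s * z) < expR 0).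
    by rewrite expR0.
  rewrite ou_discE ltr_expR subr_lt0 -ltr_pdivrMr// -/(ou_alpha L).
  by rewrite /D /bs_d -/s -mulNr ltr_pdivrMr// opprB ltrBlDl (mulrC z).
rewrite cut; case: ifPn => h.
  by rewrite (max_idPr _) ?subr_ge0 ?ltW// mulrBl mul1r dE.
by rewrite (max_idPl _) ?mul0r// subr_le0 leNgt.
Qed.

End closed_form.

(** * Derivatives and backward equation of the gain *)

Section gain_derivatives.
Variables (R : realType) (a b delta : R).
Hypotheses (a_gt0 : 0 < a) (delta_gt0 : 0 < delta).
Let a_neq0 : a != 0. Proof. by rewrite gt_eqF. Qed.
Local Notation beta := (ou_beta a).
Local Notation disc := (ou_disc a b delta).
Local Notation mean := (ou_mean a b delta).
Local Notation n01 := (@normal_pdf R 0 1).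
Local Notation sd := (ou_sd a delta).
Local Notation bsd := (bs_d a b delta).
Local Notation bsgain := (bs_gain a b delta).

(** The time derivative of M, in the form of its backward equation with M_r = - beta M and M_rr =
    beta^2 M. *)
Definition disc_dt x r : R :=
  disc x r * (delta ^+ 2 * beta x ^+ 2 / 2 - a * (b - r) * beta x - r).

Definition ou_sd_dt u : R := delta ^+ 2 * expR (- (a * u)) ^+ 2 / (2 * sd u).

Lemma is_derive_disc (u : R -> R) (z du r : R) : is_derive z 1 u du ->
  is_derive z 1 (fun z => disc (u z) r) (disc_dt (u z) r * du).
Proof.
move=> hu.
have h1 := @is_derive1_comp R beta u z _ _ (is_derive_ou_beta (u z) a_neq0) hu.
have h2 := @is_derive1_comp R (ou_int_beta2 a) u z _ _ (is_derive_ou_int_beta2 (u z) a_neq0) hu.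
pose q y := - r * beta (u y) - b * (u y - beta (u y)) + delta ^+ 2 / 2 * ou_int_beta2 a (u y).
have hq : is_derive z 1 q (- r * (expR (- (a * u z)) * du) - b * (du - expR (- (a * u z)) * du)
   + delta ^+ 2 / 2 * (beta (u z) ^+ 2 * du)).
  exact: (is_deriveD (is_deriveB (is_deriveZ (- r) h1) (is_deriveZ b (is_deriveB hu h1)))
    (is_deriveZ (delta ^+ 2 / 2) h2)).
have -> : (fun z => disc (u z) r) = expR \o q.
  by apply/funext => y; rewrite /ou_disc /q /=; congr expR; ring.
have := @is_derive1_comp R expR q z _ _ (is_derive_expR _) hq.
move/is_derive_eq; apply.
rewrite /disc_dt (_ : expR (q z) = disc (u z) r); last first.
  by rewrite /ou_disc /q /=; congr expR; ring.
by rewrite expR_ou_beta//; ring.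
Qed.

Lemma is_derive_ou_sd (u : R) : 0 < u -> is_derive u 1 sd (ou_sd_dt u).
Proof.
move=> u0; have s0 := ou_sd_gt0 a_gt0 delta_gt0 u0.
pose q x := delta ^+ 2 * (beta x - a / 2 * (beta x * beta x)).
have hb := is_derive_ou_beta u a_neq0.
have hq : is_derive u 1 q (delta ^+ 2 * expR (- (a * u)) ^+ 2).
  have h := is_deriveZ (delta ^+ 2) (is_deriveB hb (is_deriveZ (a / 2) (is_deriveM hb hb))).
  move/is_derive_eq : h; apply.
  by rewrite /GRing.scale/= expR_ou_beta//; field.
have E : sd = Num.sqrt \o q.
  by apply/funext => x; rewrite /ou_sd /= phi_varE//; congr Num.sqrt; rewrite /q; field.
have q0 : 0 < q u by move: s0; rewrite E /= sqrtr_gt0.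
have hs := @is_derive1_sqrt R (q u) q0.
have := @is_derive1_comp R Num.sqrt q u _ _ hs hq.
rewrite -E => /is_derive_eq; apply.
rewrite /ou_sd_dt E /= mulrC -mulrA; congr (_ * (_ * _)).
Qed.

(* Derivative of [bs_gain L u r] along a path (u, L) with velocity (du, dL). *)
Definition gain_dt L u r du dL : R :=
  disc_dt u r * du * Phi (bsd L u r)
  - disc_dt (u + L) r * (du + dL) * Phi (bsd L u r - sd u * beta L)
  + disc u r * n01 (bsd L u r)
    * (ou_sd_dt u * du * beta L + sd u * (expR (- (a * L)) * dL)).

Lemma is_derive_gain (u L : R -> R) (z r du dL : R) : 0 < u z -> 0 < L z ->
  is_derive z 1 u du -> is_derive z 1 L dL ->
  is_derive z 1 (fun z => bsgain (L z) (u z) r) (gain_dt (L z) (u z) r du dL).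
Proof.
move=> u0 L0 hu hL.
have s0 := ou_sd_gt0 a_gt0 delta_gt0 u0; have b0 := ou_beta_gt0 a_gt0 L0.
have hs := @is_derive1_comp R sd u z _ _ (is_derive_ou_sd u0) hu.
have hbu := @is_derive1_comp R beta u z _ _ (is_derive_ou_beta (u z) a_neq0) hu.
have hbL := @is_derive1_comp R beta L z _ _ (is_derive_ou_beta (L z) a_neq0) hL.
have hiL := @is_derive1_comp R (ou_int_beta2 a) L z _ _ (is_derive_ou_int_beta2 (L z) a_neq0) hL.
(* Differentiability is enough: the derivative of [bsd] drops out of the result by [bs_identity]. *)
have dD : derivable (fun z => bsd (L z) (u z) r) z 1.
  have -> : (fun z => bsd (L z) (u z) r) = fun z =>
     (r * (1 - a * beta (u z)) + a * b * beta (u z) - delta ^+ 2 / 2 * (beta (u z) * beta (u z))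
      - (- b * (L z - beta (L z)) + delta ^+ 2 / 2 * ou_int_beta2 a (L z)) * (beta (L z))^-1)
      * (sd (u z))^-1.
    apply/funext => y; rewrite /bs_d /ou_alpha /ou_mean /ou_logdisc0 expR_ou_beta//.
    congr ((_ - _ * _) * _); first by rewrite expr2; field.
    by field.
  have s1 : sd (u z) != 0 by rewrite gt_eqF.
  have b1 : beta (L z) != 0 by rewrite gt_eqF.
  have hm := is_deriveB (is_deriveD (is_deriveZ r (is_deriveB (is_derive_cst (1 : R) z 1)
    (is_deriveZ a hbu))) (is_deriveZ (a * b) hbu)) (is_deriveZ (delta ^+ 2 / 2) (is_deriveM hbu hbu)).
  have hl := is_deriveM (is_deriveD (is_deriveZ (- b) (is_deriveB hL hbL))
    (is_deriveZ (delta ^+ 2 / 2) hiL)) (@is_deriveV _ (beta \o L) z _ _ b1 hbL).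
  have X := is_deriveM (is_deriveB hm hl) (@is_deriveV _ (sd \o u) z _ _ s1 hs).
  exact: (@ex_derive _ _ _ _ _ _ _ X).
have hD := derivableP dD.
have h1 := is_derive_disc r hu.
have h2 := is_derive_disc r (is_deriveD hu hL).
have h4 := is_deriveM hs hbL.
have H := bs_identity b a_gt0 delta_gt0 r u0 L0.
have := is_derive_black_scholes h1 h2 hD h4 H.
move/is_derive_eq; apply.
rewrite /gain_dt /GRing.scale /=; congr (_ + _); congr (_ * _); ring.
Qed.

Lemma is_derive_bs_d (L u r : R) : is_derive r 1 (bsd L u) (expR (- (a * u)) / sd u).
Proof.
have -> : bsd L u = fun r => (expR (- (a * u)) / sd u) * r +
   (a * b * beta u - delta ^+ 2 * beta u ^+ 2 / 2 - ou_alpha a b delta L) / sd u.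
  by apply/funext => y; rewrite /bs_d /ou_mean; ring.
have h := is_deriveD (is_deriveZ (expR (- (a * u)) / sd u) (is_derive_id r 1))
  (is_derive_cst ((a * b * beta u - delta ^+ 2 * beta u ^+ 2 / 2 - ou_alpha a b delta L) / sd u) r 1).
by move/is_derive_eq : h; apply; rewrite /GRing.scale /= addr0 mulr1.
Qed.

Lemma is_derive_disc_r (x r : R) : is_derive r 1 (disc x) (- beta x * disc x r).
Proof.
have -> : disc x = fun r => expR (ou_logdisc0 a b delta x) * expR (- beta x * r).
  by apply/funext => y; rewrite ou_discE -expRD; congr expR; ring.
have := is_deriveZ (expR (ou_logdisc0 a b delta x)) (is_derive_expRM (- beta x) r).
by move/is_derive_eq; apply; rewrite /GRing.scale /=; ring.
Qed.

Definition gain_dr L u r : R :=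
  - beta u * disc u r * Phi (bsd L u r)
  - (- beta (u + L) * disc (u + L) r) * Phi (bsd L u r - sd u * beta L).

(** The density term is written with [ou_sd_dt], so that delta^2 / 2 times it is the density term of
    [gain_dt] for velocity (1, 0). *)
Definition gain_drr L u r : R :=
  beta u ^+ 2 * disc u r * Phi (bsd L u r)
  - beta (u + L) ^+ 2 * disc (u + L) r * Phi (bsd L u r - sd u * beta L)
  + 2 / delta ^+ 2 * (disc u r * n01 (bsd L u r) * (ou_sd_dt u * beta L)).

Lemma is_derive_gain_r (L u r : R) : 0 < u -> 0 < L ->
  is_derive r 1 (bsgain L u) (gain_dr L u r).
Proof.
move=> u0 L0; have H := bs_identity b a_gt0 delta_gt0 r u0 L0.
have := is_derive_black_scholes (is_derive_disc_r u r) (is_derive_disc_r (u + L) r)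
  (is_derive_bs_d L u r) (is_derive_cst (sd u * beta L) r 1) H.
by move/is_derive_eq; apply; rewrite mulr0 addr0.
Qed.

Lemma is_derive_gain_rr (L u r : R) : 0 < u -> 0 < L ->
  is_derive r 1 (gain_dr L u) (gain_drr L u r).
Proof.
move=> u0 L0; have H := bs_identity b a_gt0 delta_gt0 r u0 L0.
have s0 := ou_sd_gt0 a_gt0 delta_gt0 u0.
have hD := is_derive_bs_d L u r.
have hD2 := is_deriveB hD (is_derive_cst (sd u * beta L) r 1).
have h1 := @is_derive1_comp R (@Phi R) (bsd L u) r _ _ (is_derive_Phi _) hD.
have h2 := @is_derive1_comp R (@Phi R) (fun r => bsd L u r - sd u * beta L) r _ _ (is_derive_Phi _) hD2.
have h3 := is_deriveM (is_deriveZ (- beta u) (is_derive_disc_r u r)) h1.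
have h4 := is_deriveM (is_deriveZ (- beta (u + L)) (is_derive_disc_r (u + L) r)) h2.
have := is_deriveB h3 h4; move/is_derive_eq; apply.
rewrite /gain_drr /GRing.scale /= /ou_sd_dt.
set p1 := Phi _; set p2 := Phi (_ - _).
transitivity (beta u ^+ 2 * disc u r * p1 - beta (u + L) ^+ 2 * disc (u + L) r * p2
   - beta u * (disc u r * n01 (bsd L u r)) * (expR (- (a * u)) / sd u)
   + beta (u + L) * (disc (u + L) r * n01 (bsd L u r - sd u * beta L)) * (expR (- (a * u)) / sd u)).
  by rewrite /GRing.scale /=; ring.
(* Both density terms have the same factor by [bs_identity], with coefficient beta(u + L) - beta(u)
   = e^{-a u} beta(L). *)
rewrite -H ou_betaD// expR_ou_beta//.
by field; rewrite !gt_eqF.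
Qed.

(** The coefficients of the two Phi terms match because [disc u] and [disc (u + L)] each solve the
    backward equation; the density terms match by the form of [gain_drr]. *)
Lemma gain_dt_pde (L u r : R) : gain_dt L u r 1 0 =
  a * (b - r) * gain_dr L u r + delta ^+ 2 / 2 * gain_drr L u r - r * bsgain L u r.
Proof.
rewrite /gain_dt /gain_dr /gain_drr /bs_gain /disc_dt; field.
by rewrite gt_eqF.
Qed.

End gain_derivatives.

(** * Integration over open intervals *)

Section open_interval.
Variables (R : realType) (c : R).
Hypothesis c_gt0 : 0 < c.
Notation mu := lebesgue_measure.

(** The denominator n + 3 keeps the lower end strictly below the upper one from n = 0 on. *)
Definition inner_lo (n : nat) : R := c / n.+3%:R.
Definition inner_hi (n : nat) : R := c - inner_lo n.
Let A n : set R := `[inner_lo n, inner_hi n].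

Lemma inner_lo_gt0 n : 0 < inner_lo n.
Proof. by rewrite divr_gt0. Qed.

Lemma inner_lo_lt n : inner_lo n < inner_hi n.
Proof.
rewrite /inner_hi ltrBrDr -mulr2n /inner_lo -[ltLHS]mulr_natr mulrAC ltr_pdivrMr//.
by rewrite ltr_pM2l// ltr_nat.
Qed.

Lemma inner_hi_lt n : inner_hi n < c.
Proof. by rewrite ltrBlDr ltrDl inner_lo_gt0. Qed.

Lemma cvg_inner_lo : inner_lo n @[n --> \oo] --> (0 : R).
Proof.
have h : (@harmonic R (n + 2)%N) @[n --> \oo] --> 0.
  by rewrite (cvg_shiftn 2 (@harmonic R)); exact: cvg_harmonic.
have -> : inner_lo = fun n => c * @harmonic R (n + 2)%N.
  by apply/funext => n; rewrite /inner_lo /harmonic addn2.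
by rewrite -[X in _ --> X](mulr0 c); apply: cvgM => //; exact: cvg_cst.
Qed.

Lemma cvg_inner_hi : inner_hi n @[n --> \oo] --> c.
Proof.
by rewrite -[X in _ --> X](subr0 c); apply: cvgB; [exact: cvg_cst|exact: cvg_inner_lo].
Qed.

Let A_sub n x : A n x -> 0 < x < c.
Proof.
rewrite /A /= in_itv/= => /andP[h1 h2].
by rewrite (lt_le_trans (inner_lo_gt0 n) h1) (le_lt_trans h2 (inner_hi_lt n)).
Qed.

Let A_near x : 0 < x < c -> \forall n \near \oo, A n x.
Proof.
move=> /andP[x0 xc].
have h1 : \forall n \near \oo, inner_lo n < x by exact: cvgr_lt cvg_inner_lo _ x0.
have h2 : \forall n \near \oo, x < inner_hi n by exact: cvgr_gt cvg_inner_hi _ xc.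
near=> n; rewrite /A /= in_itv/=; apply/andP; split; apply: ltW; near: n; assumption.
Unshelve. all: by end_near. Qed.

Let A_homo : {homo A : n m / (n <= m)%N >-> (n <= m)%O}.
Proof.
move=> n m nm; rewrite subsetEset => x; rewrite /A /= !in_itv/= => /andP[h1 h2].
have lo : inner_lo m <= inner_lo n by rewrite ler_pM2l// lef_pV2 ?posrE// ler_nat !ltnS.
rewrite (le_trans lo h1) (le_trans h2)// /inner_hi lerB//.
Qed.

Let A_bigcup : \bigcup_n A n = `]0, c[%classic.
Proof.
apply/seteqP; split => [x [n _ /A_sub h]|x]; first by rewrite /= in_itv.
rewrite /= in_itv/= => /A_near [n _ h]; exists n => //; exact: h (leqnn n).
Qed.

Variables (f F : R -> R).
Hypothesis cf : forall x, 0 < x < c -> {for x, continuous f}.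

Lemma open_itv_measurable : measurable_fun `]0, c[ f.
Proof.
apply: open_continuous_measurable_fun; first exact: interval_open.
by move=> x; rewrite inE/= in_itv/= => h; exact: cf.
Qed.

Lemma bounded_integrable (K : R) : (forall x, 0 < x < c -> `|f x| <= K) ->
  mu.-integrable `]0, c[ (EFin \o f).
Proof.
move=> fK.
have iK : mu.-integrable `]0, c[ (EFin \o cst K).
  have := @continuous_integrable R (cst K) 0 c (@cst_continuous _ _ K).
  apply: integrableS => //; exact: subset_itv_oo_cc.
apply: le_integrable iK => //; first by apply/measurable_EFinP; exact: open_itv_measurable.
move=> x; rewrite /= in_itv/= => /fK h; by rewrite lee_fin (le_trans h)// ler_norm.
Qed.

Hypothesis dF : forall x, 0 < x < c -> is_derive x 1 F (f x).

Lemma FTC2_inner n : (\int[mu]_(x in A n) (f x)%:E = (F (inner_hi n) - F (inner_lo n))%:E)%E.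
Proof.
have cF x : 0 < x < c -> {for x, continuous F}.
  by move=> h; exact: is_derive_continuous (dF h).
have hh x : inner_lo n <= x <= inner_hi n -> 0 < x < c.
  by move=> h; apply: (@A_sub n); rewrite /A /= in_itv.
have [ll lh] := (inner_lo_lt n, ltW (inner_lo_lt n)).
rewrite (@continuous_FTC2 _ f F) ?EFinB//.
- apply: continuous_in_subspaceT => x; rewrite inE/= in_itv/= => /hh; exact: cf.
- split.
  + move=> x; rewrite in_itv/= => /andP[h1 h2].
    have h : 0 < x < c by apply: hh; rewrite !ltW.
    exact: (@ex_derive _ _ _ _ _ _ _ (dF h)).
  + by apply: cvg_at_right_filter; apply: cF; apply: hh; rewrite lexx.
  + by apply: cvg_at_left_filter; apply: cF; apply: hh; rewrite lexx andbT.
move=> x; rewrite in_itv/= => /andP[h1 h2].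
have h : 0 < x < c by apply: hh; rewrite !ltW.
by rewrite derive1E; exact: (@derive_val _ _ _ _ _ _ _ (dF h)).
Qed.

(** A nonnegative derivative of a bounded function is integrable even if it blows up at the ends:
    its integrals over the inner intervals are increments of [F], at most 2 K. It serves for the
    derivative of the standard deviation near 0. *)
Lemma ge0_FTC2_integrable (K : R) : (forall x, 0 < x < c -> 0 <= f x) ->
  (forall x, 0 < x < c -> `|F x| <= K) -> mu.-integrable `]0, c[ (EFin \o f).
Proof.
move=> f0 FK; apply/integrableP; split.
  by apply/measurable_EFinP; exact: open_itv_measurable.
have -> : (\int[mu]_(x in `]0%R, c[) `|(EFin \o f) x| = \int[mu]_(x in `]0%R, c[) (f x)%:E)%E.
  apply: eq_integral => x; rewrite inE/= in_itv/= => h.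
  by rewrite ger0_norm// f0.
have h : (\int[mu]_(x in A n) (f x)%:E)%E @[n --> \oo] --> (\int[mu]_(x in `]0%R, c[) (f x)%:E)%E.
  rewrite -A_bigcup; apply: ge0_nondecreasing_set_cvg_integral => //.
  - by move=> n; exact: measurable_itv.
  - move=> n; apply/measurable_EFinP; apply: measurable_funS open_itv_measurable => //.
    by move=> x /A_sub; rewrite /= in_itv.
  - by move=> n x /A_sub h; rewrite lee_fin f0.
apply: (@le_lt_trans _ _ (K + K)%:E); last exact: ltry.
apply: (cvge_le _ h); apply: nearW => n; rewrite FTC2_inner lee_fin.
have [ll lh] := (inner_lo_lt n, ltW (inner_lo_lt n)).
have h1 : 0 < inner_lo n < c by apply: (@A_sub n); rewrite /A /= in_itv/= lexx.
have h2 : 0 < inner_hi n < c by apply: (@A_sub n); rewrite /A /= in_itv/= lexx andbT.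
rewrite lerD ?(le_trans (ler_norm _) (FK _ h2))//.
by rewrite (le_trans _ (FK _ h1))// -normrN ler_norm.
Qed.

(** Dominated convergence along the inner intervals. Limits of [F] along their endpoints suffice, so
    nothing is asked of [F] at 0 and [c]. *)
Lemma FTC2_open (l0 l1 : R) : mu.-integrable `]0, c[ (EFin \o f) ->
  F (inner_lo n) @[n --> \oo] --> l0 -> F (inner_hi n) @[n --> \oo] --> l1 ->
  \int[mu]_(x in `]0, c[) f x = l1 - l0.
Proof.
move=> fi h0 h1.
have mD : @measurable _ (measurableTypeR R) `]0, c[%classic by exact: measurable_itv.
have mA n : @measurable _ (measurableTypeR R) (A n) by exact: measurable_itv.
have mf : measurable_fun `]0, c[ (EFin \o f) by apply/measurable_EFinP; exact: open_itv_measurable.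
have ai : mu.-integrable `]0, c[ (abse \o (EFin \o f)) by exact: integrable_abse.
have [|||_ _ H] := @dominated_convergence _ _ R mu _ mD
  (fun n => (EFin \o f) \_ (A n)) (EFin \o f) (abse \o (EFin \o f)) _ mf _ ai.
- move=> n; apply/(measurable_restrict _ (mA n) mD).
  by apply: measurable_funS mf => // x [].
- apply: aeW => x; rewrite /= in_itv/= => /A_near h.
  apply: cvg_near_cst; apply: filterS h => n Ax; rewrite patchE mem_set//.
- apply: aeW => x n _; rewrite patchE; case: ifPn => // _; rewrite abse0; exact: abse_ge0.
have E n : (\int[mu]_(x in `]0%R, c[) ((EFin \o f) \_ (A n)) x = (F (inner_hi n) - F (inner_lo n))%:E)%E.
  rewrite -FTC2_inner -integral_mkcondr; congr (integral _ _ _).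
  by apply: setIidr => x /A_sub; rewrite /= in_itv.
have H2 : (F (inner_hi n) - F (inner_lo n))%:E @[n --> \oo] --> (\int[mu]_(x in `]0%R, c[) (f x)%:E)%E.
  by rewrite -(funext E).
have H3 : (F (inner_hi n) - F (inner_lo n))%:E @[n --> \oo] --> (l1 - l0)%:E.
  by apply: cvg_EFin; [exact: nearW|exact: cvgB].
by rewrite /Rintegral (cvg_unique _ H2 H3).
Qed.

End open_interval.

(** * Continuity of the gain and of its derivatives along a path *)

Section gain_continuity.
Variables (R : realType) (a b delta : R).
Hypotheses (a_gt0 : 0 < a) (delta_gt0 : 0 < delta).
Let a_neq0 : a != 0. Proof. by rewrite gt_eqF. Qed.
Local Notation beta := (ou_beta a).
Local Notation disc := (ou_disc a b delta).
Local Notation mean := (ou_mean a b delta).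
Local Notation n01 := (@normal_pdf R 0 1).
Local Notation sd := (ou_sd a delta).
Local Notation bsd := (bs_d a b delta).

Variables (u L : R -> R) (z r : R).
Hypotheses (cu : {for z, continuous u}) (cL : {for z, continuous L}).
Hypotheses (u0 : 0 < u z) (L0 : 0 < L z).

Let comp (f g : R -> R) : {for z, continuous g} -> {for g z, continuous f} ->
  {for z, continuous (fun z => f (g z))}.
Proof. by move=> cg cf; exact: continuous_comp. Qed.

Let mul (f g : R -> R) : {for z, continuous f} -> {for z, continuous g} ->
  {for z, continuous (fun z => f z * g z)}.
Proof. by move=> cf cg; exact: cvgM. Qed.

Let sub (f g : R -> R) : {for z, continuous f} -> {for z, continuous g} ->
  {for z, continuous (fun z => f z - g z)}.
Proof. by move=> cf cg; exact: cvgB. Qed.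

Let add (f g : R -> R) : {for z, continuous f} -> {for z, continuous g} ->
  {for z, continuous (fun z => f z + g z)}.
Proof. by move=> cf cg; exact: cvgD. Qed.

Let cst_ (k : R) : {for z, continuous (fun _ : R => k)}.
Proof. exact: cst_continuous. Qed.

Let inv (f : R -> R) : f z != 0 -> {for z, continuous f} ->
  {for z, continuous (fun z => (f z)^-1)}.
Proof. by move=> f0 cf; exact: cvgV. Qed.

Let sqr (f : R -> R) : {for z, continuous f} -> {for z, continuous (fun z => f z ^+ 2)}.
Proof. by move=> cf; exact: mul. Qed.

Let opp (f : R -> R) : {for z, continuous f} -> {for z, continuous (fun z => - f z)}.
Proof. by move=> cf; exact: cvgN. Qed.

Let cbeta (f : R -> R) : {for z, continuous f} -> {for z, continuous (fun z => beta (f z))}.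
Proof. by move=> cf; apply: comp => //; exact: continuous_ou_beta. Qed.

Let cexp (f : R -> R) : {for z, continuous f} ->
  {for z, continuous (fun z => expR (- (a * f z)))}.
Proof. by move=> cf; apply: (comp (f := fun x => expR (- (a * x)))) => //; exact: continuous_expRNM. Qed.

Lemma continuous_disc_t x : {for x, continuous (disc ^~ r)}.
Proof. exact: is_derive_continuous (is_derive_disc b delta a_gt0 r (is_derive_id x (1 : R))). Qed.

Let cdisc (f : R -> R) : {for z, continuous f} -> {for z, continuous (fun z => disc (f z) r)}.
Proof. by move=> cf; apply: (comp (f := disc ^~ r)) => //; exact: continuous_disc_t. Qed.

Let cdisc_dt (f : R -> R) : {for z, continuous f} ->
  {for z, continuous (fun z => disc_dt a b delta (f z) r)}.
Proof.
move=> cf; have cb := cbeta cf.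
exact (mul (cdisc cf) (sub (sub (mul (mul (@cst_ (delta ^+ 2)) (sqr cb)) (@cst_ 2^-1))
  (mul (@cst_ (a * (b - r))) cb)) (@cst_ r))).
Qed.

Let csd : {for z, continuous (fun z => sd (u z))}.
Proof. by apply: comp => //; exact: is_derive_continuous (is_derive_ou_sd a_gt0 delta_gt0 u0). Qed.

Let sd_neq0 : sd (u z) != 0.
Proof. by rewrite gt_eqF// ou_sd_gt0. Qed.

Lemma continuous_ou_sd_dt : {for z, continuous (fun z => ou_sd_dt a delta (u z))}.
Proof.
apply: mul; first exact: (mul (@cst_ _) (sqr (cexp cu))).
by apply: inv; [rewrite mulf_neq0 ?pnatr_eq0|exact: (mul (@cst_ _) csd)].
Qed.

Let cbsd : {for z, continuous (fun z => bsd (L z) (u z) r)}.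
Proof.
have cb := cbeta cu; have cbL := cbeta cL; have ce := cexp cu.
have b0 : beta (L z) != 0 by rewrite gt_eqF// ou_beta_gt0.
have cI : {for z, continuous (fun z => ou_int_beta2 a (L z))}.
  by apply: comp => //; exact: is_derive_continuous (is_derive_ou_int_beta2 _ a_neq0).
have ci := inv sd_neq0 csd; have ciL := inv b0 cbL.
exact: (mul (sub (sub (add (mul (@cst_ _) ce) (mul (@cst_ _) cb)) (mul (mul (@cst_ _) (sqr cb)) (@cst_ _)))
  (mul (add (mul (@cst_ _) (sub cL cbL)) (mul (mul (@cst_ _) cI) (@cst_ _))) ciL)) ci).
Qed.

Let cPhi1 : {for z, continuous (fun z => Phi (bsd (L z) (u z) r))}.
Proof. by apply: comp => //; exact: continuous_Phi. Qed.

Let cPhi2 : {for z, continuous (fun z => Phi (bsd (L z) (u z) r - sd (u z) * beta (L z)))}.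
Proof.
apply: comp; last exact: continuous_Phi.
by apply: sub => //; apply: mul => //; exact: cbeta.
Qed.

Let cn : {for z, continuous (fun z => n01 (bsd (L z) (u z) r))}.
Proof. by apply: comp => //; exact: continuous_n01. Qed.

Let cuL : {for z, continuous (fun z => u z + L z)}.
Proof. exact: add. Qed.

Lemma continuous_bs_gain : {for z, continuous (fun z => bs_gain a b delta (L z) (u z) r)}.
Proof.
by have c1 := cdisc cu; have c2 := cdisc cuL; exact: (sub (mul c1 cPhi1) (mul c2 cPhi2)).
Qed.

Lemma continuous_gain_dr : {for z, continuous (fun z => gain_dr a b delta (L z) (u z) r)}.
Proof.
have cb := opp (cbeta cu); have cbuL := opp (cbeta cuL); have c1 := cdisc cu; have c2 := cdisc cuL.
exact: (sub (mul (mul cb c1) cPhi1) (mul (mul cbuL c2) cPhi2)).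
Qed.

Lemma continuous_gain_drr : {for z, continuous (fun z => gain_drr a b delta (L z) (u z) r)}.
Proof.
have cb := sqr (cbeta cu); have cbuL := sqr (cbeta cuL); have cbL := cbeta cL.
have c1 := cdisc cu; have c2 := cdisc cuL.
exact: (add (sub (mul (mul cb c1) cPhi1) (mul (mul cbuL c2) cPhi2))
  (mul (@cst_ _) (mul (mul c1 cn) (mul continuous_ou_sd_dt cbL)))).
Qed.

Lemma continuous_gain_dt du dL :
  {for z, continuous (fun z => gain_dt a b delta (L z) (u z) r du dL)}.
Proof.
have cbL := cbeta cL; have c0 := cdisc cu; have ce := cexp cL.
have c1 := cdisc_dt cu; have c2 := cdisc_dt cuL.
exact: (add (sub (mul (mul c1 (@cst_ _)) cPhi1) (mul (mul c2 (@cst_ _)) cPhi2))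
  (mul (mul c0 cn) (add (mul (mul continuous_ou_sd_dt (@cst_ _)) cbL) (mul csd (mul ce (@cst_ _)))))).
Qed.

End gain_continuity.

(** * Uniform bounds on the gain and its derivatives *)

Section gain_bounds.
Variables (R : realType) (a b delta : R).
Hypotheses (a_gt0 : 0 < a) (delta_gt0 : 0 < delta).
Notation mu := lebesgue_measure.
Let a_neq0 : a != 0. Proof. by rewrite gt_eqF. Qed.
Local Notation beta := (ou_beta a).
Local Notation disc := (ou_disc a b delta).
Local Notation n01 := (@normal_pdf R 0 1).
Local Notation sd := (ou_sd a delta).
Local Notation sd' := (ou_sd_dt a delta).
Local Notation bsd := (bs_d a b delta).

Lemma ou_sd_dt_ge0 u : 0 <= sd' u.
Proof.
by apply: divr_ge0; apply: mulr_ge0; rewrite ?sqr_ge0// sqrtr_ge0.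
Qed.

(** A square root of p is at most 1 + p; the variance is at most its limit delta^2 / (2 a). *)
Lemma ou_sd_le u : sd u <= 1 + delta ^+ 2 / (2 * a).
Proof.
have [s0|s0] := leP (phi_var a delta u) 0.
  rewrite /ou_sd ler0_sqrtr// addr_ge0// divr_ge0 ?sqr_ge0//.
  by rewrite mulr_ge0// ltW.
have p : phi_var a delta u <= delta ^+ 2 / (2 * a).
  rewrite /phi_var ler_piMr ?gerBl ?expR_ge0// divr_ge0 ?sqr_ge0//.
  by rewrite mulr_ge0// ltW.
have h : sd u ^+ 2 = phi_var a delta u by rewrite sqr_sqrtr// ltW.
have h0 : 0 <= sd u by exact: sqrtr_ge0.
by nra.
Qed.

(** Reduces to a u e^{-2 a u} being at most 1 - e^{-2 a u}. A factor [u] tames the singularity at 0;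
    such a factor appears when the maturity varies. *)
Lemma ou_sd_dt_le u : 0 < u -> u * sd' u <= sd u.
Proof.
move=> u0; have s0 := ou_sd_gt0 a_gt0 delta_gt0 u0.
rewrite /ou_sd_dt mulrA ler_pdivrMr ?mulr_gt0//.
have -> : sd u * (2 * sd u) = 2 * sd u ^+ 2 by ring.
rewrite sqr_sqrtr; last by rewrite ltW// phi_var_gt0.
rewrite /phi_var.
have -> : expR (- (a * u)) ^+ 2 = expR (- (2 * a * u)).
  by rewrite expr2 -expRD; congr expR; ring.
set e := expR _.
have e0 : 0 < e by exact: expR_gt0.
have h : 2 * a * u * e <= 1 - e.
  have : 1 + 2 * a * u <= expR (2 * a * u) by exact: expR_ge1Dx.
  rewrite -(ler_pM2r e0) /e -expRD subrr expR0 mulrDl mul1r => h.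
  by rewrite lerBrDl.
have -> : 2 * (delta ^+ 2 / (2 * a) * (1 - e)) = (delta ^+ 2 / a) * (1 - e) by field.
have -> : u * (delta ^+ 2 * e) = delta ^+ 2 / a * (a * u * e) by field.
rewrite ler_pM2l ?divr_gt0 ?exprn_gt0//.
have p0 : 0 <= a * u * e by rewrite !mulr_ge0// ltW.
by lra.
Qed.

Variables (c rad : R).

(** A bound on M for times in [[0, c]] and rates of modulus at most [rad], from beta(x) at most x
    and the integral of beta^2 at most x / a^2. *)
Definition disc_bound : R := expR ((rad + `|b| + delta ^+ 2 / (2 * a ^+ 2)) * c).

Lemma disc_bound_ge0 : 0 <= disc_bound. Proof. exact: expR_ge0. Qed.

Lemma disc_le x r : 0 <= x <= c -> `|r| <= rad -> disc x r <= disc_bound.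
Proof.
move=> /andP[x0 xc] rr; rewrite ler_expR.
have b0 := ou_beta_ge0 a_gt0 x0; have bx := ou_beta_le x a_gt0.
have h1 : - (r * beta x) <= rad * x.
  apply: (le_trans (ler_norm _)); rewrite normrN normrM (ger0_norm b0).
  exact: ler_pM.
have h2 : - b * (x - beta x) <= `|b| * x.
  apply: (le_trans (ler_norm _)); rewrite normrM normrN ler_wpM2l//.
  by rewrite ger0_norm ?subr_ge0// gerBl.
have h3 : ou_int_beta2 a x <= x / a ^+ 2.
  rewrite ler_pM2r ?invr_gt0 ?exprn_gt0//.
  have : 0 <= a * beta x ^+ 2 / 2 by rewrite divr_ge0// mulr_ge0 ?sqr_ge0// ltW.
  by lra.
have h4 : delta ^+ 2 * ou_int_beta2 a x / 2 <= delta ^+ 2 / (2 * a ^+ 2) * x.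
  have -> : delta ^+ 2 / (2 * a ^+ 2) * x = delta ^+ 2 * (x / a ^+ 2) / 2 by field.
  by rewrite ler_pM2r// ler_wpM2l// sqr_ge0.
apply: (@le_trans _ _ ((rad + `|b| + delta ^+ 2 / (2 * a ^+ 2)) * x)); last first.
  have rad0 : 0 <= rad by rewrite (le_trans _ rr).
  rewrite ler_wpM2l// !addr_ge0// divr_ge0 ?sqr_ge0// mulr_ge0 ?sqr_ge0//.
by move: h1 h2 h4; rewrite !mulrDl mulNr; lra.
Qed.

Let disc_norm x r : 0 <= x <= c -> `|r| <= rad -> `|disc x r| <= disc_bound.
Proof. by move=> hx hr; rewrite ger0_norm ?expR_ge0// disc_le. Qed.

Let norm_mul (x y X Y : R) : `|x| <= X -> `|y| <= Y -> `|x * y| <= X * Y.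
Proof. by move=> hx hy; rewrite normrM ler_pM. Qed.

Let norm_add (x y X Y : R) : `|x| <= X -> `|y| <= Y -> `|x + y| <= X + Y.
Proof. by move=> hx hy; rewrite (le_trans (ler_normD _ _))// lerD. Qed.

Let norm_sub (x y X Y : R) : `|x| <= X -> `|y| <= Y -> `|x - y| <= X + Y.
Proof. by move=> hx hy; rewrite (le_trans (ler_normB _ _))// lerD. Qed.

Let Phi_norm (x : R) : `|Phi x| <= 1.
Proof. by rewrite ger0_norm ?Phi_ge0// Phi_le1. Qed.

Let n01_norm (x : R) : `|n01 x| <= normal_peak 1.
Proof. by rewrite ger0_norm ?n01_ge0// n01_le. Qed.

Let beta_norm x : 0 <= x -> `|beta x| <= a^-1.
Proof. by move=> x0; rewrite ger0_norm ?ou_beta_ge0// ou_beta_leV. Qed.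

Let sd'_norm u : `|sd' u| <= sd' u.
Proof. by rewrite ger0_norm// ou_sd_dt_ge0. Qed.

Section admissible_range.
Variables (u L r : R).
Hypotheses (u0 : 0 < u) (L0 : 0 < L) (uL : u + L <= c) (rr : `|r| <= rad).
Let uc : 0 <= u <= c. Proof. by rewrite ltW//= (le_trans _ uL)// lerDl ltW. Qed.
Let uLc : 0 <= u + L <= c. Proof. by rewrite uL addr_ge0// ltW. Qed.

(** This bound and the next ones copy the shape of the bounded expression, with 1 for each Phi;
    [gain_bounds] merges them into one constant. *)
Lemma bs_gain_bound : `|bs_gain a b delta L u r| <= disc_bound * 1 + disc_bound * 1.
Proof. by apply: norm_sub; apply: norm_mul => //; exact: disc_norm. Qed.

Lemma gain_dr_bound : `|gain_dr a b delta L u r| <=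
  a^-1 * disc_bound * 1 + a^-1 * disc_bound * 1.
Proof.
have [/andP[u00 _] /andP[uL0 _]] := (uc, uLc).
apply: norm_sub; apply: norm_mul => //; apply: norm_mul; rewrite ?normrN;
  by [exact: beta_norm|exact: disc_norm].
Qed.

Lemma gain_drr_bound : `|gain_drr a b delta L u r| <=
  a^-1 * a^-1 * disc_bound * 1 + a^-1 * a^-1 * disc_bound * 1
  + 2 / delta ^+ 2 * (disc_bound * normal_peak 1 * (sd' u * a^-1)).
Proof.
have [/andP[u00 _] /andP[uL0 _]] := (uc, uLc).
apply: norm_add; last first.
  apply: norm_mul; first by rewrite ger0_norm// divr_ge0 ?sqr_ge0.
  by apply: norm_mul; apply: norm_mul => //; [exact: disc_norm|exact/beta_norm/ltW].
apply: norm_sub; apply: norm_mul => //; apply: norm_mul; rewrite ?expr2;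
  by [exact: disc_norm|apply: norm_mul; exact: beta_norm].
Qed.

Definition disc_dt_bound : R :=
  disc_bound * (delta ^+ 2 * (a^-1 * a^-1) / 2 + a * (`|b| + rad) * a^-1 + rad).

Let disc_dt_norm x : 0 <= x <= c -> `|disc_dt a b delta x r| <= disc_dt_bound.
Proof.
move=> xc; have /andP[x0 _] := xc.
apply: norm_mul; first exact: disc_norm.
apply: norm_sub => //; apply: norm_sub.
  apply: norm_mul; last by rewrite ger0_norm// invr_ge0.
  by apply: norm_mul; [rewrite ger0_norm// sqr_ge0|apply: norm_mul; exact: beta_norm].
apply: norm_mul; last exact: beta_norm.
by apply: norm_mul; [rewrite ger0_norm// ltW|exact: norm_sub].
Qed.

Lemma gain_dt_bound du dL : `|gain_dt a b delta L u r du dL| <=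
  disc_dt_bound * `|du| * 1 + disc_dt_bound * (`|du| + `|dL|) * 1
  + disc_bound * normal_peak 1
    * (sd' u * `|du| * a^-1 + (1 + delta ^+ 2 / (2 * a)) * (1 * `|dL|)).
Proof.
have [/andP[u00 _] /andP[uL0 _]] := (uc, uLc).
apply: norm_add.
  apply: norm_sub; apply: norm_mul => //; apply: norm_mul => //; try exact: disc_dt_norm.
  exact: norm_add.
apply: norm_mul; first by apply: norm_mul => //; exact: disc_norm.
apply: norm_add.
  by apply: norm_mul; [exact: norm_mul|exact/beta_norm/ltW].
apply: norm_mul; first by rewrite ger0_norm ?sqrtr_ge0// ou_sd_le.
apply: norm_mul => //; rewrite ger0_norm ?expR_ge0// -expR0 ler_expR oppr_le0.
by rewrite mulr_ge0// ltW.
Qed.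

End admissible_range.

End gain_bounds.

Lemma is_derive_under_integral d (Y : measurableType d) (R : realType)
    (mu : {measure set Y -> \bar R}) (B : set Y) (f df : R -> Y -> R) (G : Y -> R)
    (x0 lo hi : R) : measurable B -> lo < x0 < hi ->
  (forall x, lo < x < hi -> mu.-integrable B (EFin \o f x)) ->
  (forall x y, lo < x < hi -> B y -> is_derive x 1 (f ^~ y) (df x y)) ->
  (forall y, 0 <= G y) -> mu.-integrable B (EFin \o G) ->
  (forall x y, lo < x < hi -> B y -> `|df x y| <= G y) ->
  is_derive x0 1 (fun x => \int[mu]_(y in B) f x y : R) (\int[mu]_(y in B) df x0 y).
Proof.
move=> mB x0I fi fd G0 Gi dG.
have I x : `]lo, hi[%classic x -> lo < x < hi by rewrite /= in_itv.
have I0 : `]lo, hi[%classic x0 by rewrite /= in_itv.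
have dE x y : `]lo, hi[%classic x -> B y -> partial1of2 f x y = df x y.
  move=> /I xI By; rewrite /partial1of2 derive1E.
  exact: (@derive_val _ _ _ _ _ _ _ (fd x y xI By)).
have H1 x : `]lo, hi[%classic x -> mu.-integrable B (EFin \o f x) by move=> /I; exact: fi.
have H2 x y : `]lo, hi[%classic x -> B y -> derivable (f ^~ y) x 1.
  by move=> /I xI By; exact: (@ex_derive _ _ _ _ _ _ _ (fd x y xI By)).
have H3 x y : `]lo, hi[%classic x -> B y -> `|partial1of2 f x y| <= G y.
  by move=> xI By; rewrite dE//; exact: dG (I _ xI) By.
apply: DeriveDef; first exact: (@derivable_under_integral R _ _ _ _ _ mB _ _ _ I0 H1 H2 _ G0 Gi H3).
rewrite -derive1E (@differentiation_under_integral R _ _ _ _ _ mB _ _ _ I0 H1 H2 _ G0 Gi H3).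
by apply: eq_Rintegral => y; rewrite inE => By; rewrite dE.
Qed.

Section gain_limit.
Variables (R : realType) (a b delta : R).
Hypotheses (a_gt0 : 0 < a) (delta_gt0 : 0 < delta).
Notation mu := lebesgue_measure.
Let a_neq0 : a != 0. Proof. by rewrite gt_eqF. Qed.
Local Notation beta := (ou_beta a).
Local Notation disc := (ou_disc a b delta).
Local Notation mean := (ou_mean a b delta).
Local Notation excess := (excess a b delta).

Lemma excess_lipschitz (p q : R) : `|Num.max 0 (1 - p) - Num.max 0 (1 - q)| <= `|p - q|.
Proof.
have [h1|h1] := leP 0 (1 - p); have [h2|h2] := leP 0 (1 - q).
- by rewrite opprB addrC subrKA distrC.
- rewrite subr0 (ger0_norm h1) ler0_norm; last by lra.
  by lra.
- rewrite sub0r normrN (ger0_norm h2) ger0_norm; last by lra.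
  by lra.
by rewrite subrr normr0.
Qed.

Lemma cvg_excess (L_ z_ : nat -> R) (L z : R) :
  L_ n @[n --> \oo] --> L -> z_ n @[n --> \oo] --> z ->
  excess (L_ n) (z_ n) @[n --> \oo] --> excess L z.
Proof.
move=> hL hz.
have hd : disc (L_ n) (z_ n) @[n --> \oo] --> disc L z.
  rewrite ou_discE; under eq_cvg do rewrite ou_discE.
  have hb : beta (L_ n) @[n --> \oo] --> beta L.
    exact: (cvg_comp _ _ hL (@continuous_ou_beta _ _ a_neq0 L)).
  have hi : ou_int_beta2 a (L_ n) @[n --> \oo] --> ou_int_beta2 a L.
    exact: (cvg_comp _ _ hL (is_derive_continuous (is_derive_ou_int_beta2 L a_neq0))).
  have h : ou_logdisc0 a b delta (L_ n) - z_ n * beta (L_ n) @[n --> \oo] -->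
      ou_logdisc0 a b delta L - z * beta L.
    apply: cvgB; last exact: cvgM.
    apply: cvgD; first by apply: cvgM; [exact: cvg_cst|exact: cvgB].
    by apply: cvgM; [apply: cvgM => //; exact: cvg_cst|exact: cvg_cst].
  exact: (cvg_comp _ _ h (@continuous_expR _ _)).
apply/cvgrPdist_lt => e e0; move/cvgrPdist_lt : hd => /(_ e e0).
by apply: filterS => n; apply: le_lt_trans; exact: excess_lipschitz.
Qed.

(** The law of r_u shrinks to the point [r] as u tends to 0, and as the excess is at most 1
    dominated convergence applies under the fixed normal law. The closed form is avoided here, its
    argument [bs_d] having a denominator that tends to 0. *)
Lemma cvg_gain_at0 (c r : R) (u_ : nat -> R) : u_ n @[n --> \oo] --> 0 ->
  gain a b delta (c - u_ n) (u_ n) r @[n --> \oo] --> excess c r.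
Proof.
move=> hu.
have hb : beta (u_ n) @[n --> \oo] --> 0.
  by rewrite -(ou_beta0 a); exact: (cvg_comp _ _ hu (@continuous_ou_beta _ _ a_neq0 0)).
have hL : c - u_ n @[n --> \oo] --> c.
  by rewrite -[X in _ --> X](subr0 c); apply: cvgB => //; exact: cvg_cst.
have hd : disc (u_ n) r @[n --> \oo] --> (1 : R).
  rewrite -(ou_disc0 a b delta r).
  exact: (cvg_comp _ _ hu (@continuous_disc_t _ _ b delta a_gt0 r 0)).
have hm : mean (u_ n) r @[n --> \oo] --> r.
  have -> : (fun n => mean (u_ n) r) = fun n =>
     r * (1 - a * beta (u_ n)) + a * b * beta (u_ n) - delta ^+ 2 / 2 * (beta (u_ n) * beta (u_ n)).
    by apply/funext => n; rewrite /ou_mean expR_ou_beta//; ring.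
  rewrite [X in _ --> X](_ : r = r * (1 - a * 0) + a * b * 0 - delta ^+ 2 / 2 * (0 * 0)); last by ring.
  apply: cvgB; last by apply: cvgM; [exact: cvg_cst|exact: cvgM].
  apply: cvgD; apply: cvgM; try exact: cvg_cst; last by [].
  by apply: cvgB; [exact: cvg_cst|apply: cvgM => //; exact: cvg_cst].
have hv : Num.sqrt (phi_var a delta (u_ n)) @[n --> \oo] --> 0.
  rewrite -[X in _ --> X](sqrtr0 R).
  have h : phi_var a delta (u_ n) @[n --> \oo] --> 0.
    have -> : (fun n => phi_var a delta (u_ n)) = fun n =>
       delta ^+ 2 * (beta (u_ n) - a / 2 * (beta (u_ n) * beta (u_ n))).
      by apply/funext => n; rewrite phi_varE//; field.
    rewrite [X in _ --> X](_ : 0 = delta ^+ 2 * (0 - a / 2 * (0 * 0)) :> R); last by ring.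
    apply: cvgM; first exact: cvg_cst.
    by apply: cvgB => //; apply: cvgM; [exact: cvg_cst|exact: cvgM].
  exact: (cvg_comp _ _ h (@sqrt_continuous R 0)).
rewrite -[X in _ --> X]mul1r; apply: cvgM => //.
have ma (L m s : R) : measurable_fun setT (fun z : R => (excess L (m + s * z))%:E).
  apply/measurable_EFinP; apply: measurableT_comp.
    by apply: continuous_measurable_fun; exact: continuous_excess.
  by apply: measurable_funD => //; exact: measurable_funM.
have [|||||_ _ H] := @dominated_convergence _ _ _ (normal_prob 0 1) _ measurableT
  (fun n z => (excess (c - u_ n) (mean (u_ n) r + Num.sqrt (phi_var a delta (u_ n)) * z))%:E)
  (fun z => (excess c r)%:E) (fun=> 1%E).
- by move=> n; exact: ma.
- exact: measurable_cst.
- apply: aeW => z _; apply: cvg_EFin; first exact: nearW.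
  apply: cvg_excess => //; rewrite -[X in _ --> X]addr0 -(mul0r z).
  by apply: cvgD => //; apply: cvgM => //; exact: cvg_cst.
- exact: (finite_measure_integrable_cst (normal_prob 0 1)).
- apply: aeW => z n _; rewrite gee0_abs ?lee_fin ?excess_ge0//; exact: excess_le1.
apply: fine_cvg; have h := gaussE_cst (excess c r)%:E 0 0.
by rewrite /gaussE in h; rewrite h in H.
Qed.

End gain_limit.

(** * Derivatives of the candidate *)

Section total_gain.
Variables (R : realType) (a b delta : R).
Hypotheses (a_gt0 : 0 < a) (delta_gt0 : 0 < delta).
Notation mu := lebesgue_measure.
Local Notation sd := (ou_sd a delta).
Local Notation sd' := (ou_sd_dt a delta).
Local Notation k := (bs_gain a b delta).
Local Notation k_r := (gain_dr a b delta).
Local Notation k_rr := (gain_drr a b delta).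
Local Notation k_t := (gain_dt a b delta).

(** [K] adds up the constants of all the bounds, so each inequality is a sum of nonnegative terms.
    The unbounded factor [sd' u] stays explicit; it enters the first-order derivative only when [u]
    itself moves. *)
Lemma gain_bounds (c rad : R) : exists K, forall u L r, 0 < u -> 0 < L -> u + L <= c ->
  `|r| <= rad ->
  [/\ `|k L u r| <= K, `|k_r L u r| <= K, `|k_rr L u r| <= K * (1 + sd' u) &
    forall du dL, `|k_t L u r du dL| <= K * (`|du| * (1 + sd' u) + `|dL|)].
Proof.
have [rad0|rad0] := leP 0 rad; last first.
  exists 0 => u L r _ _ _ h.
  by have := le_lt_trans (le_trans (normr_ge0 r) h) rad0; rewrite ltxx.
pose D := disc_bound a b delta c rad; pose E := disc_dt_bound a b delta c rad.
have D0 : 0 <= D by exact: disc_bound_ge0.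
have ai : 0 <= a^-1 by rewrite invr_ge0 ltW.
have E0 : 0 <= E.
  apply: mulr_ge0 => //; apply: addr_ge0 => //; apply: addr_ge0.
    by apply: divr_ge0 => //; apply: mulr_ge0; [exact: sqr_ge0|exact: mulr_ge0].
  by apply: mulr_ge0 => //; apply: mulr_ge0; [exact: ltW|exact: addr_ge0].
have p0 : 0 <= normal_peak (1 : R) by exact: normal_peak_ge0.
pose S := 1 + delta ^+ 2 / (2 * a); pose Q := D * normal_peak 1.
have S0 : 0 <= S by rewrite addr_ge0// divr_ge0 ?sqr_ge0// mulr_ge0// ltW.
have Q0 : 0 <= Q by exact: mulr_ge0.
have x1 : 0 <= a^-1 * D by exact: mulr_ge0.
have x2 : 0 <= a^-1 * a^-1 * D by rewrite !mulr_ge0.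
have x3 : 0 <= 2 / delta ^+ 2 * (Q * a^-1).
  by apply: mulr_ge0; [apply: divr_ge0; rewrite ?sqr_ge0|exact: mulr_ge0].
have x4 : 0 <= Q * a^-1 by exact: mulr_ge0.
have x5 : 0 <= Q * S by exact: mulr_ge0.
pose K := 2 * D + 2 * (a^-1 * D) + 2 * (a^-1 * a^-1 * D) + 2 / delta ^+ 2 * (Q * a^-1)
  + 2 * E + Q * a^-1 + Q * S.
exists K => u L r u0 L0 uL rr.
have s0 := ou_sd_dt_ge0 a delta u.
have B1 := bs_gain_bound b delta a_gt0 u0 L0 uL rr.
have B2 := gain_dr_bound b delta a_gt0 u0 L0 uL rr.
have B3 := gain_drr_bound b delta a_gt0 u0 L0 uL rr.
split.
- by apply: le_trans B1 _; rewrite -/D /K; lra.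
- by apply: le_trans B2 _; rewrite -/D /K; lra.
- apply: le_trans B3 _; rewrite -/D -/Q.
  have y : 0 <= (K - 2 / delta ^+ 2 * (Q * a^-1)) * sd' u.
    by rewrite mulr_ge0// subr_ge0 /K; lra.
  have z : 2 / delta ^+ 2 * (Q * (sd' u * a^-1)) = 2 / delta ^+ 2 * (Q * a^-1) * sd' u by ring.
  rewrite z mulrDr mulr1; move: y; rewrite mulrBl => y.
  have w : a^-1 * a^-1 * D * 1 + a^-1 * a^-1 * D * 1 <= K by rewrite /K; lra.
  by lra.
move=> du dL; apply: le_trans (gain_dt_bound b delta a_gt0 u0 L0 uL rr du dL) _.
rewrite -/D -/Q -/E -/S.
have [d0 l0] := (normr_ge0 du, normr_ge0 dL).
move: d0 l0; set d := `|du|; set l := `|dL| => d0 l0.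
have y1 : 0 <= (K - 2 * E) * d by rewrite mulr_ge0// subr_ge0 /K; lra.
have y2 : 0 <= (K - Q * a^-1) * (d * sd' u).
  by apply: mulr_ge0; [rewrite subr_ge0 /K; lra|exact: mulr_ge0].
have y3 : 0 <= (K - E - Q * S) * l by apply: mulr_ge0 => //; rewrite /K; lra.
rewrite -subr_ge0.
have -> : K * (d * (1 + sd' u) + l) - (E * d * 1 + E * (d + l) * 1 +
    Q * (sd' u * d / a + S * (1 * l))) =
  (K - 2 * E) * d + (K - Q * a^-1) * (d * sd' u) + (K - E - Q * S) * l by ring.
by rewrite !addr_ge0.
Qed.

Section fixed_maturity.
Variables (tau : R).
Hypothesis tau_gt0 : 0 < tau.

Let path y : 0 < y < 1 ->
  [/\ 0 < tau * y, 0 < tau * (1 - y) & tau * y + tau * (1 - y) = tau].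
Proof.
move=> /andP[y0 y1]; split; first exact: mulr_gt0.
- by rewrite mulr_gt0// subr_gt0.
- by ring.
Qed.

Let is_derive_u (y : R) : is_derive y 1 (fun y : R => tau * y) tau.
Proof.
have := is_deriveZ tau (is_derive_id y (1 : R)).
by move/is_derive_eq; apply; rewrite /GRing.scale/= mulr1.
Qed.

Let is_derive_L (y : R) : is_derive y 1 (fun y : R => tau * (1 - y)) (- tau).
Proof.
have := is_deriveZ tau (is_deriveB (is_derive_cst (1 : R) y 1) (is_derive_id y (1 : R))).
by move/is_derive_eq; apply; rewrite /GRing.scale/= sub0r mulrN1.
Qed.

Let cu (y : R) := is_derive_continuous (is_derive_u y).
Let cL (y : R) := is_derive_continuous (is_derive_L y).

(** The integrand is the nonnegative derivative of the bounded function sd(tau y) / tau. *)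
Lemma integrable_ou_sd_dt_scale :
  mu.-integrable `]0, 1[ (EFin \o (fun y : R => sd' (tau * y))).
Proof.
apply: (@ge0_FTC2_integrable R 1 ltr01 (fun y : R => sd' (tau * y)) (fun y => tau^-1 * sd (tau * y))
   _ _ (tau^-1 * (1 + delta ^+ 2 / (2 * a)))).
- move=> x /path[x0 _ _].
  exact: (continuous_ou_sd_dt a_gt0 delta_gt0 (u := fun y => tau * y) (cu (y := x)) x0).
- move=> x /path[x0 _ _].
  have h := @is_derive1_comp R sd (fun y => tau * y) x _ _ (is_derive_ou_sd a_gt0 delta_gt0 x0) (is_derive_u x).
  have := is_deriveZ tau^-1 h.
  by move/is_derive_eq; apply; rewrite /GRing.scale/= mulrCA mulVf ?mulr1// gt_eqF.
- by move=> x _; exact: ou_sd_dt_ge0.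
move=> x /path[x0 _ _]; rewrite normrM !ger0_norm ?sqrtr_ge0// ?invr_ge0; last exact: ltW.
by rewrite ler_pM2l ?invr_gt0// ou_sd_le.
Qed.

Lemma integrable_dominated (f : R -> R) (K : R) :
  (forall y, 0 < y < 1 -> {for y, continuous f}) ->
  (forall y, 0 < y < 1 -> `|f y| <= K * (1 + sd' (tau * y))) ->
  mu.-integrable `]0, 1[ (EFin \o f).
Proof.
move=> cf fK.
have mI : @measurable _ (measurableTypeR R) `]0, 1[%classic by exact: measurable_itv.
have i1 : mu.-integrable `]0, 1[ (EFin \o (fun _ : R => 1 : R)).
  apply: (@bounded_integrable R 1 (fun _ => 1) _ 1).
    by move=> x _; exact: cst_continuous.
  by move=> x _; rewrite normr1.
have i2 : mu.-integrable `]0, 1[ (EFin \o (fun y => K * (1 + sd' (tau * y)))).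
  have h := integrableD mI i1 integrable_ou_sd_dt_scale.
  exact: (integrableZl mI K h).
apply: le_integrable i2 => //.
  by apply/measurable_EFinP; exact: (open_itv_measurable cf).
move=> y; rewrite /= in_itv/= => yI; rewrite lee_fin (le_trans (fK _ yI))//.
exact: ler_norm.
Qed.

Variable r : R.

Let bounds : exists K, forall y, 0 < y < 1 ->
  [/\ `|k (tau * (1 - y)) (tau * y) r| <= K, `|k_r (tau * (1 - y)) (tau * y) r| <= K,
    `|k_rr (tau * (1 - y)) (tau * y) r| <= K * (1 + sd' (tau * y)) &
    forall du dL, `|k_t (tau * (1 - y)) (tau * y) r du dL|
      <= K * (`|du| * (1 + sd' (tau * y)) + `|dL|)].
Proof.
have [K HK] := gain_bounds tau `|r|; exists K => y /path[h1 h2 h3].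
by apply: HK; rewrite ?h3.
Qed.

Let K_dominates y (K x : R) : `|x| <= K -> `|x| <= K * (1 + sd' (tau * y)).
Proof.
move=> h; apply: (le_trans h); rewrite ler_peMr ?(le_trans (normr_ge0 _) h)// lerDl.
exact: ou_sd_dt_ge0.
Qed.

Lemma integrable_k :
  mu.-integrable `]0, 1[ (EFin \o (fun y : R => k (tau * (1 - y)) (tau * y) r)).
Proof.
have [K HK] := bounds; apply: (@integrable_dominated _ K) => y yI; have [h1 h2 _] := path yI.
  exact: (continuous_bs_gain a_gt0 delta_gt0 (cu (y := y)) (cL (y := y)) h1 h2).
by have [h _ _ _] := HK y yI; exact: K_dominates.
Qed.

Lemma integrable_k_r :
  mu.-integrable `]0, 1[ (EFin \o (fun y : R => k_r (tau * (1 - y)) (tau * y) r)).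
Proof.
have [K HK] := bounds; apply: (@integrable_dominated _ K) => y yI; have [h1 h2 _] := path yI.
  exact: (continuous_gain_dr a_gt0 delta_gt0 (cu (y := y)) (cL (y := y)) h1 h2).
by have [_ h _ _] := HK y yI; exact: K_dominates.
Qed.

Lemma integrable_k_rr :
  mu.-integrable `]0, 1[ (EFin \o (fun y : R => k_rr (tau * (1 - y)) (tau * y) r)).
Proof.
have [K HK] := bounds; apply: (@integrable_dominated _ K) => y yI; have [h1 h2 _] := path yI.
  exact: (continuous_gain_drr a_gt0 delta_gt0 (cu (y := y)) (cL (y := y)) h1 h2).
by have [_ _ h _] := HK y yI.
Qed.

Lemma integrable_k_t du dL :
  mu.-integrable `]0, 1[ (EFin \o (fun y : R => k_t (tau * (1 - y)) (tau * y) r du dL)).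
Proof.
have [K HK] := bounds; apply: (@integrable_dominated _ (K * (`|du| + `|dL|))) => y yI; have [h1 h2 _] := path yI.
  exact: (continuous_gain_dt a_gt0 delta_gt0 (cu (y := y)) (cL (y := y)) h1 h2).
have [h0 _ _ h] := HK y yI; apply: (le_trans (h du dL)).
have K0 : 0 <= K by exact: le_trans (normr_ge0 _) h0.
rewrite -mulrA ler_wpM2l// mulrDl lerD2l ler_peMr// lerDl.
exact: ou_sd_dt_ge0.
Qed.

(* The integrand is the derivative of (y - 1) k(tau (1 - y), tau y), which vanishes at
   y = 1 and tends to - excess tau r at y = 0. *)
Lemma FTC_gain :
  \int[mu]_(y in `]0, 1[) (k (tau * (1 - y)) (tau * y) r
    + (y - 1) * k_t (tau * (1 - y)) (tau * y) r tau (- tau)) = excess a b delta tau r.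
Proof.
pose F (y : R) := (y - 1) * k (tau * (1 - y)) (tau * y) r.
have dF (y : R) : 0 < y < 1 -> is_derive y 1 F (k (tau * (1 - y)) (tau * y) r
    + (y - 1) * k_t (tau * (1 - y)) (tau * y) r tau (- tau)).
  move=> /path[h1 h2 _].
  have h := is_derive_gain b a_gt0 delta_gt0 r h1 h2 (is_derive_u y) (is_derive_L y).
  have := is_deriveM (is_deriveB (is_derive_id y (1 : R)) (is_derive_cst (1 : R) y 1)) h.
  by move/is_derive_eq; apply; rewrite /GRing.scale/= subr0 mulr1 addrC.
have cm (y : R) : {for y, continuous (fun y : R => y - 1)}.
  by apply: cvgB; [exact: cvg_id|exact: cvg_cst].
have cf (y : R) : 0 < y < 1 -> {for y, continuous (fun y : R => k (tau * (1 - y)) (tau * y) r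
    + (y - 1) * k_t (tau * (1 - y)) (tau * y) r tau (- tau))}.
  move=> /path[h1 h2 _]; apply: cvgD.
    exact: (continuous_bs_gain a_gt0 delta_gt0 (cu (y := y)) (cL (y := y)) h1 h2).
  apply: cvgM; first exact: cm.
  exact: (continuous_gain_dt a_gt0 delta_gt0 (cu (y := y)) (cL (y := y)) h1 h2).
have [K HK] := bounds.
have fi : mu.-integrable `]0, 1[ (EFin \o (fun y : R => k (tau * (1 - y)) (tau * y) r
    + (y - 1) * k_t (tau * (1 - y)) (tau * y) r tau (- tau))).
  apply: (@integrable_dominated _ (K + K * (`|tau| + `|tau|))) => // y yI.
  have [h0 _ _ h] := HK y yI.
  have K0 : 0 <= K by exact: le_trans (normr_ge0 _) h0.
  rewrite [leRHS]mulrDl; apply: (le_trans (ler_normD _ _)); apply: lerD; first exact: K_dominates.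
  rewrite normrM; apply: (@le_trans _ _ (1 * `|k_t (tau * (1 - y)) (tau * y) r tau (- tau)|)).
    by move/andP: yI => [y0 y1]; rewrite ler_wpM2r// ler_norml; apply/andP; split; lra.
  rewrite mul1r; apply: (le_trans (h _ _)).
  rewrite -mulrA ler_wpM2l// [leRHS]mulrDl lerD2l normrN ler_peMr// lerDl.
  exact: ou_sd_dt_ge0.
have lo_I n : 0 < inner_lo (1 : R) n < 1.
  by rewrite inner_lo_gt0//= (lt_trans (inner_lo_lt ltr01 _))// inner_hi_lt.
have hi_I n : 0 < inner_hi (1 : R) n < 1.
  by rewrite inner_hi_lt//= andbT (lt_trans (inner_lo_gt0 ltr01 _) (inner_lo_lt ltr01 _)).
rewrite (FTC2_open ltr01 cf dF (l0 := - excess a b delta tau r) (l1 := 0) fi) ?sub0r ?opprK//.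
- rewrite -mulN1r; apply: cvgM.
    rewrite -[X in _ --> X](sub0r 1); apply: cvgB; last exact: cvg_cst.
    exact: cvg_inner_lo.
  have h : tau * inner_lo (1 : R) n @[n --> \oo] --> 0.
    rewrite -[X in _ --> X](mulr0 tau); apply: cvgM; first exact: cvg_cst.
    exact: cvg_inner_lo.
  (* The limit is found on the Gaussian form [gain] and carried to the closed form along the
     interior points, where the two agree. *)
  have h2 : gain a b delta (tau - tau * inner_lo 1 n) (tau * inner_lo 1 n) r @[n --> \oo]
      --> excess a b delta tau r by exact: cvg_gain_at0.
  suff <- : (fun n => gain a b delta (tau - tau * inner_lo 1 n) (tau * inner_lo 1 n) r) =
    fun n => k (tau * (1 - inner_lo 1 n)) (tau * inner_lo 1 n) r by [].
  apply/funext => n; have [h3 h4 _] := path (lo_I n).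
  have -> : tau - tau * inner_lo 1 n = tau * (1 - inner_lo 1 n) by rewrite mulrBr mulr1.
  exact: gain_bs_gain.
(* At y = 1 the factor y - 1 vanishes and boundedness of [k] is enough; no limit of [k] is needed
   there. *)
have hK n : `|F (inner_hi 1 n)| <= (1 - inner_hi 1 n) * K.
  have [h0 _ _ _] := HK _ (hi_I n).
  by rewrite /F normrM ler_pM// distrC ger0_norm// subr_ge0 ltW// inner_hi_lt.
have hc : (1 - inner_hi 1 n) * K @[n --> \oo] --> 0.
  rewrite -[X in _ --> X](mul0r K); apply: cvgM; last exact: cvg_cst.
  rewrite -[X in _ --> X](subrr (1 : R)); apply: cvgB; [exact: cvg_cst|exact: cvg_inner_hi].
apply: norm_cvg0; apply: (squeeze_cvgr _ (cvg_cst 0) hc).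
by apply: nearW => n; rewrite normr_ge0 hK.
Qed.

End fixed_maturity.

(* Substituting u = tau y fixes the domain of integration, so that one can differentiate
   in tau under the integral sign. *)
Definition total_gain tau r : R :=
  tau * \int[mu]_(y in `]0, 1[) k (tau * (1 - y)) (tau * y) r.

Lemma total_gainE tau r : 0 < tau ->
  \int[mu]_(u in `]0, tau[) gain a b delta (tau - u) u r = total_gain tau r.
Proof.
move=> t0; rewrite /total_gain /Rintegral.
pose f : R -> R := fun u => gain a b delta (tau - u) u r.
have f0 u : 0 <= f u.
  rewrite /f /gain mulr_ge0 ?expR_ge0// fine_ge0//; apply: gaussE_ge0 => z.
  by rewrite lee_fin excess_ge0.
pose g : R -> \bar R := (EFin \o f) \_ `]0, tau[.
have mg : measurable_fun setT g.
  apply/(measurable_restrictT _ (measurable_itv _)); apply: measurable_funTS.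
  by apply/measurable_EFinP; exact: measurable_gain.
have g0 z : (0 <= g z)%E by rewrite /g patchE; case: ifPn => // _; rewrite lee_fin.
rewrite integral_mkcond (_ : (\int[mu]_x _)%E = (\int[mu]_x g x)%E)//.
rewrite (@lebesgue_integral_affine R 0 tau g t0 mg g0).
have -> : (\int[mu]_x g (0 + tau * x)%R = \int[mu]_(y in `]0%R, 1%R[)
    (k (tau * (1 - y)) (tau * y) r)%:E)%E.
  rewrite [RHS]integral_mkcond; apply: eq_integral => y _.
  rewrite /g !patchE add0r !mem_setE !in_itv/= pmulr_rgt0//.
  have -> : (tau * y < tau) = (y < 1) by rewrite -[ltRHS]mulr1 ltr_pM2l.
  case: ifPn => // /andP[y0 y1]; rewrite /f.
  rewrite (_ : tau - tau * y = tau * (1 - y)); last by ring.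
  by rewrite gain_bs_gain// mulr_gt0// subr_gt0.
rewrite fineM//; exact: integrable_fin_num (integrable_k t0 r).
Qed.

End total_gain.

Section total_gain_derivatives.
Variables (R : realType) (a b delta : R).
Hypotheses (a_gt0 : 0 < a) (delta_gt0 : 0 < delta).
Notation mu := lebesgue_measure.
Local Notation sd := (ou_sd a delta).
Local Notation sd' := (ou_sd_dt a delta).
Local Notation k := (bs_gain a b delta).
Local Notation k_r := (gain_dr a b delta).
Local Notation k_rr := (gain_drr a b delta).
Local Notation k_t := (gain_dt a b delta).
Local Notation G := (total_gain a b delta).
Let mI : @measurable _ (measurableTypeR R) `]0, 1[%classic.
Proof. exact: measurable_itv. Qed.

Definition total_gain_r tau r : R :=
  tau * \int[mu]_(y in `]0, 1[) k_r (tau * (1 - y)) (tau * y) r.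

Definition total_gain_rr tau r : R :=
  tau * \int[mu]_(y in `]0, 1[) k_rr (tau * (1 - y)) (tau * y) r.

Let gain_bounds_path (c rad : R) : exists K, 0 <= K /\
  forall tau y r, 0 < tau <= c -> 0 < y < 1 -> `|r| <= rad ->
  [/\ `|k (tau * (1 - y)) (tau * y) r| <= K, `|k_r (tau * (1 - y)) (tau * y) r| <= K,
    `|k_rr (tau * (1 - y)) (tau * y) r| <= K * (1 + sd' (tau * y)) &
    forall du dL, `|k_t (tau * (1 - y)) (tau * y) r du dL|
      <= K * (`|du| * (1 + sd' (tau * y)) + `|dL|)].
Proof.
have [K HK] := gain_bounds b delta a_gt0 c rad; exists `|K|; split => //.
move=> tau y r /andP[t0 tc] /andP[y0 y1] rr.
have h1 : 0 < tau * y by exact: mulr_gt0.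
have h2 : 0 < tau * (1 - y) by rewrite mulr_gt0// subr_gt0.
have h3 : tau * y + tau * (1 - y) <= c.
  by rewrite (_ : _ + _ = tau)//; ring.
have [b1 b2 b3 b4] := HK _ _ _ h1 h2 h3 rr.
have s0 := ou_sd_dt_ge0 a delta (tau * y).
have KK := ler_norm K.
split.
- exact: le_trans b1 _.
- exact: le_trans b2 _.
- by apply: (le_trans b3); rewrite ler_wpM2r// addr_ge0.
- move=> du dL; apply: (le_trans (b4 du dL)); rewrite ler_wpM2r//.
  by rewrite addr_ge0// mulr_ge0// addr_ge0.
Qed.

Section maturity_fixed.
Variables (tau r : R).
Hypothesis tau_gt0 : 0 < tau.

Let tt : 0 < tau <= tau. Proof. by rewrite tau_gt0 lexx. Qed.
Let rI : r - 1 < r < r + 1. Proof. by apply/andP; split; lra. Qed.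
Let rad (q : R) : r - 1 < q < r + 1 -> `|q| <= `|r| + 1.
Proof.
move=> /andP[h1 h2]; rewrite -[q](subrK r) addrC (le_trans (ler_normD _ _))// lerD2l.
by rewrite ler_norml; apply/andP; split; lra.
Qed.

Let scaled (f : R -> R) (df : R) : is_derive r 1 f df ->
  is_derive r 1 (fun q => tau * f q) (tau * df).
Proof. exact: is_deriveZ. Qed.

Lemma is_derive_total_gain_r : is_derive r 1 (G tau) (total_gain_r tau r).
Proof.
have [K [K0 HK]] := gain_bounds_path tau (`|r| + 1).
apply: scaled.
apply: (@is_derive_under_integral _ (measurableTypeR R) R mu _
  (fun q y => k (tau * (1 - y)) (tau * y) q) (fun q y => k_r (tau * (1 - y)) (tau * y) q)
  (fun _ => K) r (r - 1) (r + 1) mI rI).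
- by move=> q _; exact: integrable_k.
- move=> q y _; rewrite /= in_itv/= => /andP[y0 y1].
  by apply: is_derive_gain_r => //; rewrite mulr_gt0// subr_gt0.
- by [].
- by apply: (@bounded_integrable R 1 (fun _ => K) _ K) => [x _|x _]; [exact: cst_continuous|rewrite ger0_norm].
- move=> q y qI; rewrite /= in_itv/= => yI.
  by have [_ h _ _] := HK _ _ _ tt yI (rad qI).
Qed.

Lemma is_derive_total_gain_rr :
  is_derive r 1 (total_gain_r tau) (total_gain_rr tau r).
Proof.
have [K [K0 HK]] := gain_bounds_path tau (`|r| + 1).
apply: scaled.
apply: (@is_derive_under_integral _ (measurableTypeR R) R mu _
  (fun q y => k_r (tau * (1 - y)) (tau * y) q) (fun q y => k_rr (tau * (1 - y)) (tau * y) q)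
  (fun y => K * (1 + sd' (tau * y))) r (r - 1) (r + 1) mI rI).
- by move=> q _; exact: integrable_k_r.
- move=> q y _; rewrite /= in_itv/= => /andP[y0 y1].
  by apply: is_derive_gain_rr => //; rewrite mulr_gt0// subr_gt0.
- by move=> y; rewrite mulr_ge0// addr_ge0// ou_sd_dt_ge0.
- have i1 : mu.-integrable `]0, 1[ (EFin \o (fun _ : R => 1 : R)).
    by apply: (@bounded_integrable R 1 (fun _ => 1) _ 1) => [x _|x _]; [exact: cst_continuous|rewrite normr1].
  exact: (integrableZl mI K (integrableD mI i1 (integrable_ou_sd_dt_scale a_gt0 delta_gt0 tau_gt0))).
- move=> q y qI; rewrite /= in_itv/= => yI.
  by have [_ _ h _] := HK _ _ _ tt yI (rad qI).
Qed.

(** The lower end keeps 1 / s below 2 / tau in the dominating constant. *)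
Let tI : tau / 2 < tau < tau + tau.
Proof. by rewrite ltr_pdivrMr// ltr_pMr// ltr1n ltrDl tau_gt0. Qed.

(** For fixed [y] the point (u, L) = (s y, s (1 - y)) moves with velocity (y, 1 - y) = (1, 0) + (y -
    1) (1, -1). The second direction keeps the maturity u + L fixed, and [FTC_gain] integrates it to
    the excess; the first is left for the backward equation. *)
Lemma is_derive_total_gain_t : is_derive tau 1 (G ^~ r)
  (excess a b delta tau r
   + tau * \int[mu]_(y in `]0, 1[) k_t (tau * (1 - y)) (tau * y) r 1 0).
Proof.
have [K [K0 HK]] := gain_bounds_path (tau + tau) `|r|.
pose S := 1 + delta ^+ 2 / (2 * a).
have S0 : 0 <= S by rewrite addr_ge0// divr_ge0 ?sqr_ge0// mulr_ge0// ltW.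
pose C := K * (1 + S * (2 / tau) + 1).
have C0 : 0 <= C by rewrite mulr_ge0// !addr_ge0// mulr_ge0// divr_ge0// ltW.
have h : is_derive tau 1 (fun s => \int[mu]_(y in `]0, 1[) k (s * (1 - y)) (s * y) r : R)
    (\int[mu]_(y in `]0, 1[) k_t (tau * (1 - y)) (tau * y) r y (1 - y)).
  apply: (@is_derive_under_integral _ (measurableTypeR R) R mu _
    (fun s y => k (s * (1 - y)) (s * y) r) (fun s y => k_t (s * (1 - y)) (s * y) r y (1 - y))
    (fun _ => C) tau (tau / 2) (tau + tau) mI tI).
  - move=> s /andP[s1 _]; apply: integrable_k => //.
    by rewrite (lt_trans _ s1)// divr_gt0.
  - move=> s y /andP[s1 _]; rewrite /= in_itv/= => /andP[y0 y1].
    have s0 : 0 < s by rewrite (lt_trans _ s1)// divr_gt0.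
    have is_derive_lin (w : R) : is_derive s (1 : R) (fun s => s * w) w.
      have := is_deriveM (is_derive_id s (1 : R)) (is_derive_cst w s (1 : R)).
      by move/is_derive_eq; apply; rewrite /GRing.scale/= mulr0 add0r mulr1.
    apply: (is_derive_gain b a_gt0 delta_gt0 r _ _ (is_derive_lin y) (is_derive_lin (1 - y))).
      exact: mulr_gt0.
    by rewrite mulr_gt0// subr_gt0.
  - by [].
  - by apply: (@bounded_integrable R 1 (fun _ => C) _ C) => [x _|x _]; [exact: cst_continuous|rewrite ger0_norm].
  - move=> s y /andP[s1 s2]; rewrite /= in_itv/= => yI; have /andP[y0 y1] := yI.
    have s0 : 0 < s by rewrite (lt_trans _ s1)// divr_gt0.
    have sI : 0 < s <= tau + tau by rewrite s0 ltW.
    have [_ _ _ B] := HK _ _ _ sI yI (lexx _).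
    apply: (le_trans (B y (1 - y))); rewrite /C ler_wpM2l//.
    rewrite !ger0_norm ?subr_ge0 ?(ltW y0) ?(ltW y1)//.
    apply: lerD; last by rewrite gerBl ltW.
    rewrite mulrDr mulr1; apply: lerD; first exact: ltW.
    have sy0 : 0 < s * y by exact: mulr_gt0.
    have h1 := le_trans (ou_sd_dt_le a_gt0 delta_gt0 sy0) (ou_sd_le delta a_gt0 (s * y)).
    have -> : y * sd' (s * y) = (s * y * sd' (s * y)) / s by field; rewrite gt_eqF.
    apply: ler_pM => //; first by rewrite mulr_ge0 ?ou_sd_dt_ge0// ltW.
      by rewrite invr_ge0 ltW.
    by rewrite -[leRHS]invf_div lef_pV2 ?posrE ?divr_gt0// ltW.
have := is_deriveM (is_derive_id tau (1 : R)) h.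
move/is_derive_eq; apply; rewrite /GRing.scale/= mulr1.
rewrite -(FTC_gain b a_gt0 delta_gt0 tau_gt0 r).
have ik := integrable_k b a_gt0 delta_gt0 tau_gt0 r.
have it := integrable_k_t b a_gt0 delta_gt0 tau_gt0 r 1 0.
have iw : mu.-integrable `]0, 1[
    (EFin \o (fun y : R => (y - 1) * k_t (tau * (1 - y)) (tau * y) r 1 (-1))).
  have i1 := integrable_k_t b a_gt0 delta_gt0 tau_gt0 r 1 (-1).
  apply: le_integrable (i1) => //.
    apply/measurable_EFinP; apply: measurable_funM.
      exact: measurable_funB.
    by apply/measurable_EFinP; exact: measurable_int i1.
  move=> y; rewrite /= in_itv/= => /andP[y0 y1].
  by rewrite lee_fin normrM ler_piMl// ler_norml; apply/andP; split; lra.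
have iwt := integrableZl mI tau iw.
have -> : \int[mu]_(y in `]0, 1[) k_t (tau * (1 - y)) (tau * y) r y (1 - y) =
  \int[mu]_(y in `]0, 1[) (k_t (tau * (1 - y)) (tau * y) r 1 0
    + (y - 1) * k_t (tau * (1 - y)) (tau * y) r 1 (-1)).
  by apply: eq_Rintegral => y _; rewrite /gain_dt; ring.
have -> : \int[mu]_(y in `]0, 1[) (k (tau * (1 - y)) (tau * y) r
    + (y - 1) * k_t (tau * (1 - y)) (tau * y) r tau (- tau)) =
  \int[mu]_(y in `]0, 1[) (k (tau * (1 - y)) (tau * y) r
    + tau * ((y - 1) * k_t (tau * (1 - y)) (tau * y) r 1 (-1))).
  by apply: eq_Rintegral => y _; rewrite /gain_dt; ring.
rewrite (@RintegralD _ (measurableTypeR R) R mu _ _ _ mI it iw).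
rewrite (@RintegralD _ (measurableTypeR R) R mu _ _ _ mI ik iwt).
rewrite (@RintegralZl _ (measurableTypeR R) R mu _ _ _ mI iw).
by ring.
Qed.

Lemma total_gain_pde :
  tau * \int[mu]_(y in `]0, 1[) k_t (tau * (1 - y)) (tau * y) r 1 0 =
  a * (b - r) * total_gain_r tau r + delta ^+ 2 / 2 * total_gain_rr tau r - r * G tau r.
Proof.
have i1 := integrable_k b a_gt0 delta_gt0 tau_gt0 r.
have i2 := integrable_k_r b a_gt0 delta_gt0 tau_gt0 r.
have i3 := integrable_k_rr b a_gt0 delta_gt0 tau_gt0 r.
have j1 := integrableZl mI r i1.
have j2 := integrableZl mI (a * (b - r)) i2.
have j3 := integrableZl mI (delta ^+ 2 / 2) i3.
rewrite /total_gain_r /total_gain_rr /total_gain.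
have -> : \int[mu]_(y in `]0, 1[) k_t (tau * (1 - y)) (tau * y) r 1 0 =
  \int[mu]_(y in `]0, 1[) (a * (b - r) * k_r (tau * (1 - y)) (tau * y) r
    + delta ^+ 2 / 2 * k_rr (tau * (1 - y)) (tau * y) r - r * k (tau * (1 - y)) (tau * y) r).
  by apply: eq_Rintegral => y _; rewrite gain_dt_pde.
rewrite (@RintegralB _ (measurableTypeR R) R mu _ _ _ mI (integrableD mI j2 j3) j1).
rewrite (@RintegralD _ (measurableTypeR R) R mu _ _ _ mI j2 j3).
rewrite (RintegralZl _ mI i1) (RintegralZl _ mI i2) (RintegralZl _ mI i3).
by ring.
Qed.

End maturity_fixed.

End total_gain_derivatives.

(** * The HJB equation *)

(** A linear function on an interval is maximal at an end: [xi] if the slope is nonnegative, 0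
    otherwise. *)
Lemma sup_bang_bang (R : realType) (xi p : R) : 0 <= xi ->
  sup [set c * p | c in `[0, xi]] = xi * Num.max 0 p.
Proof.
move=> xi0; set S := [set _ | _ in _].
have ub c : 0 <= c <= xi -> c * p <= xi * Num.max 0 p.
  move=> /andP[c0 cxi]; have [p0|p0] := leP 0 p; first exact: ler_wpM2r.
  by rewrite mulr0 mulr_ge0_le0// ltW.
have bS : ubound S (xi * Num.max 0 p).
  by move=> _ [c + <-]; rewrite /= in_itv; exact: ub.
have Sm : S (xi * Num.max 0 p).
  have [p0|p0] := leP 0 p.
    by exists xi; rewrite //= in_itv/= xi0 lexx.
  by exists 0; rewrite ?mul0r ?mulr0//= in_itv/= xi0 lexx.
apply/eqP; rewrite eq_le; apply/andP; split.
  by apply: ge_sup => //; exists (xi * Num.max 0 p).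
by apply: ub_le_sup => //; exists (xi * Num.max 0 p).
Qed.

Section hjb.
Variables (R : realType) (a b delta sigma xi m T : R).
Hypotheses (a_gt0 : 0 < a) (delta_gt0 : 0 < delta) (xi_gt0 : 0 < xi).
Local Notation beta := (ou_beta a).
Local Notation disc := (ou_disc a b delta).
Local Notation G := (total_gain a b delta).

Definition value_of_maturity tau r x : R := (x + m * tau) * disc tau r + xi * G tau r.

Lemma is_derive_value_x (tau r x : R) :
  is_derive x 1 (value_of_maturity tau r) (disc tau r).
Proof.
have h := is_deriveD (is_deriveM (is_deriveD (is_derive_id x (1 : R))
  (is_derive_cst (m * tau) x (1 : R))) (is_derive_cst (disc tau r) x (1 : R)))
  (is_derive_cst (xi * G tau r) x (1 : R)).
by move/is_derive_eq : h; apply; rewrite /GRing.scale/= !addr0 mulr0 add0r mulr1.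
Qed.

Lemma is_derive_value_r (tau r x : R) : 0 < tau ->
  is_derive r 1 (fun q => value_of_maturity tau q x)
    ((x + m * tau) * (- beta tau * disc tau r) + xi * total_gain_r a b delta tau r).
Proof.
move=> t0; exact: (is_deriveD (is_deriveZ (x + m * tau) (is_derive_disc_r a b delta tau r))
  (is_deriveZ xi (is_derive_total_gain_r b a_gt0 delta_gt0 r t0))).
Qed.

Lemma is_derive_value_rr (tau r x : R) : 0 < tau ->
  is_derive r 1 (fun q => (x + m * tau) * (- beta tau * disc tau q)
      + xi * total_gain_r a b delta tau q)
    ((x + m * tau) * (- beta tau * (- beta tau * disc tau r))
      + xi * total_gain_rr a b delta tau r).
Proof.
move=> t0; exact: (is_deriveD (is_deriveZ (x + m * tau) (is_deriveZ (- beta tau) (is_derive_disc_r a b delta tau r)))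
  (is_deriveZ xi (is_derive_total_gain_rr b a_gt0 delta_gt0 r t0))).
Qed.

Lemma is_derive_value_t (t r x : R) : t < T ->
  is_derive t 1 (fun s => value_of_maturity (T - s) r x)
    (- (m * disc (T - t) r + (x + m * (T - t)) * disc_dt a b delta (T - t) r
        + xi * (excess a b delta (T - t) r
           + (T - t) * \int[lebesgue_measure]_(y in `]0, 1[)
               gain_dt a b delta ((T - t) * (1 - y)) ((T - t) * y) r 1 0))).
Proof.
move=> tT; have t0 : 0 < T - t by rewrite subr_gt0.
have hT := is_deriveB (is_derive_cst T t (1 : R)) (is_derive_id t (1 : R)).
have hd := is_derive_disc b delta a_gt0 r hT.
have hG := @is_derive1_comp R (G ^~ r) (fun s => T - s) t _ _
  (is_derive_total_gain_t b a_gt0 delta_gt0 r t0) hT.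
have h := is_deriveD (is_deriveM (is_deriveD (is_derive_cst x t (1 : R)) (is_deriveZ m hT)) hd)
  (is_deriveZ xi hG).
move/is_derive_eq : h; apply; rewrite /GRing.scale/=.
rewrite (_ : (cst x + _) t = x + m * (T - t))// (_ : (cst T - id) t = T - t)//.
by ring.
Qed.

Lemma candidate_solves_HJB (v : R -> R -> R -> R) :
  (forall t r x, 0 <= t < T -> v t r x = value_of_maturity (T - t) r x) ->
  solves_HJB a b delta sigma xi m T v.
Proof.
move=> vE t r x tI vx vr; have /andP[t_ge0 tT] := tI.
have t0 : 0 < T - t by rewrite subr_gt0.
have vxE : vx = fun=> disc (T - t) r.
  apply/funext => y; rewrite /vx derive1E (_ : v t r = value_of_maturity (T - t) r).
    exact: (@derive_val _ _ _ _ _ _ _ (is_derive_value_x (T - t) r y)).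
  by apply/funext => z; exact: vE.
have vrfE : (fun y => v t y x) = (fun y => value_of_maturity (T - t) y x).
  by apply/funext => y; exact: vE.
have vrE : vr = fun q => (x + m * (T - t)) * (- beta (T - t) * disc (T - t) q)
      + xi * total_gain_r a b delta (T - t) q.
  apply/funext => q; rewrite /vr derive1E vrfE.
  exact: (@derive_val _ _ _ _ _ _ _ (is_derive_value_r q x t0)).
split.
- rewrite (_ : v t r = value_of_maturity (T - t) r).
    exact: (@ex_derive _ _ _ _ _ _ _ (is_derive_value_x (T - t) r x)).
  by apply/funext => z; exact: vE.
- rewrite vxE; exact: derivable_cst.
- rewrite vrfE; exact: (@ex_derive _ _ _ _ _ _ _ (is_derive_value_r r x t0)).
- rewrite vrE; exact: (@ex_derive _ _ _ _ _ _ _ (is_derive_value_rr r x t0)).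
have ht := is_derive_value_t r x tT.
set dt := - (_ + _) in ht.
exists dt.
  pose q h := h^-1 *: (value_of_maturity (T - (h *: 1 + t)) r x - value_of_maturity (T - t) r x).
  have q_cvg : q h @[h --> (0 : R)^'] --> dt.
    have := @ex_derive _ _ _ _ _ _ _ ht.
    by rewrite /derivable -/q -(@derive_val _ _ _ _ _ _ _ ht).
  (* The formula is differentiable on both sides of [t], also at t = 0, so restricting its
     difference quotients to times in [[0, T]] keeps the limit; for small h these times are below T,
     where [v] is given by the formula. *)
  have : q h @[h --> within [set h | `[0, T]%classic (t + h)] (0 : R)^'] --> dt.
    exact: cvg_within_filter.
  apply: cvg_trans; apply: near_eq_cvg; rewrite near_withinE.
  have : \forall h \near (0 : R)^', h < T - t.
    by apply: cvg_within; exact: lt_nbhsl.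
  apply: filterS => h hT; rewrite /= in_itv/= => /andP[th0 _].
  rewrite /q /GRing.scale/= mulr1 (addrC h t) !vE// th0/=.
  by rewrite -ltrBrDl.
rewrite vxE vrE derive1E derive_cst sup_bang_bang; last exact: ltW.
rewrite (vE _ _ _ tI) derive1E (@derive_val _ _ _ _ _ _ _ (is_derive_value_rr r x t0)).
(* The terms in M cancel by the form of [disc_dt], those in the total gain by [total_gain_pde], the
   drift [m] against the derivative of m tau, and xi times the excess against the supremum. *)
rewrite /dt total_gain_pde// /value_of_maturity /disc_dt /excess.
by field.
Qed.

End hjb.

Theorem theorem2p11 (d : measure_display) (Omega : measurableType d)
    (R : realType) (P : probability Omega R)
    (a b delta sigma xi mu T : R)
    (W B : R -> Omega -> R) (rho : R -> R -> R -> Omega -> R)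
    (a_gt0 : 0 < a) (delta_gt0 : 0 < delta) (sigma_gt0 : 0 < sigma)
    (xi_gt0 : 0 < xi) (T_gt0 : 0 < T) (btilde_gt0 : 0 < btilde a b delta)
    (W_brownian : brownian_motion P W) (B_brownian : brownian_motion P B)
    (WB_independent : independent_processes P W B)
    (rho_OU : forall t r : R, 0 <= t <= T ->
       OU_process P a b delta B t r (rho t r)) :
  let V := value_function P rho W B mu sigma xi T in
  let M := discount P rho in
  let v := candidate M a b delta xi mu T in
  let cstar (t r : R) (s : R) (w : Omega) : R :=
    if alpha a b delta T s < rho t r s w then xi else 0 in
  [/\ forall t r x : R, 0 <= t <= T -> (v t r x)%:E = V t r x,
      solves_HJB a b delta sigma xi mu T v
    & forall t r x : R, 0 <= t <= T ->
        admissible P W B xi T t (cstar t r) /\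
        return_function P rho W mu sigma T (cstar t r) t r x = V t r x].
Proof.
move=> V M v cstar.
have ME u r : 0 <= u <= T -> M u r = ou_disc a b delta u r.
  move=> /andP[u0 uT]; rewrite /M /discount unlock.
  have T0 : 0 <= (0 : R) <= T by rewrite lexx ltW.
  have := expectation_disc W_brownian B_brownian WB_independent a_gt0 delta_gt0
    (lexx 0) (rho_OU _ r T0) u0.
  by rewrite subr0 => ->.
(* The common value: the candidate equals it by rewriting the inner integral as the gain, every
   return is bounded by it, and the threshold strategy attains it. *)
pose val t r x := (x + mu * (T - t)) * ou_disc a b delta (T - t) r
  + xi * \int[lebesgue_measure]_(u in `]0, T - t[) gain a b delta (T - t - u) u r.
have vE t r x : 0 <= t <= T -> v t r x = val t r x.
  move=> tI; rewrite /v /candidate (Gtilde_gain a_gt0 delta_gt0 _ _ _ tI ME) ME.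
    by rewrite /val addrA -mulrDl.
  by case/andP: tI => t0 tT; rewrite subr_ge0 tT/= gerBl.
have V_le t r x c : 0 <= t <= T -> admissible P W B xi T t c ->
    (return_function P rho W mu sigma T c t r x <= (val t r x)%:E)%E.
  move=> tI; have /andP[t0 tT] := tI; move=> cA.
  exact: (return_le_value W_brownian B_brownian WB_independent sigma mu x a_gt0 delta_gt0 xi_gt0 t0 tT (rho_OU _ r tI)).
have cA t r : 0 <= t <= T -> admissible P W B xi T t (cstar t r).
  move=> tI; have /andP[t0 tT] := tI.
  exact: (cstar_admissible W B_brownian T a_gt0 xi_gt0 t0 (rho_OU _ r tI)).
have cR t r x : 0 <= t <= T ->
    return_function P rho W mu sigma T (cstar t r) t r x = (val t r x)%:E.
  move=> tI; have /andP[t0 tT] := tI.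
  exact: (return_cstar W_brownian B_brownian WB_independent sigma mu x a_gt0 delta_gt0 xi_gt0 t0 tT (rho_OU _ r tI)).
have VE t r x : 0 <= t <= T -> V t r x = (val t r x)%:E.
  move=> tI; rewrite /V /value_function; apply/eqP; rewrite eq_le; apply/andP; split.
    by apply: ge_ereal_sup => _ [c cAd <-]; exact: V_le.
  by apply: ereal_sup_ubound; exists (cstar t r); [exact: cA|exact: cR].
split.
- by move=> t r x tI; rewrite vE// VE.
- apply: candidate_solves_HJB => // t r x /andP[t0 tT].
  rewrite vE ?t0 ?ltW// /val /value_of_maturity total_gainE// subr_gt0//.
- by move=> t r x tI; split; [exact: cA|rewrite VE//; exact: cR].
Qed.
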